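(* Let $b>0$, $1<p<\infty$, and let $u$ be a convex weak solution to $$-b\,\operatorname{div}\left(\frac{\nabla u}{|\nabla u|}\right)-\operatorname{div}\left(|\nabla u|^{p-2}\nabla u\right)=0\quad\text{in }\mathbb{R}^n .$$ Then the facet $F=\{x\in\mathbb{R}^n\mid u(x)\le u(y)\text{ for all }y\in\mathbb{R}^n\}$ of $u$ satisfies either $F=\emptyset$ or $F=\mathbb{R}^n$. In particular: (1) if $u$ attains its minimum in $\mathbb{R}^n$, then $u$ is constant; (2) if $u$ does not attain its minimum in $\mathbb{R}^n$, then $u$ is a non-constant affine function in $\mathbb{R}^n$.
   Context: $\langle\cdot\mid\cdot\rangle$ is the standard inner product on $\mathbb{R}^n$. For $z\in\mathbb{R}^n$, $\partial|\cdot|(z)$ is the subdifferential of the Euclidean norm at $z$: it equals $\{z/|z|\}$ if $z\ne0$ and the closed unit ball if $z=0$. The vector $|z|^{p-2}z$ is understood as $0$ for $z=0$. Weak solution: $u\in W^{1,p}_{\mathrm{loc}}(\mathbb{R}^n)$ is a weak solution of the equation in $\mathbb{R}^n$ if for every bounded Lipschitz domain $\omega\subset\mathbb{R}^n$ there exists $Z\in L^\infty(\omega,\mathbb{R}^n)$ such that $Z(x)\in\partial|\cdot|(\nabla u(x))$ for a.e. $x\in\omega$ and $$b\int_\omega\langle Z\mid\nabla\phi\rangle\,dx+\int_\omega\langle|\nabla u|^{p-2}\nabla u\mid\nabla\phi\rangle\,dx=0\quad\text{for all }\phi\in W^{1,p}_0(\omega).$$ *)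

(* Defs.v *)
From HB Require Import structures.
From mathcomp Require Import all_boot all_order all_algebra.
From mathcomp Require Import all_classical all_reals all_analysis.
From mathcomp Require Import ring lra.

Set Implicit Arguments.
Unset Strict Implicit.
Unset Printing Implicit Defensive.

Import Order.TTheory GRing.Theory Num.Theory.
Import numFieldNormedType.Exports.

Local Open Scope classical_set_scope.
Local Open Scope ring_scope.

Definition rV_display : measure_display -> measure_display.
Proof. exact. Qed.

Section rV_measurable.
Context d (T : measurableType d) (n : nat).

Let coord (i : 'I_n) (x : 'rV[T]_n) : T := x ord0 i.

Let rV_set0 : g_sigma_preimage coord set0.
Proof. exact: sigma_algebra0. Qed.

Let rV_setC A : g_sigma_preimage coord A -> g_sigma_preimage coord (~` A).
Proof. exact: sigma_algebraC. Qed.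

Let rV_bigcup (F : _^nat) : (forall i, g_sigma_preimage coord (F i)) ->
  g_sigma_preimage coord (\bigcup_i (F i)).
Proof. exact: sigma_algebra_bigcup. Qed.

(* R^n carries the product sigma-algebra, i.e. the one generated by the
   coordinate maps; for T = R these are the Borel sets of R^n. *)
HB.instance Definition _ := @isMeasurable.Build (rV_display d)
  'rV[T]_n (g_sigma_preimage coord) rV_set0 rV_setC rV_bigcup.

Lemma measurable_coord (i : 'I_n) :
  measurable_fun [set: 'rV[T]_n] (fun x : 'rV[T]_n => x ord0 i).
Proof.
move=> _ Y mY; rewrite setTI; apply: sub_sigma_algebra => /=.
rewrite -bigcup_seq/=; exists i => /=; first by rewrite mem_index_enum.
by exists Y => //; rewrite setTI.
Qed.

Lemma measurable_fun_rV d' (S : measurableType d') (f : S -> 'rV[T]_n) :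
  (forall i, measurable_fun [set: S] (fun s => f s ord0 i)) ->
  measurable_fun [set: S] f.
Proof.
move=> mf; have pf : preimage_set_system [set: S] f
    (g_sigma_preimage coord) `<=` measurable.
  rewrite -g_sigma_preimage_comp; apply: smallest_sub.
    exact: sigma_algebra_measurable.
  rewrite -bigcup_seq/= => _ [i _] [Y mY <-].
  exact: mf.
by move=> _ Y mY; apply: pf; exists Y.
Qed.

End rV_measurable.

Lemma sigma_finite_prod d1 d2 (T1 : measurableType d1) (T2 : measurableType d2)
    (R : realType) (m1 : {sigma_finite_measure set T1 -> \bar R})
    (m2 : {sigma_finite_measure set T2 -> \bar R}) :
  sigma_finite setT (m1 \x m2)%E.
Proof.
have /sigma_finiteP[F [TF ndF Foo]] := sigma_finiteT m1.
have /sigma_finiteP[G [TG ndG Goo]] := sigma_finiteT m2.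
exists (fun n => F n `*` G n).
  rewrite -setXTT TF TG predeqE => -[x y]; split.
    move=> [/= [n _ Fnx] [k _ Gky]]; exists (maxn n k) => //; split.
    - by move: x Fnx; exact/subsetPset/ndF/leq_maxl.
    - by move: y Gky; exact/subsetPset/ndG/leq_maxr.
  by move=> [n _ []/= ? ?]; split; exists n.
move=> k; have [? ?] := Foo k; have [? ?] := Goo k.
split; first exact: measurableX.
by rewrite product_measure1E// lte_mul_pinfty// ge0_fin_numE.
Qed.

Section lebesgue_rV_step.
Context (R : realType) (n : nat).

Definition rV_cons (xv : measurableTypeR R * 'rV[R]_n) : 'rV[R]_n.+1 :=
  row_mx (\row_(_ < 1) (xv.1 : R)) xv.2.

Definition rV_uncons (v : 'rV[R]_n.+1) : measurableTypeR R * 'rV[R]_n :=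
  (v ord0 ord0, \row_j v ord0 (lift ord0 j)).

Lemma rV_consK : cancel rV_cons rV_uncons.
Proof.
case=> x v; rewrite /rV_uncons /rV_cons/=; congr pair.
  by rewrite mxE; case: fintype.splitP => j //; rewrite mxE.
apply/rowP => j; rewrite !mxE; case: fintype.splitP => k /= jk.
  by have := ltn_ord k; rewrite -jk.
by congr (v _ _); apply/val_inj; move: jk => /=; rewrite /bump/= => -[].
Qed.

Lemma rV_unconsK : cancel rV_uncons rV_cons.
Proof.
move=> v; apply/rowP => i; rewrite /rV_cons /rV_uncons mxE.
by case: fintype.splitP => j ij; rewrite !mxE; congr (v _ _); apply/val_inj;
  rewrite /= ij// ord1.
Qed.

Lemma measurable_rV_cons : measurable_fun setT rV_cons.
Proof.
apply: measurable_fun_rV => i.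
have [->|[j ->]] : i = ord0 \/ exists j, i = lift ord0 j.
  by case: (unliftP ord0 i) => [j ->|->]; [right; exists j|left].
- rewrite (_ : (fun s => _) = fst); first exact: measurable_fst.
  by apply/funext => s; rewrite -[in RHS](rV_consK s).
- rewrite (_ : (fun s => _) = (fun v : 'rV[R]_n => v ord0 j) \o snd).
    by apply: measurableT_comp; [exact: measurable_coord|exact: measurable_snd].
  by apply/funext => s; rewrite -[in RHS](rV_consK s)/= mxE.
Qed.

Lemma measurable_rV_uncons : measurable_fun setT rV_uncons.
Proof.
apply/measurable_fun_pairP; split; first exact: measurable_coord.
apply: measurable_fun_rV => j /=.
rewrite (_ : (fun s => _) = (fun s : 'rV[R]_n.+1 => s ord0 (lift ord0 j))).
  exact: measurable_coord.
by apply/funext => s; rewrite mxE.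
Qed.

Variable m : {sigma_finite_measure set 'rV[R]_n -> \bar R}.

Definition lebesgue_rV_step : set 'rV[R]_n.+1 -> \bar R :=
  pushforward (lebesgue_measure \x m)%E rV_cons.

Let step0 : lebesgue_rV_step set0 = 0%E.
Proof. by rewrite /lebesgue_rV_step /pushforward preimage_set0 measure0. Qed.

Let step_ge0 A : (0 <= lebesgue_rV_step A)%E.
Proof. by rewrite /lebesgue_rV_step /pushforward; exact: measure_ge0. Qed.

Let step_sigma_additive : semi_sigma_additive lebesgue_rV_step.
Proof.
have mpre A : measurable A -> measurable (rV_cons @^-1` A).
  by move=> mA; rewrite -[X in measurable X]setTI; exact: measurable_rV_cons.
move=> F mF tF mUF; rewrite /lebesgue_rV_step /pushforward preimage_bigcup.
apply: measure_semi_sigma_additive.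
- by move=> k; exact: mpre.
- apply/trivIsetP => /= i j _ _ ij; rewrite -preimage_setI.
  by move/trivIsetP : tF => /(_ _ _ _ _ ij) ->//; rewrite preimage_set0.
- by rewrite -preimage_bigcup; exact: mpre.
Qed.

HB.instance Definition _ := isMeasure.Build _ _ _ lebesgue_rV_step
  step0 step_ge0 step_sigma_additive.

Let step_sigma_finite : sigma_finite setT lebesgue_rV_step.
Proof.
have [F UF mF] : sigma_finite setT (lebesgue_measure \x m)%E.
  exact: (sigma_finite_prod lebesgue_measure m).
exists (fun k => rV_uncons @^-1` F k).
  by rewrite -preimage_bigcup -UF preimage_setT.
move=> k; have [mFk Fkoo] := mF k; split.
  by rewrite -[X in measurable X]setTI; exact: measurable_rV_uncons.
rewrite /lebesgue_rV_step /pushforward (_ : _ @^-1` _ = F k)//.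
by apply/seteqP; split => z /=; rewrite rV_consK.
Qed.

HB.instance Definition _ := Measure_isSigmaFinite.Build _ _ _ lebesgue_rV_step
  step_sigma_finite.

End lebesgue_rV_step.

(* n-dimensional Lebesgue measure, by induction on n: the product of the
   Lebesgue measure on R and of that on R^n, carried over to R^(n+1). *)
Fixpoint lebesgue_rV (R : realType) (n : nat) :
    {sigma_finite_measure set 'rV[R]_n -> \bar R} :=
  match n with
  | 0%N => \d_(0 : 'rV[R]_0)
  | n'.+1 => lebesgue_rV_step (lebesgue_rV R n')
  end.

Lemma lebesgue_rV_box (R : realType) (n : nat) (A : 'I_n -> set R) :
  (forall i, measurable (A i)) ->
  lebesgue_rV R n [set x | forall i, A i (x ord0 i)] =
  (\prod_(i < n) lebesgue_measure (A i))%E.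
Proof.
elim: n A => [|n IHn] A mA.
  by rewrite big_ord0 /= diracE mem_set// => -[].
have mB : measurable [set x : 'rV[R]_n | forall i, A (lift ord0 i) (x ord0 i)].
  rewrite (_ : [set _ | _] = \big[setI/setT]_(i < n)
    ([set: 'rV[R]_n] `&` ((fun x : 'rV[R]_n => x ord0 i) @^-1` A (lift ord0 i)))).
    by apply: bigsetI_measurable => i _; exact: measurable_coord.
  rewrite -bigcap_seq; apply/seteqP; split => [x xA i _|x xA i]; first by split.
  by have [] := xA i (mem_index_enum _).
rewrite big_ord_recl -(IHn (fun i => A (lift ord0 i)))//.
rewrite -(@product_measure1E _ _ _ _ R lebesgue_measure)//; last exact: mA.
rewrite /= /lebesgue_rV_step /pushforward; congr product_measure1.
apply/seteqP; split => [z zA|z [z1 z2] i] /=.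
  split => [|i] /=; first by have := zA ord0; rewrite -[in z.1](rV_consK z).
  by have := zA (lift ord0 i); rewrite -[in z.2](rV_consK z)/= mxE.
have [->|[j ->]] : i = ord0 \/ exists j, i = lift ord0 j.
  by case: (unliftP ord0 i) => [j ->|->]; [right; exists j|left].
- by rewrite -[in z.1](rV_consK z) in z1.
- by have := z2 j; rewrite -[in z.2](rV_consK z)/= mxE.
Qed.

Section euclidean.
Context (R : realType) (n : nat).
Implicit Types u v w z : 'rV[R]_n.

Definition dot u v : R := \sum_(i < n) u ord0 i * v ord0 i.

(* The library norm `|u| on 'rV[R]_n is the sup norm. *)
Definition enorm u : R := Num.sqrt (dot u u).

Definition subdifferential (f : 'rV[R]_n -> R) z : set 'rV[R]_n :=
  [set w | forall y, f z + dot w (y - z) <= f y].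

Lemma dotC u v : dot u v = dot v u.
Proof. by apply: eq_bigr => i _; rewrite mulrC. Qed.

Lemma dotDl u v w : dot (u + v) w = dot u w + dot v w.
Proof. by rewrite -big_split; apply: eq_bigr => i _; rewrite mxE mulrDl. Qed.

Lemma dotZl a u v : dot (a *: u) v = a * dot u v.
Proof. by rewrite mulr_sumr; apply: eq_bigr => i _; rewrite mxE mulrA. Qed.

Lemma dotNl u v : dot (- u) v = - dot u v.
Proof. by rewrite -scaleN1r dotZl mulN1r. Qed.

Lemma dotDr u v w : dot w (u + v) = dot w u + dot w v.
Proof. by rewrite !(dotC w) dotDl. Qed.

Lemma dotZr a u v : dot u (a *: v) = a * dot u v.
Proof. by rewrite !(dotC u) dotZl. Qed.

Lemma dotNr u v : dot u (- v) = - dot u v.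
Proof. by rewrite !(dotC u) dotNl. Qed.

Lemma dot_ge0 u : 0 <= dot u u.
Proof. by apply: sumr_ge0 => i _; rewrite -expr2 sqr_ge0. Qed.

Lemma dot_eq0 u : (dot u u == 0) = (u == 0).
Proof.
rewrite psumr_eq0; last by move=> i _; rewrite -expr2 sqr_ge0.
apply/allP/eqP => [u0|-> i _]; last by rewrite mxE mulr0 eqxx.
apply/rowP => i; rewrite mxE; apply/eqP.
by have := u0 i (mem_index_enum _); rewrite /= mulf_eq0 orbb.
Qed.

Lemma enorm_ge0 u : 0 <= enorm u.
Proof. exact: sqrtr_ge0. Qed.

Lemma enorm_sqr u : enorm u ^+ 2 = dot u u.
Proof. by rewrite sqr_sqrtr// dot_ge0. Qed.

Lemma enorm_eq0 u : (enorm u == 0) = (u == 0).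
Proof. by rewrite -sqrf_eq0 enorm_sqr dot_eq0. Qed.

Lemma enorm0 : enorm 0 = 0.
Proof. by apply/eqP; rewrite enorm_eq0. Qed.

Lemma dot_le_enorm u v : dot u v <= enorm u * enorm v.
Proof.
apply: (le_trans (ler_norm _)).
rewrite -(@ler_pXn2r _ 2)// ?nnegrE ?mulr_ge0 ?enorm_ge0//.
rewrite exprMn !enorm_sqr real_normK ?num_real//.
have [->|v0] := eqVneq v 0.
  by rewrite (_ : dot u 0 = 0) ?expr0n ?mulr_ge0 ?dot_ge0// -(scale0r 0) dotZr mul0r.
have vv : 0 < dot v v by rewrite lt_neqAle eq_sym dot_eq0 v0 dot_ge0.
have := dot_ge0 (dot v v *: u - dot u v *: v).
rewrite !(dotDl, dotDr, dotNl, dotNr, dotZl, dotZr) (dotC v u).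
rewrite (_ : _ + _ = dot v v * (dot u u * dot v v - dot u v ^+ 2)); last by ring.
by rewrite pmulr_rge0// subr_ge0.
Qed.

Lemma enormD u v : enorm (u + v) <= enorm u + enorm v.
Proof.
rewrite -(@ler_pXn2r _ 2)// ?nnegrE ?addr_ge0 ?enorm_ge0//.
rewrite enorm_sqr sqrrD !enorm_sqr !(dotDl, dotDr) (dotC v u).
by have := dot_le_enorm u v; lra.
Qed.

Lemma subdifferential_enorm z : subdifferential enorm z =
  if z == 0 then [set w | enorm w <= 1] else [set (enorm z)^-1 *: z].
Proof.
have le1 w : dot w w <= enorm w -> enorm w <= 1.
  rewrite -enorm_sqr; have [->//|w0] := eqVneq (enorm w) 0.
  by rewrite expr2 ger_pMr// lt_neqAle eq_sym w0 enorm_ge0.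
case: eqP => [->|/eqP z0]; apply/seteqP; split => w /=.
- by move=> /(_ w); rewrite subr0 enorm0 add0r; exact: le1.
- move=> w1 y; rewrite subr0 enorm0 add0r.
  by apply: (le_trans (dot_le_enorm _ _)); rewrite ler_piMl// enorm_ge0.
- have zgt0 : 0 < enorm z by rewrite lt_neqAle eq_sym enorm_eq0 z0 enorm_ge0.
  move=> wz.
  have w1 : enorm w <= 1.
    apply: le1; have := wz (z + w); rewrite [z + w - z]addrC addKr => h.
    by have := enormD z w; lra.
  have wzE : enorm z <= dot w z.
    by have := wz 0; rewrite enorm0 sub0r dotNr subr_le0.
  apply/eqP; rewrite -subr_eq0 -dot_eq0 eq_le dot_ge0 andbT.
  rewrite !(dotDl, dotDr, dotNl, dotNr, dotZl, dotZr) (dotC z w) -!enorm_sqr.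
  have -> : (enorm z)^-1 * ((enorm z)^-1 * enorm z ^+ 2) = 1.
    by field; rewrite gt_eqF.
  have : 1 <= (enorm z)^-1 * dot w z by rewrite ler_pdivlMl// mulr1.
  have : enorm w ^+ 2 <= 1 by rewrite expr_le1 ?enorm_ge0.
  lra.
- move=> -> y; rewrite dotDr dotNr !dotZl -enorm_sqr.
  have zgt0 : 0 < enorm z by rewrite lt_neqAle eq_sym enorm_eq0 z0 enorm_ge0.
  have -> : (enorm z)^-1 * enorm z ^+ 2 = enorm z by field; rewrite gt_eqF.
  by rewrite addrC subrK ler_pdivrMl// dot_le_enorm.
Qed.

End euclidean.
Arguments enorm {R n} u.

Section sobolev.
Context (R : realType) (n : nat).
Local Notation mu := (lebesgue_rV R n).
Implicit Types (D : set 'rV[R]_n) (u phi : 'rV[R]_n -> R)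
  (G Z : 'rV[R]_n -> 'rV[R]_n) (p : \bar R).

Definition partial (i : 'I_n) u : 'rV[R]_n -> R := 'D_(delta_mx ord0 i) u.

Definition grad u : 'rV[R]_n -> 'rV[R]_n := fun x => \row_i partial i u x.

(* C^k on R^n: existence and continuity of all partial derivatives up to
   order k *)
Fixpoint Ck (k : nat) u : Prop :=
  match k with
  | 0%N => continuous u
  | k'.+1 => (forall i x, derivable u x (delta_mx ord0 i)) /\
             (forall i, Ck k' (partial i u))
  end.

(* C_c^infty(D), as functions on R^n vanishing outside D *)
Definition test_function D phi : Prop :=
  let support := closure [set x | phi x != 0] in
  [/\ forall k, Ck k phi, compact support & support `<=` D].

Definition Lp_norm p D u : \bar R := 'N[mu]_p[EFin \o (u \_ D)]%E.

Definition Lp p D u : Prop := measurable_fun D u /\ (Lp_norm p D u < +oo)%E.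

Definition Lp_vec p D Z : Prop :=
  measurable_fun D Z /\ (Lp_norm p D (enorm \o Z) < +oo)%E.

Definition weak_gradient D u G : Prop :=
  forall phi, test_function D phi -> forall i,
    \int[mu]_(x in D) (u x * partial i phi x) =
    - \int[mu]_(x in D) (G x ord0 i * phi x).

(* u \in W^{1,p}(D), with weak gradient G *)
Definition sobolev p D u G : Prop :=
  [/\ Lp p D u, Lp_vec p D G & weak_gradient D u G].

(* u \in W^{1,p}_loc(D), with weak gradient G *)
Definition sobolev_loc p D u G : Prop :=
  forall E, open E -> compact (closure E) -> closure E `<=` D ->
    sobolev p E u G.

(* u \in W^{1,p}_0(D), with weak gradient G: the closure of C_c^infty(D) in
   W^{1,p}(D) *)
Definition sobolev0 p D u G : Prop :=
  sobolev p D u G /\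
  exists phi : nat -> 'rV[R]_n -> R,
    [/\ forall k, test_function D (phi k),
        Lp_norm p D (fun x => phi k x - u x) @[k --> \oo] --> 0%E &
        Lp_norm p D (fun x => enorm (grad (phi k) x - G x)) @[k --> \oo]
          --> 0%E].

(* Near each boundary point, in an orthonormal frame with last vector e, D is
   the region above the graph of a Lipschitz function gamma of the remaining
   n - 1 coordinates, that is, of the projection of x onto the orthogonal of e. *)
Definition bounded_lipschitz_domain D : Prop :=
  [/\ open D, connected D, D !=set0, bounded_set D &
   forall x0, (closure D `\` D) x0 ->
     exists (r : R) (e : 'rV[R]_n) (gamma : 'rV[R]_n -> R),
       [/\ 0 < r, enorm e = 1, lipschitz gamma &
        forall x, enorm (x - x0) < r ->
          (D x <-> gamma (x - dot x e *: e) < dot x e)]].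

End sobolev.

Section equation.
Context (R : realType) (n : nat).
Local Notation mu := (lebesgue_rV R n).

(* A weak gradient is determined up to a null set, and the condition does not
   depend on the representative G of the weak gradient of u. *)
Definition weak_solution (b p : R) (u : 'rV[R]_n -> R) : Prop :=
  exists2 G : 'rV[R]_n -> 'rV[R]_n, sobolev_loc p%:E setT u G &
  forall D, bounded_lipschitz_domain D ->
  exists Z : 'rV[R]_n -> 'rV[R]_n,
    [/\ Lp_vec +oo%E D Z,
        {ae mu, forall x, D x -> subdifferential enorm (G x) (Z x)} &
        forall phi Gphi, sobolev0 p%:E D phi Gphi ->
          b * \int[mu]_(x in D) dot (Z x) (Gphi x) +
          \int[mu]_(x in D) dot (enorm (G x) `^ (p - 2) *: G x) (Gphi x) = 0].

Definition facet (u : 'rV[R]_n -> R) : set 'rV[R]_n :=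
  [set x | forall y, u x <= u y].

End equation.

(* Main.v *)
(** Suppose that [u] is not affine. Two subgradients [a1 <> a2] at points of
differentiability give a nonzero convex combination [a] of them such that
[u - <a|.>] is bounded below by a multiple of [|<d|.>|] minus a constant, where
[d = a1 - a2]; hence the sublevel sets of [u - <a|.>] lie in slabs orthogonal
to [d]. The linear function [<a|.>] is a solution with constant flux since
[a <> 0], and the two equations are subtracted and tested with [t^2 chi], where
[t = (T - (u - <a|.>) - e|x|^2)_+] and [chi = (1 + gam^2 |x|^2)^-n] is
integrable. The pointwise monotonicity gap of the flux controls both the
gradient difference and the flux difference, so a Poincare inequality across
the slab, applied to [t^3 chi], absorbs everything but an error of order [e]:
the integral of [t^3 chi] tends to 0 with [e], although it increases as [e]
decreases. So all the subgradients agree, and [u] is affine. The test functions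
are only Lipschitz; they are mollified, and the equation passes to the limit
because the partial derivatives of a convex function are continuous at the
points of differentiability. *)

Require Import Defs.
From HB Require Import structures.
From mathcomp Require Import all_boot all_order all_algebra.
From mathcomp Require Import all_classical all_reals all_analysis.
From mathcomp Require Import measurable_realfun ring lra.
Set Implicit Arguments.
Unset Strict Implicit.
Unset Printing Implicit Defensive.
Import Order.TTheory GRing.Theory Num.Theory.
Import numFieldNormedType.Exports.
Local Open Scope classical_set_scope.
Local Open Scope ring_scope.

(** * Lebesgue measure on row vectors *)

(** The slope [a] must be nonzero because at 0 the flux is multivalued: the monotonicity gap
    vanishes there for every admissible [Z], so it cannot control the flux. Next to [a <> 0] the gap
    [g] bounds both differences by [C (g + sqrt g)]; the square root serves near [a], where the gap
    is quadratic, and the linear term serves far away.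

    The exponents fit together: the gradients of [t^3 chi] and [t^2 chi] share the factor [t chi],
    and what remains is an inequality between bounded scalars, where Young's inequality turns
    [t |grad u - a|] into a small multiple of [t^2] plus a multiple of [g]. Exponents at least 2
    also keep the gradient of the test function continuous wherever [u] is differentiable.

    The slab is bounded only along [d]. The term [e|x|^2] gives compact support, and [chi], whose
    logarithmic gradient is at most [n gam], makes the error integrable uniformly in [e].

    One-sided difference quotients replace almost everywhere differentiation throughout: they exist
    everywhere for convex functions and integrate by parts through translation invariance. The facet
    enters only at the end, since an affine function with a minimum is constant. *)

Section bounded_convergence.
Context d (T : measurableType d) (R : realType)
  (mu : {measure set T -> \bar R}).
Implicit Types (D : set T) (f g : T -> R).

Lemma integrable_of_bounded D f (M : R) : measurable D -> (mu D < +oo)%E ->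
  measurable_fun D f -> (forall x, D x -> `|f x| <= M) ->
  mu.-integrable D (EFin \o f).
Proof.
move=> mD Dfin mf fM; apply: measurable_bounded_integrable => //.
exists M; split; first exact: num_real.
by move=> r Mr x /= Dx; rewrite (le_trans (fM x Dx))// ltW.
Qed.

Lemma dominated_Rintegral_cvg D (f_ : nat -> T -> R) f g :
  measurable D ->
  (forall k, measurable_fun D (f_ k)) -> measurable_fun D f ->
  {ae mu, forall x, D x -> f_ ^~ x @ \oo --> f x} ->
  mu.-integrable D (EFin \o g) ->
  {ae mu, forall x k, D x -> `|f_ k x| <= g x} ->
  (\int[mu]_(x in D) f_ k x) @[k --> \oo] --> \int[mu]_(x in D) f x.
Proof.
move=> mD mf_ mf cf ig bf.
have [ifx _ cvf] := @dominated_convergence _ _ _ mu D mD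
  (fun k => EFin \o f_ k) (EFin \o f) (EFin \o g)
  ltac:(by move=> k; apply/measurable_EFinP)
  ltac:(by apply/measurable_EFinP)
  ltac:(by apply: filterS cf => x xP Dx; apply: cvg_EFin;
     [exact: nearW|exact: xP])
  ig
  ltac:(by apply: filterS bf => x xP k Dx /=; rewrite lee_fin; exact: xP).
apply: fine_cvg; rewrite fineK; first exact: cvf.
exact: integrable_fin_num.
Qed.

Lemma bounded_Rintegral_cvg D (f_ : nat -> T -> R) f (M : R) :
  measurable D -> (mu D < +oo)%E ->
  (forall k, measurable_fun D (f_ k)) -> measurable_fun D f ->
  {ae mu, forall x, D x -> f_ ^~ x @ \oo --> f x} ->
  {ae mu, forall x k, D x -> `|f_ k x| <= M} ->
  (\int[mu]_(x in D) f_ k x) @[k --> \oo] --> \int[mu]_(x in D) f x.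
Proof.
move=> mD Dfin mf_ mf cf bf.
apply: (dominated_Rintegral_cvg (g := fun=> M)) => //.
exact: (integrable_of_bounded (M := `|M|)).
Qed.

Lemma eq_Rintegral_ae D f g : measurable D ->
  measurable_fun D f -> measurable_fun D g ->
  {ae mu, forall x, D x -> f x = g x} ->
  \int[mu]_(x in D) f x = \int[mu]_(x in D) g x.
Proof.
move=> mD mf mg fg; rewrite /Rintegral; congr fine.
apply: ae_eq_integral => //; [exact/measurable_EFinP|exact/measurable_EFinP|].
by apply: filterS fg => x /= xP Dx; rewrite xP.
Qed.

End bounded_convergence.

Section rV_norm.
Context (R : realType) (n : nat).
Implicit Types (x y : 'rV[R]_n) (r : R).

Lemma ler_coord_norm x i : `|x ord0 i| <= `|x|.
Proof.
rewrite [leRHS]/Num.norm /= mx_normrE; apply/bigmax_geP; right => /=.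
by exists (ord0, i).
Qed.

Lemma rV_norm_ltP x r : 0 < r ->
  `|x| < r <-> forall i, `|x ord0 i| < r.
Proof.
move=> r0; split => [xr i|xr]; first exact: le_lt_trans (ler_coord_norm x i) xr.
rewrite [ltLHS]/Num.norm /= mx_normrE; apply/bigmax_ltP; split => // -[i j] _ /=.
by rewrite (ord1 i).
Qed.

Lemma rV_norm_leP x r : 0 <= r ->
  `|x| <= r <-> forall i, `|x ord0 i| <= r.
Proof.
move=> r0; split => [xr i|xr]; first exact: le_trans (ler_coord_norm x i) xr.
rewrite [leLHS]/Num.norm /= mx_normrE; apply/bigmax_leP; split => // -[i j] _ /=.
by rewrite (ord1 i).
Qed.

End rV_norm.

(** * Boxes, cubes and Borel sets *)

Section rV_topology.
Context (R : realType) (n : nat).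
Local Notation mu := (lebesgue_rV R n).
Implicit Types (x y : 'rV[R]_n) (r : R).

Definition obox (a b : 'I_n -> R) : set 'rV[R]_n :=
  [set x | forall i, x ord0 i \in `]a i, b i[].

Definition cube r : set 'rV[R]_n := [set x | `|x| < r].

Lemma cubeE r : 0 < r -> cube r = obox (fun=> - r) (fun=> r).
Proof.
move=> r0; apply/seteqP; split => x /=.
  by move/(rV_norm_ltP _ r0) => xr i; rewrite in_itv/= -ltr_norml.
by move=> xr; apply/(rV_norm_ltP _ r0) => i; rewrite ltr_norml; have := xr i;
  rewrite in_itv.
Qed.

Lemma measurable_obox a b : measurable (obox a b).
Proof.
rewrite (_ : obox a b = \big[setI/setT]_(i < n)
    ([set: 'rV[R]_n] `&` ((fun x : 'rV[R]_n => x ord0 i) @^-1` `]a i, b i[%classic))).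
  by apply: bigsetI_measurable => i _; apply: measurable_coord.
rewrite -bigcap_seq; apply/seteqP; split => [x xA i _|x xA i]; first by split => //; exact: xA.
by have [] := xA i (mem_index_enum _).
Qed.

Lemma measurable_cube r : measurable (cube r).
Proof.
have [r0|r0] := ltP 0 r; first by rewrite cubeE//; exact: measurable_obox.
rewrite (_ : cube r = set0)//; apply/seteqP; split => x //=.
by rewrite /cube/= ltNge (le_trans r0).
Qed.

Lemma lebesgue_rV_obox a b : mu (obox a b) =
  (\prod_(i < n) lebesgue_measure (`]a i, b i[%classic : set R))%E.
Proof.
by rewrite -lebesgue_rV_box//; congr (mu _).
Qed.

Lemma obox_fin a b : (mu (obox a b) < +oo)%E.
Proof.
rewrite lebesgue_rV_obox -ge0_fin_numE; last first.
  by apply: prode_ge0 => i _; exact: measure_ge0.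
apply: prode_fin_num => i _; rewrite lebesgue_measure_itv/=.
by case: ifP.
Qed.

Lemma cube_fin r : (mu (cube r) < +oo)%E.
Proof.
have [r0|r0] := ltP 0 r; first by rewrite cubeE//; exact: obox_fin.
rewrite (_ : cube r = set0) ?measure0//; apply/seteqP; split => x //=.
by rewrite /cube/= ltNge (le_trans r0).
Qed.

Lemma obox_gt0 a b : (forall i, a i < b i) -> (0 < mu (obox a b))%E.
Proof.
move=> ab; rewrite lebesgue_rV_obox.
rewrite (eq_bigr (fun i => (b i - a i)%:E)); last first.
  by move=> i _; rewrite lebesgue_measure_itv/= lte_fin ab EFinD.
rewrite prodEFin lte_fin prodr_gt0// => i _.
by rewrite subr_gt0.
Qed.

Lemma open_obox a b : open (obox a b).
Proof.
rewrite (_ : obox a b = \big[setI/setT]_(i < n)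
    ((fun x : 'rV[R]_n => x ord0 i) @^-1` `]a i, b i[%classic)); last first.
  rewrite -bigcap_seq; apply/seteqP; split => [x xA i _|x xA i]; first exact: xA.
  exact: xA i (mem_index_enum _).
apply: big_ind; [exact: openT|by move=> *; exact: openI|].
move=> i _; apply: open_comp; first by move=> x _; exact: coord_continuous.
exact: interval_open.
Qed.

Lemma open_cube r : open (cube r).
Proof.
have [r0|r0] := ltP 0 r; first by rewrite cubeE//; exact: open_obox.
rewrite (_ : cube r = set0); first exact: open0.
apply/seteqP; split => x //=.
by rewrite /cube/= ltNge (le_trans r0).
Qed.

(** Countably many boxes have a rational centre and half-side [1/(k+1)]; those contained in [U]
    cover it. *)
Lemma open_measurable_rV (U : set 'rV[R]_n) : open U -> measurable U.
Proof.
move=> oU.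
pose q2r (q : 'rV[rat]_n) : 'rV[R]_n := \row_i ratr (q ord0 i).
pose B (qk : 'rV[rat]_n * nat) := obox (fun i => q2r qk.1 ord0 i - qk.2.+1%:R^-1)
  (fun i => q2r qk.1 ord0 i + qk.2.+1%:R^-1).
pose P := [set qk | B qk `<=` U].
suff -> : U = \bigcup_qk (if qk \in P then B qk else set0).
  apply: countable_bigcupT_measurable => // qk.
  by case: ifP => _; [exact: measurable_obox|exact: measurable0].
apply/seteqP; split => [x Ux|x [qk _]]; last first.
  by case: ifPn => //; rewrite inE /P/= => qP xB; exact: qP.
have /nbhs_ballP[e /= e0 eU] : nbhs x U by exact: open_nbhs_nbhs.
pose k := Num.truncn (2 / e).
have ke : k.+1%:R^-1 < e / 2.
  rewrite -[e / 2]invrK ltf_pV2 ?posrE ?invr_gt0 ?divr_gt0// invf_div.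
  exact: truncnS_gt.
have k0 : 0 < k.+1%:R^-1 :> R by rewrite invr_gt0.
have Q i : exists q : rat, ratr q \in `]x ord0 i - k.+1%:R^-1, x ord0 i + k.+1%:R^-1[.
  have /rat_in_itvoo[q] : x ord0 i - k.+1%:R^-1 < x ord0 i + k.+1%:R^-1.
    by move: (k.+1%:R^-1 : R) k0 => dl; lra.
  by exists q.
have [q qP] := choice Q.
have qE i : q2r (\row_i q i) ord0 i = ratr (q i) by rewrite !mxE.
exists (\row_i q i, k) => //; rewrite ifT; last first.
  rewrite inE/=; move=> y yB; apply: eU; rewrite -ball_normE /ball_/=.
  apply/rV_norm_ltP => // i; rewrite !mxE ltr_norml.
  have := yB i; rewrite /= qE; have := qP i; rewrite !in_itv/=.
  by move: (k.+1%:R^-1 : R) k0 ke => dl; lra.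
move=> i /=; rewrite qE; have := qP i; rewrite !in_itv/=.
by move: (k.+1%:R^-1 : R) k0 ke => dl; lra.
Qed.

Lemma continuous_measurable_rV (f : 'rV[R]_n -> R) :
  continuous f -> measurable_fun setT f.
Proof.
move=> cf; apply: (measurability _ (@RGenOpens.measurableE R)).
move=> _ [_ [a [b ->]] <-]; rewrite setTI; apply: open_measurable_rV.
by apply: open_comp => [x _|]; [exact: cf|exact: interval_open].
Qed.

End rV_topology.

(** * Translation invariance of Lebesgue measure *)

Section rV_translation.
Context (R : realType) (n : nat).
Local Notation mu := (lebesgue_rV R n).
Implicit Types (x y : 'rV[R]_n) (r : R).

Definition oboxes : set (set 'rV[R]_n) := [set B | exists a b, B = obox a b].

Lemma setI_closed_oboxes : setI_closed oboxes.
Proof.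
move=> _ _ [a [b ->]] [a' [b' ->]].
exists (fun i => Num.max (a i) (a' i)), (fun i => Num.min (b i) (b' i)).
apply/seteqP; split => [x [xa xb] i|x xab].
  by have := xa i; have := xb i; rewrite !in_itv/= gt_max lt_min => /andP[-> ->] /andP[-> ->].
by split => i; have := xab i; rewrite !in_itv/= gt_max lt_min => /andP[/andP[? ?] /andP[? ?]];
  apply/andP.
Qed.

Definition nat_cube (k : nat) : set 'rV[R]_n :=
  obox (fun=> - k%:R) (fun=> k%:R).

Lemma bigcup_nat_cube : \bigcup_k nat_cube k = setT.
Proof.
rewrite -subTset => x _; exists (Num.truncn `|x|).+1 => // i.
by rewrite in_itv/= -ltr_norml (le_lt_trans (ler_coord_norm x i))// truncnS_gt.
Qed.

(** Open boxes are stable under intersection, so this presentation of the sigma-algebra allows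
    measures, and later integrals, to be compared on boxes alone. *)
Lemma measurable_rVE : measurable = <<s oboxes >>.
Proof.
apply/seteqP; split; last first.
  apply: smallest_sub; first exact: sigma_algebra_measurable.
  by move=> _ [a [b ->]]; exact: measurable_obox.
apply: smallest_sub; first exact: smallest_sigma_algebra.
rewrite -bigcup_seq/= => _ [i _] [Y mY <-]; rewrite setTI.
have sG : sigma_algebra setT (<<s oboxes >> : set (set 'rV[R]_n)).
  exact: smallest_sigma_algebra.
pose T' := g_sigma_algebraType oboxes.
suff : measurable_fun [set: T'] (fun x : T' => (x : 'rV[R]_n) ord0 i).
  by move=> /(_ measurableT Y mY); rewrite setTI.
apply: (measurability _ (@RGenOpens.measurableE R)).
move=> _ [_ [a [b ->]] <-]; rewrite setTI.
(* A slab in coordinate [i] is not a box; it is exhausted by boxes whose other sides are []-k,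
   k[]. *)
rewrite (_ : _ @^-1` _ = \bigcup_k (obox (fun j => if j == i then a else - k%:R)
    (fun j => if j == i then b else k%:R) : set T')).
  by apply: bigcupT_measurable => k; apply: sub_sigma_algebra; eexists; eexists.
apply/seteqP; split => x /=.
  move=> xab; exists (Num.truncn `|x : 'rV[R]_n|).+1 => // j.
  case: eqP => [->//|_].
  by rewrite in_itv/= -ltr_norml (le_lt_trans (ler_coord_norm (x : 'rV[R]_n) j))// truncnS_gt.
by move=> [k _] /(_ i); rewrite eqxx.
Qed.

Lemma measurable_rV_translation h : measurable_fun setT (fun x : 'rV[R]_n => x + h).
Proof.
apply: measurable_fun_rV => i.
rewrite (_ : (fun s => _) = (fun s : 'rV[R]_n => s ord0 i + h ord0 i)).
  by apply: measurable_funD => //; exact: measurable_coord.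
by apply/funext => s; rewrite mxE.
Qed.

(** Uniqueness of measures: the translated measure agrees with [mu] on boxes, a family closed under
    intersection that contains an exhaustion by sets of finite measure. *)
Lemma lebesgue_rV_translation h (A : set 'rV[R]_n) : measurable A ->
  mu ((fun x => x + h) @^-1` A) = mu A.
Proof.
move=> mA; apply/esym; have mh := measurable_rV_translation h.
pose mu' := measure_function_pushforward__canonical__measure_function_Measure mu mh.
apply: (measure_unique oboxes nat_cube measurable_rVE setI_closed_oboxes _
  bigcup_nat_cube mu mu') => //.
- by move=> k; eexists; eexists.
- move=> _ [a [b ->]]; rewrite /= /pushforward.
  rewrite (_ : _ @^-1` _ = obox (fun i => a i - h ord0 i) (fun i => b i - h ord0 i)).
    rewrite !lebesgue_rV_obox; apply: eq_bigr => i _.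
    rewrite !lebesgue_measure_itv/= !lte_fin ltrD2r; case: ifP => // _.
    by rewrite -!EFinD; congr EFin; lra.
  apply/seteqP; split => x /= xab i; have := xab i; rewrite !in_itv/= mxE; lra.
- by move=> k; exact: obox_fin.
Qed.

Lemma ge0_integral_translation h (f : 'rV[R]_n -> \bar R) :
  measurable_fun setT f -> (forall x, 0 <= f x)%E ->
  (\int[mu]_x f (x + h)%R = \int[mu]_x f x)%E.
Proof.
move=> mf f0; have mh := measurable_rV_translation h.
rewrite -[LHS](@ge0_integral_pushforward _ _ _ _ _ _ mh mu setT f)//.
by apply: eq_measure_integral => A mA _; exact: lebesgue_rV_translation.
Qed.

Lemma Rintegral_translation h (f : 'rV[R]_n -> R) :
  measurable_fun setT f -> \int[mu]_x f (x + h)%R = \int[mu]_x f x.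
Proof.
move=> mf; have mf' : measurable_fun setT (fun x => f (x + h)).
  by apply: measurableT_comp => //; exact: measurable_rV_translation.
rewrite /Rintegral; congr fine; rewrite [LHS]integralE [RHS]integralE; congr (_ - _)%E.
  transitivity (\int[mu]_x ((EFin \o f)^\+ (x + h)%R))%E; first by apply: eq_integral => x _; rewrite unlock.
  by apply: ge0_integral_translation => //; exact/measurable_funepos/measurable_EFinP.
transitivity (\int[mu]_x ((EFin \o f)^\- (x + h)%R))%E; first by apply: eq_integral => x _; rewrite unlock.
by apply: ge0_integral_translation => //; exact/measurable_funeneg/measurable_EFinP.
Qed.

End rV_translation.

(** * One-sided directional derivatives and integration by parts *)

Section mean_value.
Context (R : realType).

Lemma mean_value (h h' : R -> R) (a b : R) :
  (forall t : R, is_derive t 1 h (h' t)) ->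
  exists2 xi, `|xi - a| <= `|b - a| & h b - h a = h' xi * (b - a).
Proof.
move=> dh; have ch : continuous h.
  by move=> t; apply/differentiable_continuous/derivable1_diffP; have [] := dh t.
have [ab|ba|->] := ltgtP a b; last 1 first.
- by exists b => //; rewrite !subrr mulr0.
- have [xi] := MVT_segment (ltW ab) (fun t _ => dh t) (continuous_subspaceT ch).
  rewrite in_itv/= => /andP[axi xib] hE; exists xi => //.
  by rewrite !ger0_norm ?subr_ge0 ?lerD2r// ltW.
- have [xi] := MVT_segment (ltW ba) (fun t _ => dh t) (continuous_subspaceT ch).
  rewrite in_itv/= => /andP[axi xib] hE; exists xi.
    by rewrite !ler0_norm ?subr_le0 ?lerN2 ?lerD2r// ltW.
  by rewrite -opprB hE; ring.
Qed.

End mean_value.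

Section real_sequences.
Context (R : realType).
Implicit Types (a b : nat -> R) (l m : R).

Lemma eq_cvg_seq a b l : a =1 b -> a k @[k --> \oo] --> l -> b k @[k --> \oo] --> l.
Proof. by move=> /funext ->. Qed.

Lemma cvg_seqD a b l m : a k @[k --> \oo] --> l -> b k @[k --> \oo] --> m ->
  a k + b k @[k --> \oo] --> l + m.
Proof. exact: cvgD. Qed.

Lemma cvg_seqM a b l m : a k @[k --> \oo] --> l -> b k @[k --> \oo] --> m ->
  a k * b k @[k --> \oo] --> l * m.
Proof. exact: cvgM. Qed.

Lemma cvg_seqZ a l m : a k @[k --> \oo] --> l -> m * a k @[k --> \oo] --> m * l.
Proof. by move=> al; apply: cvg_seqM => //; exact: cvg_cst. Qed.

Lemma cvg_seqN a l : a k @[k --> \oo] --> l -> - a k @[k --> \oo] --> - l.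
Proof. exact: cvgN. Qed.

Lemma cvg_seqV a l : l != 0 -> a k @[k --> \oo] --> l -> (a k)^-1 @[k --> \oo] --> l^-1.
Proof. by move=> ?; exact: cvgV. Qed.

Lemma cvg_seq_comp (T : topologicalType) (h : T -> R) (a : nat -> T) (l : T) :
  {for l, continuous h} -> a k @[k --> \oo] --> l -> h (a k) @[k --> \oo] --> h l.
Proof. by move=> ch; exact: continuous_cvg. Qed.

Lemma cvg_invS : (k.+1%:R^-1 : R) @[k --> \oo] --> (0 : R).
Proof. exact: cvg_harmonic. Qed.

Lemma invS_itv k : 0 <= (k.+1%:R^-1 : R) <= 1.
Proof. by rewrite invr_ge0 ler0n invf_le1// ler1n. Qed.

End real_sequences.

Section bounded_on_balls.
Context (R : realType) (n : nat).
Implicit Types (F : 'rV[R]_n -> R).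

Lemma continuous_bounded F (r : R) : continuous F ->
  exists M : R, 0 <= M /\ forall x, `|x| <= r -> `|F x| <= M.
Proof.
move=> cF; pose B : set 'rV[R]_n := [set x | `|x| <= r].
have cB : compact B.
  apply: bounded_closed_compact.
    by exists r; split; [exact: num_real|move=> s rs x /= xr; rewrite (le_trans xr)// ltW].
  rewrite (_ : B = (fun x => `|x|) @^-1` [set y | y <= r])//.
  apply: closed_comp => [x _|]; first exact: norm_continuous.
  exact: closed_le.
have [M [_ MP]] := compact_bounded (continuous_compact (continuous_subspaceT cF) cB).
exists (Num.max 0 (M + 1)); split; first by rewrite le_max lexx.
move=> x xr; rewrite le_max; apply/orP; right.
by apply: (MP (M + 1)); [rewrite ltrDl|exists x].
Qed.

Lemma seq_add_cvg (x v : 'rV[R]_n) (u : nat -> R) :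
  u k @[k --> \oo] --> (0 : R) -> (x + u k *: v) @[k --> \oo] --> x.
Proof.
move=> u0; rewrite -[X in _ --> X]addr0; apply: cvgD; first exact: cvg_cst.
by rewrite -(scale0r v); apply: cvgZr_tmp.
Qed.

End bounded_on_balls.

Section continuous_dot.
Context (R : realType) (n : nat).
Implicit Types (a x : 'rV[R]_n).

Lemma continuous_sum (I : Type) (s : seq I) (F : I -> 'rV[R]_n -> R) :
  (forall i, continuous (F i)) -> continuous (fun x => \sum_(i <- s) F i x).
Proof.
move=> cF; elim: s => [|i s IH].
  have -> : (fun x => \sum_(i <- [::]) F i x) = (fun=> 0).
    by apply/funext => y; rewrite big_nil.
  exact: cst_continuous.
have -> : (fun x => \sum_(j <- i :: s) F j x) = (fun x => F i x + \sum_(j <- s) F j x).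
  by apply/funext => y; rewrite big_cons.
by move=> x; exact: cvgD (cF i x) (IH x).
Qed.

Lemma continuous_dot a : continuous (dot a).
Proof.
apply: continuous_sum => i x.
exact: cvgM (cvg_cst (a ord0 i)) (@coord_continuous _ _ _ _ _ x).
Qed.

Lemma continuous_dot_sqr : continuous (fun x : 'rV[R]_n => dot x x).
Proof.
apply: continuous_sum => i x.
exact: cvgM (@coord_continuous _ _ _ _ _ x) (@coord_continuous _ _ _ _ _ x).
Qed.

End continuous_dot.

Section rdiff.
Context (R : realType) (n : nat).
Local Notation mu := (lebesgue_rV R n).
Implicit Types (v x : 'rV[R]_n) (F G : 'rV[R]_n -> R).

(** A one-sided derivative along [v], taken along the steps [1/(k+1)] and required at every point,
    with a local Lipschitz bound to dominate the quotients. Convex functions satisfy it everywhere,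
    it is stable under products and compositions with C^1 functions, and it suffices for integration
    by parts. *)
Definition rdiff v F F' : Prop :=
  [/\ continuous F,
      forall r, exists L : R, forall x (t : R), `|x| <= r -> 0 <= t <= 1 ->
        `|F (x + t *: v) - F x| <= L * t &
      forall x, (k.+1%:R * (F (x + k.+1%:R^-1 *: v) - F x)) @[k --> \oo] --> F' x].

Lemma shift_norm r v x t : `|x| <= r -> 0 <= t <= 1 -> `|x + t *: v| <= r + `|v|.
Proof.
move=> xr /andP[t0 t1]; apply: (le_trans (ler_normD _ _)); rewrite lerD//.
by rewrite normrZ ger0_norm// ler_piMl.
Qed.

Lemma rdiff_quot_bound v F F' r : rdiff v F F' ->
  exists L : R, 0 <= L /\ forall x, `|x| <= r ->
    (forall k, `|k.+1%:R * (F (x + k.+1%:R^-1 *: v) - F x)| <= L) /\ `|F' x| <= L.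
Proof.
move=> [_ lF cF]; have [L LP] := lF r; exists (Num.max 0 L).
split; first by rewrite le_max lexx.
move=> x xr.
have H k : `|k.+1%:R * (F (x + k.+1%:R^-1 *: v) - F x)| <= L.
  rewrite normrM ger0_norm//.
  by rewrite mulrC -ler_pdivlMr// LP// invS_itv.
split=> [k|]; first by rewrite le_max H orbT.
rewrite le_max; apply/orP; right.
by apply: (cvgr_to_le (cvg_norm (cF x))); exact: nearW.
Qed.

Lemma rdiff_measurable v F F' : rdiff v F F' -> measurable_fun setT F'.
Proof.
move=> [cF _ qF].
apply: (measurable_fun_cvg _ (fun x _ => qF x)) => // k.
apply: measurable_funM => //; apply: measurable_funB.
  apply: measurableT_comp; first exact: continuous_measurable_rV.
  exact: measurable_rV_translation.
exact: continuous_measurable_rV.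
Qed.

Lemma rdiff_cst v c : rdiff v (fun=> c) (fun=> 0).
Proof.
split; [exact: cst_continuous|exists 0 => x t _ _|move=> x].
  by rewrite subrr normr0 mul0r.
by under eq_cvg do rewrite subrr mulr0; exact: cvg_cst.
Qed.

Lemma rdiffD v F F' G G' : rdiff v F F' -> rdiff v G G' ->
  rdiff v (fun x => F x + G x) (fun x => F' x + G' x).
Proof.
move=> [cF lF qF] [cG lG qG]; split.
- by move=> x; exact: cvgD (cF x) (cG x).
- move=> r; have [L LP] := lF r; have [K KP] := lG r; exists (L + K) => x t xr t01.
  rewrite (_ : _ - _ = (F (x + t *: v) - F x) + (G (x + t *: v) - G x)); last by ring.
  by rewrite (le_trans (ler_normD _ _))// mulrDl lerD// ?LP// KP.
- move=> x; have := cvg_seqD (qF x) (qG x); by apply: eq_cvg_seq => k; ring.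
Qed.

Lemma rdiffM v F F' G G' : rdiff v F F' -> rdiff v G G' ->
  rdiff v (fun x => F x * G x) (fun x => F' x * G x + F x * G' x).
Proof.
move=> [cF lF qF] [cG lG qG]; split.
- by move=> x; exact: cvgM (cF x) (cG x).
- move=> r; have [L LP] := lF r; have [K KP] := lG r.
  have [M [M0 MP]] := continuous_bounded (r + `|v|) cG.
  have [N [N0 NP]] := continuous_bounded r cF.
  exists (L * M + N * K) => x t xr t01.
  rewrite (_ : _ - _ = (F (x + t *: v) - F x) * G (x + t *: v) + F x * (G (x + t *: v) - G x)); last by ring.
  rewrite [leRHS]mulrDl (le_trans (ler_normD _ _)) ?lerD ?normrM//.
    by rewrite mulrAC ler_pM// ?LP ?MP// shift_norm.
  by rewrite -mulrA ler_pM// ?NP// KP.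
- move=> x; have cG' : G (x + k.+1%:R^-1 *: v) @[k --> \oo] --> G x.
    by apply: continuous_cvg; [exact: cG|apply: seq_add_cvg; exact: cvg_invS].
  have := cvg_seqD (cvg_seqM (qF x) cG') (cvg_seqZ (m := F x) (qG x)).
  by apply: eq_cvg_seq => k; ring.
Qed.

Lemma rdiffZ v F F' c : rdiff v F F' -> rdiff v (fun x => c * F x) (fun x => c * F' x).
Proof.
move=> rF; have := rdiffM (rdiff_cst v c) rF.
by congr (rdiff _ _ _); apply/funext => x; rewrite mul0r add0r.
Qed.

Lemma rdiffX v F F' m : rdiff v F F' ->
  rdiff v (fun x => F x ^+ m.+1) (fun x => m.+1%:R * F x ^+ m * F' x).
Proof.
move=> rF; elim: m => [|m IH].
  by move: rF; congr (rdiff _ _ _); apply/funext => x; rewrite ?expr1// expr0 !mul1r.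
have -> : (fun x => F x ^+ m.+2) = (fun x => F x * F x ^+ m.+1).
  by apply/funext => x; rewrite exprS.
have -> : (fun x => m.+2%:R * F x ^+ m.+1 * F' x) =
    (fun x => F' x * F x ^+ m.+1 + F x * (m.+1%:R * F x ^+ m * F' x)).
  by apply/funext => x; rewrite -(natr1 m.+1) (exprS _ m); ring.
exact: rdiffM.
Qed.

Lemma rdiffV v F F' : rdiff v F F' -> (forall x, 1 <= F x) ->
  rdiff v (fun x => (F x)^-1) (fun x => - (F' x / F x ^+ 2)).
Proof.
move=> [cF lF qF] F1; have F0 x : F x != 0.
  by rewrite gt_eqF// (lt_le_trans _ (F1 x)).
have E x y : (F y)^-1 - (F x)^-1 = - ((F y - F x) * ((F y)^-1 * (F x)^-1)).
  by field; rewrite !F0.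
split.
- by move=> x; exact: cvgV (F0 x) (cF x).
- move=> r; have [L LP] := lF r; exists L => x t xr t01.
  rewrite E normrN normrM (le_trans _ (LP x t xr t01))// ler_piMr// ger0_norm.
    by rewrite mulr_ile1// ?invr_ge0 ?invf_le1// ?(le_trans _ (F1 _))// ?(lt_le_trans _ (F1 _)).
  by rewrite mulr_ge0// invr_ge0 (le_trans _ (F1 _)).
- move=> x; have cF' : F (x + k.+1%:R^-1 *: v) @[k --> \oo] --> F x.
    by apply: continuous_cvg; [exact: cF|apply: seq_add_cvg; exact: cvg_invS].
  have := cvg_seqN (cvg_seqZ (m := (F x)^-1) (cvg_seqM (qF x) (cvg_seqV (F0 x) cF'))).
  rewrite (_ : - (_ * _) = - (F' x / F x ^+ 2)); last by field; rewrite F0.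
  apply: eq_cvg_seq => k.
  by rewrite E; ring.
Qed.

Lemma rdiff_comp v F F' (h h' : R -> R) : rdiff v F F' ->
  (forall t : R, is_derive t 1 h (h' t)) -> continuous h' ->
  rdiff v (fun x => h (F x)) (fun x => h' (F x) * F' x).
Proof.
move=> [cF lF qF] dh ch'; have ch : continuous h.
  by move=> t; apply/differentiable_continuous/derivable1_diffP; have [] := dh t.
split.
- by move=> x; apply: continuous_comp; [exact: cF|exact: ch].
- move=> r; have [L LP] := lF r.
  have [M [M0 MP]] := continuous_bounded (r + `|v|) cF.
  (* The intermediate point is within [|F (x + t v) - F x| <= 2 M] of [F x], hence bounded by
     [3 M]. *)
  have [K KP] : exists K : R, forall s : R, `|s| <= 3 * M -> `|h' s| <= K.
    have cc : compact `[- (3 * M), 3 * M] by exact: segment_compact.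
    have [K [_ KP]] := compact_bounded (continuous_compact (continuous_subspaceT ch') cc).
    exists (K + 1) => s sM; apply: (KP (K + 1)); first by rewrite ltrDl.
    by exists s => //=; rewrite in_itv/= -ler_norml.
  exists (K * L) => x t xr t01.
  have [xi xiP ->] := mean_value (F x) (F (x + t *: v)) dh.
  rewrite normrM -mulrA ler_pM// ?LP// KP//.
  have h1 : `|F x| <= M by apply: MP; rewrite (le_trans xr)// lerDl.
  have h2 : `|F (x + t *: v)| <= M by apply: MP; exact: shift_norm.
  rewrite -(subrK (F x) xi) (le_trans (ler_normD _ _))//.
  have := ler_normB (F (x + t *: v)) (F x); lra.
- move=> x; have cF' : F (x + k.+1%:R^-1 *: v) @[k --> \oo] --> F x.
    by apply: continuous_cvg; [exact: cF|apply: seq_add_cvg; exact: cvg_invS].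
  have /choice[xi xiP] k : exists xi : R, `|xi - F x| <= `|F (x + k.+1%:R^-1 *: v) - F x| /\
     h (F (x + k.+1%:R^-1 *: v)) - h (F x) = h' xi * (F (x + k.+1%:R^-1 *: v) - F x).
    by have [xi ? ?] := mean_value (F x) (F (x + k.+1%:R^-1 *: v)) dh; exists xi.
  have cxi : xi k @[k --> \oo] --> F x.
    apply/cvgrPdist_le => e e0; move/cvgrPdist_le : cF' => /(_ e e0).
    apply: filterS => k; rewrite ![`|F x - _|]distrC; apply: le_trans.
    by have [] := xiP k.
  have := cvg_seqM (cvg_seq_comp (ch' (F x)) cxi) (qF x).
  apply: eq_cvg_seq => k.
  by have [_ ->] := xiP k; ring.
Qed.

Lemma line_derive v F F' : (forall x, is_derive x v F (F' x)) ->
  forall x (t : R), is_derive t 1 (fun t => F (x + t *: v)) (F' (x + t *: v)).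
Proof.
move=> dF x t.
have E : (fun h : R => h^-1 *: (F (x + (h *: 1 + t) *: v) - F (x + t *: v))) =
   (fun h : R => h^-1 *: (F (h *: v + (x + t *: v)) - F (x + t *: v))).
  apply/funext => h; congr (_ *: (F _ - _)).
  by rewrite scalerDl [h *: 1]mulr1 addrCA.
have [d1 d2] := dF (x + t *: v); split.
  by rewrite /derivable; move: d1; rewrite /derivable /= E.
by rewrite /derive -d2 /derive /= E.
Qed.

Lemma line_mean_value v F F' : (forall x, is_derive x v F (F' x)) ->
  forall x (t : R), exists xi : R,
    `|xi| <= `|t| /\ F (x + t *: v) - F x = F' (x + xi *: v) * t.
Proof.
move=> dF x t; have [xi] := mean_value 0 t (line_derive dF x).
by rewrite !subr0 scale0r addr0 => ? ?; exists xi.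
Qed.

(** The factor [c] makes both [e_i] and [- e_i] available: in general a one-sided derivative says
    nothing about the opposite direction, so the two are treated separately for convex functions. *)
Lemma C1_rdiff v F F' c : (forall x, is_derive x v F (F' x)) ->
  continuous F -> continuous F' -> rdiff (c *: v) F (fun x => c * F' x).
Proof.
move=> dF cF cF'; have mvl := line_mean_value dF.
split => //.
- move=> r; have [M [M0 MP]] := continuous_bounded (r + `|c| * `|v|) cF'.
  exists (M * `|c|) => x t xr /andP[t0 t1]; rewrite scalerA.
  have [xi [xit ->]] := mvl x (t * c).
  rewrite normrM normrM (ger0_norm t0) (mulrC t) mulrA ler_wpM2r// ler_wpM2r// MP//.
  rewrite (le_trans (ler_normD _ _))// lerD// normrZ ler_wpM2r//.
  by rewrite (le_trans xit)// normrM (ger0_norm t0) ler_piMl.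
- move=> x.
  have /choice[xi xiP] k := mvl x (k.+1%:R^-1 * c).
  have xi0 : xi k @[k --> \oo] --> (0 : R).
    have : `|k.+1%:R^-1 * c| @[k --> \oo] --> (0 : R).
      rewrite -[X in _ --> X](@normr0 _ R) -[X in `|X|](mul0r c); apply: cvg_norm.
      by apply: cvgMr_tmp; exact: cvg_invS.
    move=> /cvgrPdist_le H; apply/cvgrPdist_le => e e0.
    apply: filterS (H e e0) => k; rewrite !sub0r !normrN normr_id; apply: le_trans.
    by have [] := xiP k.
  have := cvg_seqZ (m := c) (cvg_seq_comp (cF' x) (@seq_add_cvg _ _ x v _ xi0)).
  apply: eq_cvg_seq => k.
  have [_] := xiP k; rewrite scalerA => ->.
  have k0 : k.+1%:R != 0 :> R by rewrite pnatr_eq0.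
  by rewrite [_ * (_^-1 * c)]mulrCA mulVKf// mulrC.
Qed.

Lemma rdiff_translation v F F' c : rdiff v F F' ->
  rdiff v (fun x => F (x + c)) (fun x => F' (x + c)).
Proof.
move=> [cF lF qF]; split.
- move=> x; have ct : y + c @[y --> x] --> x + c by exact: cvgD (@cvg_id _ _) (cvg_cst _).
  exact: continuous_cvg (cF _) ct.
- move=> r; have [L LP] := lF (r + `|c|); exists L => x t xr t01.
  by rewrite addrAC LP// (le_trans (ler_normD _ _))// lerD2r.
- by move=> x; have := qF (x + c); apply: eq_cvg_seq => k; rewrite addrAC.
Qed.

Lemma rdiff_dot v a : rdiff v (dot a) (fun=> dot a v).
Proof.
have E x (t : R) : dot a (x + t *: v) - dot a x = dot a v * t.
  by rewrite dotDr dotZr; ring.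
split.
- apply: continuous_dot.
- by move=> r; exists `|dot a v| => x t _ /andP[t0 _]; rewrite E normrM (ger0_norm t0).
- move=> x; rewrite (_ : (fun k => _) = fun=> dot a v); first exact: cvg_cst.
  by apply/funext => k; rewrite E mulrCA divff ?mulr1// pnatr_eq0.
Qed.

Lemma rdiff_sqr v : rdiff v (fun x => dot x x) (fun x => 2 * dot x v).
Proof.
have E x (t : R) : dot (x + t *: v) (x + t *: v) - dot x x = (2 * dot x v + dot v v * t) * t.
  by rewrite !(dotDr, dotDl, dotZr, dotZl) (dotC v x); ring.
split.
- exact: continuous_dot_sqr.
- move=> r; have [M [M0 MP]] := continuous_bounded r (@continuous_dot _ _ v).
  exists (2 * M + dot v v) => x t xr /andP[t0 t1].
  rewrite E normrM (ger0_norm t0) ler_wpM2r// (le_trans (ler_normD _ _))//.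
  rewrite !normrM (ger0_norm (dot_ge0 v)) (ger0_norm t0) ger0_norm//.
  by rewrite lerD// ?ler_pM2l// ?(dotC x) ?MP// ler_piMr// dot_ge0.
- move=> x.
  have c2 : 2 * dot x v @[k --> \oo] --> 2 * dot x v by exact: cvg_cst.
  have := cvg_seqD c2 (cvg_seqZ (m := dot v v) (@cvg_invS R)).
  rewrite mulr0 addr0; apply: eq_cvg_seq => k.
  by rewrite E mulrCA divff ?mulr1// pnatr_eq0.
Qed.

End rdiff.

(** * Integration by parts with one-sided derivatives *)

Section integration_by_parts.
Context (R : realType) (n : nat).
Local Notation mu := (lebesgue_rV R n).
Implicit Types (v x : 'rV[R]_n) (F G f : 'rV[R]_n -> R) (D : set 'rV[R]_n).

Lemma Rintegral_setTE D f : (forall x, ~ D x -> f x = 0) ->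
  \int[mu]_x f x = \int[mu]_(x in D) f x.
Proof.
move=> f0; rewrite [RHS]Rintegral_mkcond; congr (Rintegral _ _ _).
apply/funext => x; rewrite patchE; case: ifPn => // xD.
by apply: f0 => Dx; rewrite mem_set in xD.
Qed.

Lemma cube_integrable f (r M : R) : measurable_fun setT f ->
  (forall x, `|x| < r -> `|f x| <= M) -> mu.-integrable (cube r : set 'rV[R]_n) (EFin \o f).
Proof.
move=> mf fM; apply: (integrable_of_bounded (M := M)) => //.
- exact: measurable_cube.
- exact: cube_fin.
- exact: measurable_funTS.
Qed.

Lemma bounded_support_integrable f (r M : R) : measurable_fun setT f ->
  (forall x, `|f x| <= M) -> (forall x, r <= `|x| -> f x = 0) ->
  mu.-integrable setT (EFin \o f).
Proof.
move=> mf fM f0; have := cube_integrable (r := r) mf (fun x _ => fM x).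
rewrite (integrable_mkcond _ (measurable_cube r)); congr (mu.-integrable _ _).
apply/funext => x; rewrite patchE; case: ifPn => // xD.
rewrite /= f0// leNgt; apply/negP => xr; move: xD.
by rewrite mem_set.
Qed.

(** The quotients look ahead by at most [|v|], which is the margin added to the support. *)
Lemma rdiff_support v F F' (r : R) : rdiff v F F' ->
  (forall x, r <= `|x| -> F x = 0) -> forall x, r + `|v| <= `|x| -> F' x = 0.
Proof.
move=> [_ _ qF] F0 x sx; apply/esym/(cvg_unique _ _ (qF x)) => //.
rewrite (_ : (fun k => _) = fun=> 0); first exact: cvg_cst.
apply/funext => k; rewrite !F0 ?subrr ?mulr0//.
  by rewrite (le_trans _ sx)// lerDl.
have /andP[i0 i1] := invS_itv R k.
have := lerB_normD x (k.+1%:R^-1 *: v); apply: le_trans.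
rewrite lerBrDr (le_trans _ sx)// lerD2l normrZ ger0_norm//.
by rewrite ler_piMl.
Qed.

(* Translation invariance: the difference quotients of F integrate to 0. *)
Lemma rdiff_Rintegral v F F' (r : R) : rdiff v F F' ->
  (forall x, r <= `|x| -> F x = 0) -> \int[mu]_x F' x = 0.
Proof.
move=> rF F0; have [cF lF qF] := rF.
have mF : measurable_fun setT F by exact: continuous_measurable_rV.
pose s := r + `|v|.
pose q k x := k.+1%:R * (F (x + k.+1%:R^-1 *: v) - F x).
have q0 k x : s <= `|x| -> q k x = 0.
  move=> sx; rewrite /q !F0 ?subrr ?mulr0//; first by rewrite (le_trans _ sx)// lerDl.
  have /andP[i0 i1] := invS_itv R k.
  have := lerB_normD x (k.+1%:R^-1 *: v); apply: le_trans.
  rewrite lerBrDr (le_trans _ sx)// lerD2l normrZ ger0_norm//.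
  by rewrite ler_piMl.
have F'0 := rdiff_support rF F0.
have out f : (forall x, s <= `|x| -> f x = 0) ->
    \int[mu]_x f x = \int[mu]_(x in cube s) f x.
  by move=> f0; apply: Rintegral_setTE => x /negP; rewrite -leNgt; exact: f0.
have mq k : measurable_fun setT (q k).
  apply: measurable_funM => //; apply: measurable_funB => //.
  by apply: measurableT_comp => //; exact: measurable_rV_translation.
have [L [L0 LP]] := rdiff_quot_bound s rF.
have [M [M0 MP]] := continuous_bounded r cF.
have FM x : `|F x| <= M.
  by have [/MP//|/ltW/F0 ->] := leP `|x| r; rewrite normr0.
rewrite out//; apply/esym; apply: (cvg_unique _ _ (bounded_Rintegral_cvg (M := L)
    (measurable_cube s) (cube_fin n s) (fun k => measurable_funTS (mq k))
    (measurable_funTS (rdiff_measurable rF)) _ _)) => //=; last first.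
- by apply: aeW => x k /= /ltW xs; have [H _] := LP x xs; exact: H.
- by apply: aeW => x _; exact: qF.
rewrite (_ : (fun k => _) = fun=> 0); first exact: cvg_cst.
apply/funext => k; rewrite -out; last exact: q0.
have iF : mu.-integrable setT (EFin \o F) by exact: (bounded_support_integrable (r := r) (M := M)).
have iF' : mu.-integrable setT (EFin \o (fun x => F (x + k.+1%:R^-1 *: v))).
  apply: (bounded_support_integrable (r := s) (M := M)) => //.
    by apply: measurableT_comp => //; exact: measurable_rV_translation.
  move=> x sx; have := q0 k x sx; rewrite /q => /eqP; rewrite mulf_eq0 pnatr_eq0/=.
  rewrite subr_eq0 => /eqP ->; apply: F0; rewrite (le_trans _ sx)// lerDl.
  exact: normr_ge0.
rewrite RintegralZl//; last first.
  exact: (integrableB measurableT iF' iF).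
by rewrite RintegralB// Rintegral_translation// subrr mulr0.
Qed.

Definition lbounded f := forall r : R, exists M : R, forall x, `|x| <= r -> `|f x| <= M.

Lemma continuous_lbounded f : continuous f -> lbounded f.
Proof. by move=> cf r; have [M [_ MP]] := continuous_bounded r cf; exists M. Qed.

Lemma rdiff_lbounded v F F' : rdiff v F F' -> lbounded F'.
Proof.
move=> rF r; have [L [_ LP]] := rdiff_quot_bound r rF; exists L => x xr.
by have [] := LP x xr.
Qed.

Lemma lboundedM f g : lbounded f -> lbounded g -> lbounded (fun x => f x * g x).
Proof.
move=> bf bg r; have [M MP] := bf r; have [N NP] := bg r; exists (M * N) => x xr.
by rewrite normrM ler_pM// ?MP// NP.
Qed.

Lemma lboundedD f g : lbounded f -> lbounded g -> lbounded (fun x => f x + g x).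
Proof.
move=> bf bg r; have [M MP] := bf r; have [N NP] := bg r; exists (M + N) => x xr.
by rewrite (le_trans (ler_normD _ _))// lerD// ?MP// NP.
Qed.

Lemma lbounded_integrable f (r : R) : measurable_fun setT f -> lbounded f ->
  (forall x, r <= `|x| -> f x = 0) -> mu.-integrable setT (EFin \o f).
Proof.
move=> mf bf f0; have [M MP] := bf r.
apply: (bounded_support_integrable (r := r) (M := Num.max 0 M)) => // x.
have [/MP xM|/ltW/f0 ->] := leP `|x| r; first by rewrite le_max xM orbT.
by rewrite normr0 le_max lexx.
Qed.

Lemma rdiff_by_parts v F F' G G' (r : R) : rdiff v F F' -> rdiff v G G' ->
  (forall x, r <= `|x| -> G x = 0) ->
  \int[mu]_x (F x * G' x) = - \int[mu]_x (F' x * G x).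
Proof.
move=> rF rG G0.
have FG0 : \int[mu]_x (F' x * G x + F x * G' x) = 0.
  by apply: (rdiff_Rintegral (r := r) (rdiffM rF rG)) => x /G0 ->; rewrite mulr0.
have [[cF _ _] [cG _ _]] := (rF, rG).
apply/eqP; rewrite -addr_eq0 addrC; apply/eqP; rewrite -{}FG0 RintegralD//.
- apply: (lbounded_integrable (r := r)).
  + by apply: measurable_funM; [exact: rdiff_measurable rF|exact: continuous_measurable_rV].
  + by apply: lboundedM; [exact: rdiff_lbounded rF|exact: continuous_lbounded].
  + by move=> x /G0 ->; rewrite mulr0.
- apply: (lbounded_integrable (r := r + `|v|)).
  + by apply: measurable_funM; [exact: continuous_measurable_rV|exact: rdiff_measurable rG].
  + by apply: lboundedM; [exact: continuous_lbounded|exact: rdiff_lbounded rG].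
  + by move=> x /(rdiff_support rG G0) ->; rewrite mulr0.
Qed.

End integration_by_parts.

(** * Convex functions *)

Definition basis_rV (R : realType) (n : nat) (i : 'I_n) : 'rV[R]_n := delta_mx ord0 i.

Lemma continuous_at_rV (R : realType) (n : nat) (f : 'rV[R]_n -> R) (x : 'rV[R]_n) :
  (forall e : R, 0 < e -> exists2 d : R, 0 < d & forall y, `|x - y| < d -> `|f x - f y| <= e) ->
  {for x, continuous f}.
Proof.
move=> H; have := @cvgrPdist_le _ _ _ _ (nbhs_filter x) f (f x); case=> _; apply.
move=> e /H[d d0 dP]; apply/nbhs_ballP; exists d => //= y.
by rewrite -ball_normE /= => /dP.
Qed.

Section convex_functions.
Context (R : realType) (n : nat).
Implicit Types (x y z v : 'rV[R]_n) (t s h : R).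
Local Notation e_ := (@basis_rV R n).

Lemma dot_basis (a : 'rV[R]_n) i : dot a (e_ i) = a ord0 i.
Proof.
rewrite /dot (bigD1 i)//= mxE !eqxx mulr1 big1 ?addr0// => j ji.
by rewrite mxE (negbTE ji) andbF mulr0.
Qed.

Lemma rV_sum_basis x : x = \sum_i x ord0 i *: e_ i.
Proof. exact: row_sum_delta. Qed.

Lemma norm_basis i : `|e_ i| <= 1.
Proof.
apply/rV_norm_leP => // j; rewrite mxE eqxx/=.
by case: (j == i); rewrite ?normr1 ?normr0.
Qed.

Variable u : 'rV[R]_n -> R.
Hypothesis cu : forall x y t, 0 <= t <= 1 ->
  u (t *: x + (1 - t) *: y) <= t * u x + (1 - t) * u y.

Lemma convex_jensen k (y : nat -> 'rV[R]_n) :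
  u (k.+1%:R^-1 *: \sum_(i < k.+1) y i) <= k.+1%:R^-1 * \sum_(i < k.+1) u (y i).
Proof.
elim: k => [|k IH]; first by rewrite !big_ord1 invr1 scale1r mul1r.
rewrite big_ord_recr [in leRHS]big_ord_recr /=.
set S := \sum_(i < k.+1) y i in IH *; set T := \sum_(i < k.+1) u (y i) in IH *.
have k1 : k.+1%:R != 0 :> R by rewrite pnatr_eq0.
have k2 : k.+2%:R != 0 :> R by rewrite pnatr_eq0.
have E : 1 - k.+2%:R^-1 = k.+1%:R / k.+2%:R :> R.
  by rewrite -(natr1 k.+1) in k2 *; field.
have := cu (y k.+1) (k.+1%:R^-1 *: S) (invS_itv R k.+1).
rewrite E scalerA mulrAC divff// mul1r addrC -scalerDr => /le_trans; apply.
rewrite mulrDr addrC lerD2r -mulrA mulrCA ler_wpM2l//.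
rewrite -ler_pdivlMl//.
Qed.

Lemma convex_slope x v s t : 0 < s <= t ->
  (u (x + s *: v) - u x) / s <= (u (x + t *: v) - u x) / t.
Proof.
move=> /andP[s0 st]; have t0 : 0 < t by exact: lt_le_trans st.
have st01 : 0 <= s / t <= 1.
  by rewrite divr_ge0 ?(ltW s0) ?(ltW t0)// ler_pdivrMr// mul1r.
have := cu (x + t *: v) x st01.
have -> : (s / t) *: (x + t *: v) + (1 - s / t) *: x = x + s *: v.
  by apply/rowP => i; rewrite !mxE; field; rewrite gt_eqF.
move=> H; rewrite ler_pdivrMr//.
have -> : (u (x + t *: v) - u x) / t * s = s / t * u (x + t *: v) + (1 - s / t) * u x - u x.
  by field; rewrite gt_eqF.
by rewrite lerD2r.
Qed.

(** Above: [x] is the mean of the points [n x_i e_i], each on the segment between [- Q e_i] and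
    [Q e_i], so finitely many values of [u] bound it. Below: [0] is the midpoint of [x] and [- x],
    and [u (- x)] is already bounded above. *)
Lemma convex_bounded (r : R) : (0 < n)%N -> exists M : R, 0 <= M /\ forall x, `|x| <= r -> `|u x| <= M.
Proof.
move=> n0; pose Q := n%:R * `|r| + 1.
have Q0 : 0 < Q by rewrite ltr_wpDl// mulr_ge0.
pose M := \sum_i (`|u (Q *: e_ i)| + `|u (- Q *: e_ i)|).
have nn0 : n%:R != 0 :> R by rewrite pnatr_eq0 -lt0n.
have ub x : `|x| <= r -> u x <= M.
  (* [convex_jensen] takes a sequence on [nat]; the default 0 outside ['I_n] never enters the
     sum. *)
  move=> xr; pose y (i : nat) : 'rV[R]_n :=
    if insub i is Some j then (n%:R * x ord0 j) *: e_ j else 0.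
  have yE (j : 'I_n) : y j = (n%:R * x ord0 j) *: e_ j by rewrite /y valK.
  have := convex_jensen n.-1 y; rewrite prednK//.
  rewrite (eq_bigr (fun j : 'I_n => n%:R *: (x ord0 j *: e_ j))); last first.
    by move=> j _; rewrite yE scalerA.
  rewrite -scaler_sumr -rV_sum_basis scalerA mulVf// scale1r => /le_trans; apply.
  rewrite ler_pdivrMl ?ltr0n// (@le_trans _ _ (\sum_(j < n) M))//; last first.
    by rewrite sumr_const card_ord mulr_natl.
  apply: ler_sum => j _; rewrite yE.
  have sQ : `|n%:R * x ord0 j| <= Q.
    rewrite normrM ger0_norm// ler_wpDr// ler_wpM2l//.
    by rewrite (le_trans (ler_coord_norm x j))// (le_trans xr)// ler_norm.
  set s := n%:R * x ord0 j in sQ *.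
  have t01 : 0 <= (s + Q) / (2 * Q) <= 1.
    rewrite ler_norml in sQ; move/andP : sQ => [sQ1 sQ2].
    by rewrite divr_ge0 ?ler_pdivrMr ?mulr_gt0//; lra.
  have := cu (Q *: e_ j) (- Q *: e_ j) t01.
  rewrite !scalerA -scalerDl.
  have -> : (s + Q) / (2 * Q) * Q + (1 - (s + Q) / (2 * Q)) * - Q = s.
    by field; rewrite gt_eqF.
  move=> /le_trans; apply; rewrite /M (bigD1 j)//= ler_wpDr//; first exact: sumr_ge0.
  case/andP : t01 => t0 t1; apply: lerD.
    by rewrite (le_trans (ler_norm _))// normrM ger0_norm// ler_piMl.
  rewrite (le_trans (ler_norm _))// normrM ger0_norm ?subr_ge0//.
  by rewrite ler_piMl// lerBlDr lerDl.
exists (M + 2 * `|u 0|); split.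
  by rewrite addr_ge0 ?mulr_ge0// sumr_ge0.
move=> x xr; rewrite ler_norml; apply/andP; split; last first.
  by rewrite (le_trans (ub x xr))// lerDl mulr_ge0.
have h12 : 0 <= (2^-1 : R) <= 1 by lra.
have := cu x (- x) h12; rewrite (_ : _ *: x + _ = 0); last first.
  by rewrite scalerN -scalerBl (_ : _ - _ = 0) ?scale0r//; lra.
have := ub (- x); rewrite normrN => /(_ xr).
have := ler_norm (- u 0); rewrite normrN; lra.
Qed.

(** Extend the segment from [x] to [y] by length 1 beyond [y], to a point [z] where [u] is still
    bounded by [M]. Then [y] divides the segment from [x] to [z] in the ratio [d : 1] with
    [d = |y - x|], and convexity gives [u y - u x <= 2 M d / (1 + d)]. *)
Lemma convex_lipschitz (r : R) : (0 < n)%N -> exists L : R, 0 <= L /\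
  forall x y, `|x| <= r -> `|y| <= r -> `|u y - u x| <= L * `|y - x|.
Proof.
move=> n0; have [M [M0 MP]] := convex_bounded (r + 1) n0.
exists (2 * M); split; first by rewrite mulr_ge0.
suff H x y : `|x| <= r -> `|y| <= r -> u y - u x <= 2 * M * `|y - x|.
  move=> x y xr yr; rewrite ler_norml H// andbT.
  by rewrite lerNl opprB -[`|y - x|]normrN opprB H.
move=> xr yr; have [->|xy] := eqVneq y x; first by rewrite !subrr normr0 mulr0.
have d0 : 0 < `|y - x| by rewrite normr_gt0 subr_eq0.
set d := `|y - x| in d0 *; pose z := y + d^-1 *: (y - x).
have zr : `|z| <= r + 1.
  rewrite (le_trans (ler_normD _ _))// lerD// normrZ ger0_norm ?invr_ge0 ?(ltW d0)//.
  by rewrite mulVf// gt_eqF.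
have t01 : 0 <= d / (1 + d) <= 1.
  by rewrite divr_ge0 ?ler_pdivrMr//; lra.
have := cu z x t01.
have -> : (d / (1 + d)) *: z + (1 - d / (1 + d)) *: x = y.
  apply/rowP => i; rewrite !mxE; field; lra.
move=> H; have := MP z zr; have : `|u x| <= M by apply: MP; rewrite (le_trans xr)// lerDl.
rewrite !ler_norml => /andP[x1 x2] /andP[z1 z2].
have : u y - u x <= d / (1 + d) * (u z - u x) by lra.
move/le_trans; apply; rewrite (@le_trans _ _ (d / (1 + d) * (2 * M)))//.
  by rewrite ler_wpM2l//; [case/andP : t01|lra].
rewrite mulrC ler_wpM2l ?mulr_ge0//.
by rewrite ler_pdivrMr; [nra|lra].
Qed.

Lemma convex_continuous : (0 < n)%N -> continuous u.
Proof.
move=> n0 x; have [L [L0 LP]] := convex_lipschitz (`|x| + 1) n0.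
apply: continuous_at_rV => e e0; exists (Num.min 1 (e / (L + 1))).
  by rewrite lt_min ltr01 divr_gt0// ltr_wpDl.
move=> y; rewrite lt_min => /andP[/ltW yx1 /ltW yxe].
rewrite (le_trans (LP y x _ _))//.
- rewrite -(subrK x y) addrC (le_trans (ler_normD _ _))// lerD2l.
  by rewrite distrC.
- by rewrite lerDl.
- rewrite (le_trans (ler_wpM2l L0 yxe))// mulrA ler_pdivrMr ?ltr_wpDl//.
  by rewrite mulrC ler_pM2l// lerDl.
Qed.

End convex_functions.

(** * Right derivatives and points of differentiability *)

Section directional_derivative.
Context (R : realType) (n : nat).
Implicit Types (x y z v : 'rV[R]_n) (t s h : R).
Local Notation e_ := (@basis_rV R n).

(** The right directional derivative. The steps [1/(k+1)] suffice because the slopes of a convex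
    function are monotone in the step. *)
Definition dd (u : 'rV[R]_n -> R) v x : R :=
  limn (fun k => k.+1%:R * (u (x + k.+1%:R^-1 *: v) - u x)).

Variable u : 'rV[R]_n -> R.
Hypothesis n0 : (0 < n)%N.
Hypothesis cu : forall x y t, 0 <= t <= 1 ->
  u (t *: x + (1 - t) *: y) <= t * u x + (1 - t) * u y.

Lemma invS_gt0 k : 0 < (k.+1%:R^-1 : R).
Proof. by rewrite invr_gt0. Qed.

Lemma dd_cvg v x :
  k.+1%:R * (u (x + k.+1%:R^-1 *: v) - u x) @[k --> \oo] --> dd u v x.
Proof.
have [L [L0 LP]] := convex_lipschitz cu (`|x| + `|v|) n0.
apply: nonincreasing_is_cvgn.
  apply/nonincreasing_seqP => k.
  have := convex_slope cu x v (s := k.+2%:R^-1) (t := k.+1%:R^-1).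
  rewrite !invrK ![_ * _%:R]mulrC; apply.
  by rewrite invr_gt0 ltr0n/= lef_pV2 ?posrE ?ltr0n// ler_nat.
exists (- (L * `|v|)) => _ [k _ <-].
have H : `|u (x + k.+1%:R^-1 *: v) - u x| <= L * `|(x + k.+1%:R^-1 *: v) - x|.
  by apply: LP; [rewrite lerDl|apply: shift_norm => //; exact: invS_itv].
rewrite addrAC subrr add0r normrZ ger0_norm ?(ltW (invS_gt0 k))// in H.
move: H; rewrite ler_norml => /andP[H _].
rewrite -ler_pdivrMl ?ltr0n// mulrN (le_trans _ H)// lerN2.
by rewrite mulrCA.
Qed.

Arguments dd_cvg : clear implicits.

Lemma convex_rdiff v : rdiff v u (dd u v).
Proof.
split; first exact: convex_continuous cu n0.
- move=> r; have [L [L0 LP]] := convex_lipschitz cu (r + `|v|) n0.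
  exists (L * `|v|) => x t xr t01.
  rewrite (le_trans (LP _ _ _ _))//; first by rewrite (le_trans xr)// lerDl.
    exact: shift_norm.
  rewrite addrAC subrr add0r normrZ ger0_norm; last by case/andP: t01.
  by rewrite mulrA mulrAC.
- exact: dd_cvg.
Qed.

Lemma dd_le v x h : 0 < h -> dd u v x <= (u (x + h *: v) - u x) / h.
Proof.
move=> h0; apply: (cvgr_to_le (dd_cvg v x)); near=> k.
have := convex_slope cu x v (s := k.+1%:R^-1) (t := h).
rewrite invrK mulrC; apply; rewrite invS_gt0/= -[h]invrK lef_pV2 ?posrE ?invr_gt0//.
rewrite (le_trans (ltW (truncnS_gt _)))// ler_nat.
by near: k; exact: nbhs_infty_ge.
Unshelve. all: by end_near. Qed.

Lemma dd_oppose v x : - dd u (- v) x <= dd u v x.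
Proof.
have := cvg_seqD (dd_cvg v x) (dd_cvg (- v) x).
rewrite lerNl -subr_ge0 opprK addrC => H.
apply: (cvgr_to_ge H); apply: nearW => k.
rewrite -mulrDr mulr_ge0//.
have h12 : 0 <= (2^-1 : R) <= 1 by lra.
have := cu (x + k.+1%:R^-1 *: v) (x + k.+1%:R^-1 *: - v) h12.
have -> : 2^-1 *: (x + k.+1%:R^-1 *: v) + (1 - 2^-1) *: (x + k.+1%:R^-1 *: - v) = x.
  by move: (k.+1%:R^-1) => s; apply/rowP => i; rewrite !mxE; field.
lra.
Qed.

(** Only the coordinate directions are compared. For convex [u] this already amounts to
    differentiability; the two consequences used are [differentiable_subgradient] and
    [dd_continuous]. *)
Definition differentiable_pt x := forall i, dd u (- e_ i) x = - dd u (e_ i) x.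

Definition right_grad x : 'rV[R]_n := \row_i dd u (e_ i) x.

Lemma differentiable_upper x (e : R) : differentiable_pt x -> 0 < e ->
  exists2 d : R, 0 < d & forall i s, `|s| <= d ->
    u (x + s *: e_ i) - u x <= s * dd u (e_ i) x + `|s| * e.
Proof.
move=> dx e0.
have near_le v : \forall k \near \oo,
    k.+1%:R * (u (x + k.+1%:R^-1 *: v) - u x) <= dd u v x + e.
  by apply: (cvgr_le _ (dd_cvg v x)); rewrite ltrDl.
have : \forall k \near \oo, forall i,
    k.+1%:R * (u (x + k.+1%:R^-1 *: e_ i) - u x) <= dd u (e_ i) x + e /\
    k.+1%:R * (u (x + k.+1%:R^-1 *: - e_ i) - u x) <= dd u (- e_ i) x + e.
  by apply: filter_forall => i; apply: filterI; exact: near_le.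
move=> /filter_ex[k kP]; exists k.+1%:R^-1; first exact: invS_gt0.
have main v s : k.+1%:R * (u (x + k.+1%:R^-1 *: v) - u x) <= dd u v x + e ->
    0 <= s <= k.+1%:R^-1 -> u (x + s *: v) - u x <= s * (dd u v x + e).
  move=> H /andP[s0 sk]; have [->|s0'] := eqVneq s 0.
    by rewrite scale0r addr0 subrr mul0r.
  have sgt0 : 0 < s by rewrite lt_neqAle eq_sym s0'.
  rewrite mulrC -ler_pdivrMr//; apply: le_trans H.
  have := convex_slope cu x v (s := s) (t := k.+1%:R^-1).
  by rewrite invrK [_ * k.+1%:R]mulrC; apply; rewrite sgt0.
move=> i s sk; have [p1 p2] := kP i; have [s0|s0] := leP 0 s.
  rewrite (ger0_norm s0) in sk *; rewrite -mulrDr; apply: main => //.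
  by rewrite s0.
have := main (- e_ i) (- s) p2; rewrite (ltr0_norm s0) in sk *.
rewrite oppr_ge0 (ltW s0) sk => /(_ isT); rewrite scalerN scaleNr opprK dx; lra.
Qed.

(** Differentiability along the axes gives an upper bound for [u] at [x - h z], [z = y - x], by
    averaging over the coordinate directions. Since [x] lies between [x - h z] and [y], convexity
    turns it into a lower bound for [u y], up to an arbitrary [e]. *)
Lemma differentiable_subgradient x y : differentiable_pt x ->
  u x + dot (right_grad x) (y - x) <= u y.
Proof.
move=> dx; pose z := y - x; pose S : R := \sum_i `|z ord0 i|.
have S0 : 0 <= S by exact: sumr_ge0.
apply/ler_addgt0Pr => e e0; rewrite -/z.
have e'0 : 0 < e / (S + 1) by rewrite divr_gt0// ltr_wpDl.
have [d d0 dP] := differentiable_upper dx e'0.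
have n0' : n%:R != 0 :> R by rewrite pnatr_eq0 -lt0n.
(* This keeps every coordinate step [h n z_i] within the range [d] of [differentiable_upper]. *)
pose h := Num.min 1 (d / (n%:R * (`|z| + 1))).
have nz0 : 0 < n%:R * (`|z| + 1) by rewrite mulr_gt0 ?ltr0n// ltr_wpDl.
have h0 : 0 < h by rewrite lt_min ltr01 divr_gt0.
have hz i : `|- (h * n%:R * z ord0 i)| <= d.
  rewrite normrN !normrM (ger0_norm (ltW h0)) ger0_norm// -mulrA.
  rewrite (@le_trans _ _ (h * (n%:R * (`|z| + 1))))//.
    rewrite ler_pM2l// ler_wpM2l// (le_trans (ler_coord_norm z i))//.
    by rewrite lerDl.
  by rewrite -ler_pdivlMr// ge_min lexx orbT.
have key : u (x - h *: z) - u x <= - h * dot (right_grad x) z + h * S * (e / (S + 1)).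
  pose w (i : nat) : 'rV[R]_n :=
    if insub i is Some j then x + (- (h * n%:R * z ord0 j)) *: e_ j else 0.
  have wE (j : 'I_n) : w j = x + (- (h * n%:R * z ord0 j)) *: e_ j by rewrite /w valK.
  have := convex_jensen cu n.-1 w; rewrite prednK//.
  have -> : n%:R^-1 *: \sum_(i < n) w i = x - h *: z.
    rewrite (eq_bigr (fun i : 'I_n => x + (- (h * n%:R)) *: (z ord0 i *: e_ i))); last first.
      by move=> i _; rewrite wE scalerA mulNr.
    rewrite big_split/= -scaler_sumr -rV_sum_basis sumr_const card_ord.
    by rewrite -[x *+ n]scaler_nat; apply/rowP => i; rewrite !mxE; field.
  move=> H; rewrite lerBlDr; apply: (le_trans H).
  rewrite ler_pdivrMl ?ltr0n//.
  apply: (@le_trans _ _ (\sum_(i < n) (u x + (- (h * n%:R * z ord0 i) * dd u (e_ i) x +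
      `|- (h * n%:R * z ord0 i)| * (e / (S + 1)))))).
    by apply: ler_sum => i _; rewrite wE -lerBlDl; exact: dP.
  rewrite big_split/= sumr_const card_ord big_split/= -mulr_suml.
  rewrite (eq_bigr (fun i => - (h * n%:R) * (dd u (e_ i) x * z ord0 i))); last first.
    by move=> i _; ring.
  rewrite -mulr_sumr [X in _ + (X + _)](_ : _ = - (h * n%:R) * dot (right_grad x) z); last first.
    by congr (_ * _); apply: eq_bigr => i _; rewrite [right_grad x _ _]mxE.
  rewrite (eq_bigr (fun i => h * n%:R * `|z ord0 i|)); last first.
    by move=> i _; rewrite normrN !normrM (ger0_norm (ltW h0)) ger0_norm.
  rewrite -mulr_sumr -/S -mulr_natl; lra.
have h1 : h <= 1 by rewrite ge_min lexx.
(* The weight of [y] for which the convex combination of [y] and [x - h z] is [x]. *)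
have hh : 0 <= h / (1 + h) <= 1 by rewrite divr_ge0 ?ler_pdivrMr//; lra.
have := cu y (x - h *: z) hh.
have -> : (h / (1 + h)) *: y + (1 - h / (1 + h)) *: (x - h *: z) = x.
  by apply/rowP => i; rewrite !mxE; field; lra.
move=> H; have {}H : (1 + h) * u x <= h * u y + u (x - h *: z).
  have H1 : (1 + h) * u x <= (1 + h) * (h / (1 + h) * u y + (1 - h / (1 + h)) * u (x - h *: z)).
    by rewrite ler_pM2l//; lra.
  apply: (le_trans H1); rewrite le_eqVlt; apply/orP; left; apply/eqP; field; lra.
have SE : S * (e / (S + 1)) <= e.
  by rewrite mulrA ler_pdivrMr ?ltr_wpDl// mulrC ler_pM2l// lerDl.
rewrite -(ler_pM2l h0).
have : h * (S * (e / (S + 1))) <= h * e by rewrite ler_pM2l.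
move: key H; rewrite -!mulrA; set a := u (x - h *: z); set b := dot _ _; lra.
Qed.

(** Each [dd u v] is a limit of decreasing continuous quotients, hence upper semicontinuous. For
    [v = - e_i] and with [dd_oppose], this bounds [dd u (e_i)] from below, and at [x] the two bounds
    meet. *)
Lemma dd_continuous x i : differentiable_pt x ->
  {for x, continuous (dd u (e_ i))}.
Proof.
move=> dx; apply: continuous_at_rV => e e0.
have cu' := convex_continuous cu n0.
have near_le v : exists2 d : R, 0 < d & forall y, `|x - y| < d -> dd u v y <= dd u v x + e.
  have : \forall k \near \oo, k.+1%:R * (u (x + k.+1%:R^-1 *: v) - u x) < dd u v x + e.
    by apply: (cvgr_lt _ (dd_cvg v x)); rewrite ltrDl.
  move=> /filter_ex[k kP].
  pose q y := k.+1%:R * (u (y + k.+1%:R^-1 *: v) - u y).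
  have cq : {for x, continuous q}.
    have ct : y + k.+1%:R^-1 *: v @[y --> x] --> x + k.+1%:R^-1 *: v.
      exact: cvgD (@cvg_id _ _) (cvg_cst _).
    have c1 : u (y + k.+1%:R^-1 *: v) @[y --> x] --> u (x + k.+1%:R^-1 *: v).
      exact: continuous_cvg (cu' _) ct.
    exact: cvgM (cvg_cst (k.+1%:R : R)) (cvgB c1 (cu' x)).
  have := @cvgr_lt _ _ _ (nbhs_filter x) _ _ cq _ kP.
  move=> /nbhs_ballP[d d0 dP]; exists d => // y xy.
  have /ltW : q y < dd u v x + e by apply: dP; rewrite -ball_normE.
  apply: le_trans.
  have := dd_le v y (invS_gt0 k); rewrite invrK mulrC; exact.
have [d1 d10 d1P] := near_le (e_ i); have [d2 d20 d2P] := near_le (- e_ i).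
exists (Num.min d1 d2); first by rewrite lt_min d10.
move=> y; rewrite lt_min => /andP[/d1P y1 /d2P y2].
have := dd_oppose (e_ i) y; rewrite dx in y2.
rewrite ler_distlC; lra.
Qed.

End directional_derivative.

(** * Smooth functions and bump functions *)

Section directional_derivatives.
Context (R : realType) (n : nat).
Implicit Types (F : 'rV[R]_n -> R) (x v : 'rV[R]_n).

Lemma is_derive_line F x v d :
  is_derive (0 : R) 1 (fun t => F (x + t *: v)) d -> is_derive x v F d.
Proof.
have E : (fun h : R => h^-1 *: (F (x + (h *: 1 + 0) *: v) - F (x + 0 *: v))) =
   (fun h : R => h^-1 *: (F (h *: v + x) - F x)).
  by apply/funext => h; rewrite scale0r !addr0 [h%:A]mulr1 [x + _]addrC.
move=> [d1 d2]; split.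
  by move: d1; rewrite /derivable /= E.
by move: d2; rewrite /derive /= E.
Qed.

Lemma is_derive_seq F x v d :
  (forall a : nat -> R, (forall k, a k != 0) -> a k @[k --> \oo] --> (0 : R) ->
    (F (x + a k *: v) - F x) / a k @[k --> \oo] --> d) -> is_derive x v F d.
Proof.
move=> H; have C : h^-1 *: (F (h *: v + x) - F x) @[h --> (0 : R)^'] --> d.
  apply/cvgr_dnbhsP => a [a0 ac]; have := H a a0 ac.
  by apply: eq_cvg_seq => k; rewrite [_ *: v + _]addrC mulrC.
by apply: DeriveDef; [apply/cvg_ex; exists d|exact/cvg_lim].
Qed.

Lemma continuous_at_seq F x :
  (forall y : nat -> 'rV[R]_n, y k @[k --> \oo] --> x -> F (y k) @[k --> \oo] --> F x) ->
  {for x, continuous F}.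
Proof.
move=> H; apply: continuous_at_rV => e e0; apply: contrapT => /forall2NP N.
have /choice[y yP] (k : nat) : exists y, `|x - y| < k.+1%:R^-1 /\ e < `|F x - F y|.
  have [|/existsNP[y /not_implyP[xy /negP]]] := N k.+1%:R^-1.
    by move=> /negP; rewrite invr_gt0 ltr0n.
  by rewrite -ltNge => Fy; exists y.
have yx : y k @[k --> \oo] --> x.
  apply/cvgrPdist_le => d d0; have := @cvg_invS R => /cvgrPdist_le /(_ d d0).
  apply: filterS => k; rewrite sub0r normrN ger0_norm ?invr_ge0//.
  by apply: le_trans; apply: ltW; have [] := yP k.
have /cvgrPdist_le /(_ e e0) /filter_ex[k] := H y yx.
by rewrite leNgt => /negP; apply; have [] := yP k.
Qed.

End directional_derivatives.

Section smooth_functions.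
Context (R : realType) (n : nat).
Implicit Types (f g : 'rV[R]_n -> R) (i j : 'I_n) (x : 'rV[R]_n).
Local Notation e_ := (@basis_rV R n).

Definition smooth f := forall k, Ck k f.

Lemma smooth_continuous f : smooth f -> continuous f.
Proof. by move=> /(_ 0%N). Qed.

Lemma smooth_derivable f i x : smooth f -> is_derive x (e_ i) f (partial i f x).
Proof. by move=> /(_ 1%N)[d _]; apply: DeriveDef => //; exact: d. Qed.

Lemma smooth_partial f i : smooth f -> smooth (partial i f).
Proof. by move=> sf k; have [_] := sf k.+1; exact. Qed.

(** Coinduction for smoothness: a class of continuous functions closed under partial derivatives
    consists of smooth functions, so higher derivatives need not be computed. *)
Lemma smooth_coind (P : ('rV[R]_n -> R) -> Prop) :
  (forall f, P f -> continuous f /\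
     forall i, exists2 g, P g & forall x, is_derive x (e_ i) f (g x)) ->
  forall f, P f -> smooth f.
Proof.
move=> PP f Pf k; elim: k f Pf => [|k IH] f Pf; first by have [] := PP _ Pf.
have [_ dP] := PP _ Pf; split=> [i x|i].
  by have [g _ /(_ x)[]] := dP i.
have [g Pg dg] := dP i; rewrite (_ : partial i f = g); first exact: IH.
by apply/funext => x; have [] := dg x.
Qed.

(** Products alone are not closed under differentiation; by the Leibniz rule, their finite sums
    are. *)
Inductive prod_span : ('rV[R]_n -> R) -> Prop :=
| Prod_span f g : smooth f -> smooth g -> prod_span (fun x => f x * g x)
| Sum_span f g : prod_span f -> prod_span g -> prod_span (fun x => f x + g x).

Lemma smoothM f g : smooth f -> smooth g -> smooth (fun x => f x * g x).
Proof.
move=> sf sg; apply: (smooth_coind (P := prod_span)); last exact: Prod_span.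
move=> {f g sf sg} ? ; elim=> [f g sf sg|f g _ [cf df] _ [cg dg]]; split.
- have cf := smooth_continuous sf; have cg := smooth_continuous sg.
  by move=> x; exact: cvgM (cf x) (cg x).
- move=> i; exists (fun x => f x * partial i g x + partial i f x * g x).
    by apply: Sum_span; apply: Prod_span => //; exact: smooth_partial.
  move=> x; have := is_deriveM (smooth_derivable i x sf) (smooth_derivable i x sg).
  by move=> H; apply: is_derive_eq H _; rewrite /GRing.scale/= [g x * _]mulrC.
- by move=> x; exact: cvgD (cf x) (cg x).
- move=> i; have [f' pf' df'] := df i; have [g' pg' dg'] := dg i.
  exists (fun x => f' x + g' x); first exact: Sum_span.
  by move=> x; exact: is_deriveD.
Qed.

Lemma smooth_cst c : smooth (fun=> c).
Proof.
apply: (smooth_coind (P := fun f => exists c, f = fun=> c)); last by exists c.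
move=> _ [d ->]; split; first exact: cst_continuous.
by move=> i; exists (fun=> 0); [exists 0|move=> x; exact: is_derive_cst].
Qed.

Lemma smoothZ c f : smooth f -> smooth (fun x => c * f x).
Proof. by move=> sf; apply: smoothM => //; exact: smooth_cst. Qed.

Lemma smooth_prod (I : Type) (s : seq I) (F : I -> 'rV[R]_n -> R) :
  (forall k, smooth (F k)) -> smooth (fun x => \prod_(k <- s) F k x).
Proof.
move=> sF; elim: s => [|i0 s IH].
  have -> : (fun x => \prod_(k <- [::]) F k x) = fun=> 1.
    by apply/funext => x; rewrite big_nil.
  exact: smooth_cst.
have -> : (fun x => \prod_(k <- i0 :: s) F k x) = (fun x => F i0 x * \prod_(k <- s) F k x).
  by apply/funext => x; rewrite big_cons.
exact: smoothM.
Qed.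

Lemma is_derive_coord (h h' : R -> R) i j (c b : R) x :
  (forall s : R, is_derive s 1 h (h' s)) ->
  is_derive x (e_ j) (fun x => h (c * x ord0 i + b))
    ((if j == i then c else 0) * h' (c * x ord0 i + b)).
Proof.
move=> dh; set k := if j == i then c else 0; set s := c * x ord0 i + b.
have E t : c * (t *: e_ j + x) ord0 i + b = k * t + s.
  rewrite !mxE eqxx/= /k /s [j == i]eq_sym; case: (i == j) => /=; ring.
apply: is_derive_line.
have -> : (fun t : R => h (c * (x + t *: e_ j) ord0 i + b)) = h \o (fun t => k * t + s).
  by apply/funext => t /=; rewrite -E [x + _]addrC.
rewrite mulrC; apply: is_derive1_comp.
  by rewrite mulr0 add0r.
rewrite (_ : (fun t : R => k * t + s) = (k \*: id) + cst s)//.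
by apply: is_derive_eq; rewrite addr0 /GRing.scale/= mulr1.
Qed.

End smooth_functions.

Section flat_functions.
Context (R : realType).
Implicit Types (s : R) (m : nat).

(* s^-m exp(-1/s) for s > 0; the span of this family is stable under
   differentiation. *)
Definition flat m s : R := if 0 < s then s^-1 ^+ m * expR (- s^-1) else 0.

(** From [exp y >= y^(m+2) / (m+2)!] at [y = 1/s]. The decay of order 2 at 0 is what makes the
    derivative vanish there. *)
Lemma flat_bound m s : `|flat m s| <= m.+2`!%:R * s ^+ 2.
Proof.
rewrite /flat; case: ifPn => s0; last by rewrite normr0 mulr_ge0// sqr_ge0.
rewrite ger0_norm ?mulr_ge0 ?exprn_ge0 ?invr_ge0 ?expR_ge0 ?(ltW s0)//.
have := expR_ge1Dxn m.+1 (x := s^-1); rewrite invr_ge0 (ltW s0) => /(_ isT) H.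
have {}H : s^-1 ^+ m.+2 <= m.+2`!%:R * expR s^-1.
  by rewrite -ler_pdivrMl ?ltr0n ?fact_gt0// mulrC (le_trans _ H)// lerDr.
rewrite expRN ler_pdivrMr ?expR_gt0//.
have -> : s^-1 ^+ m = s ^+ 2 * s^-1 ^+ m.+2.
  by rewrite !exprS; field; rewrite gt_eqF.
by apply: (le_trans (ler_wpM2l (sqr_ge0 s) H)); rewrite mulrCA mulrA.
Qed.

Lemma flat_le0 m s : s <= 0 -> flat m s = 0.
Proof. by rewrite /flat leNgt => /negbTE ->. Qed.

Lemma flat_derive m s : is_derive s 1 (flat m) (flat m.+2 s - m%:R * flat m.+1 s).
Proof.
have [s0|s0|->] := ltgtP s 0.
- rewrite !flat_le0 ?(ltW s0)// mulr0 subr0.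
  apply: (near_eq_is_derive (f := fun=> 0)).
    by near=> t; rewrite flat_le0//; near: t; exact: lt_le_nbhsl.
- have nE : \near s, (fun t : R => t^-1 ^+ m * expR (- t^-1)) s = flat m s.
    by near=> t; rewrite /flat ifT//; near: t; exact: lt_nbhsr.
  have dV : is_derive s 1 (fun t : R => t^-1) (- s ^- 2).
    have := @is_deriveV R id s 1 1; rewrite gt_eqF// => /(_ isT (is_derive_id _ _)).
    by rewrite [_ *: 1]mulr1.
  have dE := is_derive1_comp (f := expR) (g := fun t => - t^-1)
    (is_derive_expR (- s^-1)) (is_deriveN dV).
  have dM := is_deriveM (is_deriveX m dV) dE.
  have fE : ((fun t : R => t^-1) ^+ m * (expR \o (fun t : R => - t^-1)) : R -> R) =
      (fun t => t^-1 ^+ m * expR (- t^-1)).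
    by apply/funext => t; rewrite mulrfctE exprfctE.
  rewrite fE in dM; apply: is_derive_eq (near_eq_is_derive nE dM) _.
  rewrite exprfctE.
  rewrite /flat s0 /GRing.scale/=.
  case: (m) => [|k] /=; first by rewrite !expr0; field; rewrite gt_eqF.
  by rewrite !exprS; field; rewrite gt_eqF.
- rewrite !flat_le0// mulr0 subr0.
  have H : h^-1 *: (flat m (h *: 1 + 0) - flat m 0) @[h --> (0 : R)^'] --> (0 : R).
    apply/cvgrPdist_le => e e0; near=> h.
    rewrite addr0 [h%:A]mulr1 [flat m 0]flat_le0// subr0 sub0r normrN normrM.
    have h0 : h != 0 by near: h; exact: nbhs_dnbhs_neq.
    rewrite normfV ler_pdivrMl ?normr_gt0// (le_trans (flat_bound m h))//.
    rewrite -[h ^+ 2]real_normK ?num_real// expr2 mulrCA ler_wpM2l//.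
    rewrite -ler_pdivlMl ?ltr0n ?fact_gt0//.
    near: h; apply: (@dnbhs0_le _ R).
    by rewrite mulr_gt0// invr_gt0 ltr0n fact_gt0.
  by apply: DeriveDef; [apply/cvg_ex; exists 0|apply/cvg_lim].
Unshelve. all: by end_near. Qed.

End flat_functions.

Section bump_functions.
Context (R : realType) (n : nat).
Local Notation mu := (lebesgue_rV R n).
Implicit Types (f g phi : 'rV[R]_n -> R) (i j : 'I_n) (x : 'rV[R]_n) (D : set 'rV[R]_n).
Local Notation e_ := (@basis_rV R n).

(** Closed under all partial derivatives: along another coordinate than [i] the derivative is the
    multiple by 0 supplied by [Flat_scale]. *)
Inductive flat_span i : ('rV[R]_n -> R) -> Prop :=
| Flat_base m c b : flat_span i (fun x => flat m (c * x ord0 i + b))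
| Flat_add f g : flat_span i f -> flat_span i g -> flat_span i (fun x => f x + g x)
| Flat_scale c f : flat_span i f -> flat_span i (fun x => c * f x).

Lemma smooth_flat m i (c b : R) : smooth (fun x => flat m (c * x ord0 i + b)).
Proof.
apply: (smooth_coind (P := flat_span i)); last exact: Flat_base.
move=> ?; elim=> {m c b} [m c b|f g _ [cf df] _ [cg dg]|c f _ [cf df]]; split.
- have cflat : continuous (@flat R m).
    move=> s; apply/differentiable_continuous/derivable1_diffP.
    by have [] := flat_derive m s.
  move=> x; have cc : (fun y : 'rV[R]_n => c * y ord0 i + b) y @[y --> x] --> c * x ord0 i + b.
    exact: cvgD (cvgM (cvg_cst c) (@coord_continuous _ _ _ _ _ x)) (cvg_cst b).
  exact: continuous_cvg (cflat _) cc.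
- move=> j; exists (fun x => (if j == i then c else 0) *
      (flat m.+2 (c * x ord0 i + b) + - m%:R * flat m.+1 (c * x ord0 i + b))).
    apply: Flat_scale; apply: Flat_add; first exact: Flat_base.
    by apply: Flat_scale; exact: Flat_base.
  move=> x; have := is_derive_coord i j c b x (flat_derive m).
  by move=> H; apply: is_derive_eq H _; rewrite mulNr.
- by move=> x; exact: cvgD (cf x) (cg x).
- move=> j; have [f' pf' df'] := df j; have [g' pg' dg'] := dg j.
  exists (fun x => f' x + g' x); first exact: Flat_add.
  by move=> x; exact: is_deriveD.
- by move=> x; exact: cvgM (cvg_cst c) (cf x).
- move=> j; have [f' pf' df'] := df j.
  exists (fun x => c * f' x); first exact: Flat_scale.
  by move=> x; exact: is_deriveZ.
Qed.

(** One flat factor for each face of the box; the factor [k+1] in the argument drives each of them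
    to 1 inside, so these functions tend to the indicator of the open box. *)
Definition box_bump (a b : 'I_n -> R) (k : nat) x : R :=
  \prod_(i < n) (flat 0 (k.+1%:R * x ord0 i + - (k.+1%:R * a i)) *
                 flat 0 (- k.+1%:R * x ord0 i + k.+1%:R * b i)).

Lemma smooth_box_bump a b k : smooth (box_bump a b k).
Proof. by apply: smooth_prod => i; apply: smoothM; exact: smooth_flat. Qed.

Lemma flat0_itv (s : R) : 0 <= flat 0 s <= 1.
Proof.
rewrite /flat; case: ifPn => s0; rewrite ?lexx ?ler01// expr0 mul1r expR_ge0.
by rewrite expR_le1 oppr_le0 invr_ge0 ltW.
Qed.

Lemma box_bump_itv a b k x : 0 <= box_bump a b k x <= 1.
Proof.
rewrite /box_bump; elim/big_ind : _ => [|y z /andP[y0 y1] /andP[z0 z1]|i _].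
- by rewrite ler01 lexx.
- by rewrite mulr_ge0// mulr_ile1.
- have /andP[y0 y1] := flat0_itv (k.+1%:R * x ord0 i + - (k.+1%:R * a i)).
  have /andP[z0 z1] := flat0_itv (- k.+1%:R * x ord0 i + k.+1%:R * b i).
  by rewrite mulr_ge0// mulr_ile1.
Qed.

Lemma box_bump_out a b k x : ~ obox a b x -> box_bump a b k x = 0.
Proof.
move=> /existsNP[i /negP]; rewrite in_itv/= negb_and -!leNgt => H.
rewrite /box_bump (bigD1 i)//=; case/orP : H => H.
  by rewrite flat_le0 ?mul0r// -mulrBr mulr_ge0_le0// subr_le0.
by rewrite [X in _ * X * _]flat_le0 ?mulr0 ?mul0r// mulNr addrC -mulrBr mulr_ge0_le0// subr_le0.
Qed.

Lemma box_bump_gt0 a b k x : obox a b x -> 0 < box_bump a b k x.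
Proof.
move=> xab; rewrite /box_bump prodr_gt0// => i _.
have := xab i; rewrite in_itv/= => /andP[ax xb].
rewrite /flat !ifT; last 2 first.
- by rewrite mulNr addrC -mulrBr mulr_gt0// subr_gt0.
- by rewrite -mulrBr mulr_gt0// subr_gt0.
by rewrite !expr0 !mul1r mulr_gt0// expR_gt0.
Qed.

Lemma flat0_cvg (t : R) : 0 < t -> flat 0 (k.+1%:R * t) @[k --> \oo] --> (1 : R).
Proof.
move=> t0.
have : expR (- (t^-1 * k.+1%:R^-1)) @[k --> \oo] --> (1 : R).
  have := cvg_seq_comp (@continuous_expR R _)
    (cvg_seqN (cvg_seqZ (m := t^-1) (@cvg_invS R))).
  by rewrite mulr0 oppr0 expR0.
apply: eq_cvg_seq => k; rewrite /flat ifT ?mulr_gt0// expr0 mul1r.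
by rewrite invfM mulrC.
Qed.

Lemma box_bump_cvg a b x : box_bump a b k x @[k --> \oo] --> (\1_(obox a b) x : R).
Proof.
rewrite indicE; have [xab|xab] := pselect (obox a b x); last first.
  rewrite memNset//= (_ : (fun k => _) = fun=> 0); first exact: cvg_cst.
  by apply/funext => k; rewrite box_bump_out.
rewrite mem_set//= /box_bump.
have H i : flat 0 (k.+1%:R * x ord0 i + - (k.+1%:R * a i)) *
    flat 0 (- k.+1%:R * x ord0 i + k.+1%:R * b i) @[k --> \oo] --> (1 : R).
  have := xab i; rewrite in_itv/= => /andP[ax xb].
  rewrite -subr_gt0 in ax; rewrite -subr_gt0 in xb.
  have := cvg_seqM (flat0_cvg ax) (flat0_cvg xb); rewrite mulr1.
  by apply: eq_cvg_seq => k; congr (flat _ _ * flat _ _); ring.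
elim: (index_enum _) => [|i s IH].
  rewrite (_ : (fun k => _) = fun=> 1); first exact: cvg_cst.
  by apply/funext => k; rewrite big_nil.
have := cvg_seqM (H i) IH; rewrite mulr1.
by apply: eq_cvg_seq => k; rewrite big_cons.
Qed.

Lemma partial_support i phi x :
  ~ closure [set x | phi x != 0] x -> partial i phi x = 0.
Proof.
move=> Nx; rewrite /partial (@near_eq_derive _ _ _ phi (cst 0)).
  by rewrite derive_cst.
have oC : open (~` closure [set x | phi x != 0]).
  by apply: closed_openC; exact: closed_closure.
have := open_nbhs_nbhs (conj oC Nx); apply: filterS => y Ny.
by apply/eqP; apply: contrapT => /negP y0; apply: Ny; exact: subset_closure.
Qed.

Lemma smooth_test_function D phi (r : R) : smooth phi ->
  (forall x, r <= `|x| -> phi x = 0) -> (forall x, `|x| <= r -> D x) ->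
  test_function D phi.
Proof.
move=> sphi phi0 rD.
have cl : closure [set x | phi x != 0] `<=` [set x | `|x| <= r].
  have cB : closed [set x : 'rV[R]_n | `|x| <= r].
    rewrite (_ : [set x | _] = (fun x : 'rV[R]_n => `|x|) @^-1` [set y | y <= r])//.
    apply: closed_comp => [x _|]; first exact: norm_continuous.
    exact: closed_le.
  rewrite [X in _ `<=` X](closure_id _).1//; apply: closure_subset => x /=.
  by apply: contraNT; rewrite -ltNge => /ltW/phi0 ->.
split => //; last by move=> x /cl /=; exact: rD.
apply: bounded_closed_compact; last exact: closed_closure.
exists r; split; first exact: num_real.
by move=> s rs x /cl /= xr; rewrite (le_trans xr)// ltW.
Qed.

End bump_functions.

(** * Fundamental lemma and mollification *)

Section fundamental_lemma.
Context (R : realType) (n : nat).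
Local Notation mu := (lebesgue_rV R n).
Implicit Types (f g phi : 'rV[R]_n -> R) (x : 'rV[R]_n) (A B D : set 'rV[R]_n) (r : R).

Lemma obox_cube (a b : 'I_n -> R) : exists2 r : R, 0 < r & obox a b `<=` cube r.
Proof.
pose r : R := \sum_i (`|a i| + `|b i|) + 1.
have r0 : 0 < r by rewrite ltr_wpDl// sumr_ge0.
exists r => // x xab; apply/(rV_norm_ltP _ r0) => i.
have : `|a i| + `|b i| < r.
  by rewrite /r (bigD1 i)//= -addrA ltrDl ltr_wpDl// sumr_ge0.
have := xab i; rewrite in_itv/= ltr_norml => /andP[ax xb].
have := ler_norm (b i); have := ler_norm (- a i); rewrite normrN.
have := normr_ge0 (a i); have := normr_ge0 (b i).
by move=> *; apply/andP; split; lra.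
Qed.

(** The measurable sets over which [g] integrates to 0 form a lambda-system containing the boxes,
    hence all measurable sets. *)
Lemma null_integral_oboxes g : mu.-integrable setT (EFin \o g) ->
  (forall B, oboxes B -> \int[mu]_x (g x * \1_B x) = 0) ->
  {ae mu, forall x, g x = 0}.
Proof.
move=> ig gB; have mg : measurable_fun setT g.
  by apply/measurable_EFinP; case/integrableP : ig.
have igA A : measurable A -> mu.-integrable setT (EFin \o (fun x => g x * \1_A x)).
  move=> mA; apply: le_integrable ig => //.
    by apply/measurable_EFinP; apply: measurable_funM => //; exact: measurable_indic.
  move=> x _ /=; rewrite lee_fin normrM ler_piMr// indicE.
  by case: (x \in A); rewrite ?normr1 ?normr0.
pose H := [set A | measurable A /\ \int[mu]_x (g x * \1_A x) = 0].
have cvgA (F : nat -> set 'rV[R]_n) : nondecreasing_seq F ->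
    (forall k, H (F k)) -> H (\bigcup_k F k).
  move=> ndF HF; have mF k : measurable (F k) by have [] := HF k.
  have mU : measurable (\bigcup_k F k) by exact: bigcupT_measurable.
  split => //; apply/esym/(cvg_unique _ _ (dominated_Rintegral_cvg (D := setT)
      (f_ := fun k x => g x * \1_(F k) x) (g := fun x => `|g x|) _ _ _ _ _ _)) => //=.
  - rewrite (_ : (fun k => _) = fun=> 0); first exact: cvg_cst.
    by apply/funext => k; have [] := HF k.
  - by move=> k; apply: measurable_funM => //; exact: measurable_indic.
  - by apply: measurable_funM => //; exact: measurable_indic.
  - apply: aeW => x _; apply: cvg_seqZ.
    have [[N _ FNx]|Ux] := pselect ((\bigcup_k F k) x); last first.
      rewrite indicE memNset// (_ : (fun k => _) = fun=> 0); first exact: cvg_cst.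
      apply/funext => k; rewrite indicE memNset// => Fkx.
      by apply: Ux; exists k.
    rewrite indicE mem_set; last by exists N.
    apply: cvg_near_cst; near=> k; rewrite indicE mem_set//.
    have : F N `<=` F k by apply/subsetPset/ndF; near: k; exact: nbhs_infty_ge.
    exact.
  - exact: integrable_norm.
  - apply: aeW => x k _; rewrite normrM ler_piMr// indicE.
    by case: (x \in F k); rewrite ?normr1 ?normr0.
have HT : H setT.
  rewrite -bigcup_nat_cube; apply: cvgA.
    move=> k l kl; apply/subsetPset => x xk i; have := xk i.
    rewrite !in_itv/= => /andP[x1 x2].
    have kl' : k%:R <= l%:R :> R by rewrite ler_nat.
    by apply/andP; split; lra.
  move=> k; split; first exact: measurable_obox.
  by apply: gB; eexists; eexists.
have lam : lambda_system setT H.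
  split => // A B BA [mA A0] [mB B0]; split; first exact: measurableD.
  rewrite (_ : (fun x => _) = (fun x => g x * \1_A x - g x * \1_B x)).
    by rewrite RintegralB ?A0 ?B0 ?subrr//; exact: igA.
  apply/funext => x; rewrite -mulrBr !indicE in_setD; congr (_ * _).
  have [xB|xB] := boolP (x \in B); last by rewrite andbT subr0.
  by rewrite andbF mem_set ?subrr//; apply: BA; exact: set_mem.
have HA A : measurable A -> H A.
  rewrite measurable_rVE; move: A; apply: (lambda_system_subset (@setI_closed_oboxes R n) lam) => //.
  by move=> B BB; split; [case: BB => a [b ->]; exact: measurable_obox|exact: gB].
have : ae_eq mu setT (EFin \o g) (cst 0%E); last first.
  by apply: filterS => x /(_ I) /= [->].
apply: integral_ae_eq => // E _ mE.
rewrite integral0; have [_ E0] := HA E mE.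
rewrite integral_mkcond -[LHS]fineK; last first.
  apply: integrable_fin_num => //; rewrite -integrable_mkcond//.
  exact: integrableS ig.
rewrite -[RHS]/((0 : R)%:E) -E0; congr (fine _)%:E; apply: eq_integral => x _.
by rewrite patchE indicE; case: ifP; rewrite ?mulr1 ?mulr0.
Unshelve. all: by end_near. Qed.

(** The bumps [box_bump] are admissible and converge boundedly to the indicators of boxes, so [f]
    integrates to 0 over every box. As [f] is only locally integrable, the conclusion is drawn on
    cubes. *)
Lemma smooth_null f : measurable_fun setT f ->
  (forall r, mu.-integrable (cube r) (EFin \o f)) ->
  (forall phi r, smooth phi -> (forall x, r <= `|x| -> phi x = 0) ->
    \int[mu]_x (f x * phi x) = 0) ->
  {ae mu, forall x, f x = 0}.
Proof.
move=> mf lf f0.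
have box0 a b : \int[mu]_x (f x * \1_(obox a b) x) = 0.
  have [r r0 abr] := obox_cube a b.
  have bcvg : \int[mu]_x (f x * box_bump a b k x) @[k --> \oo] --> (0 : R).
    rewrite (_ : (fun k => _) = fun=> 0); first exact: cvg_cst.
    apply/funext => k; apply: (f0 _ r); first exact: smooth_box_bump.
    by move=> x rx; apply: box_bump_out => /abr; rewrite /cube/= ltNge rx.
  apply: (cvg_unique _ _ bcvg) => //.
  apply: (dominated_Rintegral_cvg (g := fun x => `|f x| * \1_(cube r) x)) => //.
  - move=> k; apply: measurable_funM => //; apply: continuous_measurable_rV.
    exact/smooth_continuous/smooth_box_bump.
  - by apply: measurable_funM => //; apply: measurable_indic; exact: measurable_obox.
  - by apply: aeW => x _; apply: cvg_seqZ; exact: box_bump_cvg.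
  - have := integrable_norm (lf r); rewrite (integrable_mkcond _ (measurable_cube r)).
    congr (mu.-integrable _ _); apply/funext => x; rewrite patchE /= indicE.
    by case: ifP; rewrite ?mulr1 ?mulr0.
  - apply: aeW => x k _; rewrite normrM ler_wpM2l// ger0_norm; last first.
      by have /andP[] := box_bump_itv a b k x.
    have [xab|xab] := pselect (obox a b x); last by rewrite box_bump_out.
    by rewrite indicE mem_set//=; [have /andP[] := box_bump_itv a b k x|exact: abr].
have cube0 k : {ae mu, forall x, cube k.+1%:R x -> f x = 0}.
  have : {ae mu, forall x, f x * \1_(cube k.+1%:R) x = 0}.
    apply: null_integral_oboxes.
      have := lf k.+1%:R; rewrite (integrable_mkcond _ (measurable_cube _)).
      congr (mu.-integrable _ _); apply/funext => x; rewrite patchE /= indicE.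
      by case: ifP; rewrite ?mulr1 ?mulr0.
    move=> _ [a [b ->]].
    (* The intersection of a box with a cube is again a box. *)
    rewrite (_ : (fun x => _) = (fun x => f x * \1_(obox
      (fun i => Num.max (a i) (- k.+1%:R)) (fun i => Num.min (b i) k.+1%:R)) x)).
      exact: box0.
    apply/funext => x; rewrite -mulrA; congr (_ * _).
    have k0 : 0 < k.+1%:R :> R by rewrite ltr0n.
    rewrite cubeE// !indicE -natrM mulnb; congr (nat_of_bool _)%:R.
    apply/andP/idP.
    - move=> [/set_mem xk /set_mem xab]; apply/mem_set => i.
      have := xk i; have := xab i; rewrite !in_itv/= gt_max lt_min.
      by move=> /andP[-> ->] /andP[-> ->].
    - move=> /set_mem xm; split; apply/mem_set => i; have := xm i;
        by rewrite !in_itv/= gt_max lt_min => /andP[/andP[? ?] /andP[? ?]]; apply/andP.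
  apply: filterS => x /= /[swap] xk; rewrite indicE mem_set// mulr1//.
have /ae_foralln H := cube0.
apply: filterS H => x H; apply: (H (Num.truncn `|x|)).
exact: truncnS_gt.
Qed.

End fundamental_lemma.

Section mollification.
Context (R : realType) (n : nat).
Local Notation mu := (lebesgue_rV R n).
Local Notation e_ := (@basis_rV R n).
Implicit Types (f g phi w eta : 'rV[R]_n -> R) (x : 'rV[R]_n) (A B D : set 'rV[R]_n) (r : R).

Lemma Rintegral_gt0 f x0 : continuous f -> mu.-integrable setT (EFin \o f) ->
  (forall x, 0 <= f x) -> 0 < f x0 -> 0 < \int[mu]_x f x.
Proof.
move=> cf intf f0 fx0.
have fx02 : f x0 / 2 < f x0 by lra.
have := @cvgr_gt _ _ _ (nbhs_filter x0) _ _ (cf x0) _ fx02.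
move=> /nbhs_ballP[d /= d0 dP].
pose B := obox (fun i => x0 ord0 i - d) (fun i => x0 ord0 i + d).
have BP x : B x -> f x0 / 2 < f x.
  move=> xB; apply: dP; rewrite -ball_normE /=; apply/(rV_norm_ltP _ d0) => i.
  by have := xB i; rewrite in_itv/= !mxE ltr_norml => /andP[? ?]; apply/andP; split; lra.
have mB : measurable B by exact: measurable_obox.
have iB : mu.-integrable setT (EFin \o (fun x => f x0 / 2 * \1_B x)).
  apply: le_integrable intf => //.
    by apply/measurable_EFinP; apply: measurable_funM => //; exact: measurable_indic.
  move=> x _ /=; rewrite lee_fin (ger0_norm (f0 x)) indicE.
  have [xB|_] := boolP (x \in B); last by rewrite mulr0 normr0.
  by rewrite mulr1 ger0_norm ?divr_ge0 ?(ltW fx0)//; apply/ltW/BP; exact: set_mem.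
apply: (@lt_le_trans _ _ (\int[mu]_x (f x0 / 2 * \1_B x))); last first.
  apply: le_Rintegral => // x _; rewrite indicE.
  have [xB|_] := boolP (x \in B); last by rewrite mulr0.
  by rewrite mulr1; apply/ltW/BP; exact: set_mem.
rewrite (_ : (fun x => _) = ((fun=> f x0 / 2) \_ B)); last first.
  by apply/funext => x; rewrite patchE indicE; case: ifP; rewrite ?mulr1 ?mulr0.
rewrite -Rintegral_mkcond Rintegral_cst// mulr_gt0//; first by lra.
apply: fine_gt0; rewrite obox_fin andbT obox_gt0// => i; lra.
Qed.

Lemma mollifier_exists (d : R) : 0 < d -> exists eta,
  [/\ smooth eta, forall x, 0 <= eta x, forall x, d <= `|x| -> eta x = 0 &
      \int[mu]_x eta x = 1].
Proof.
move=> d0; pose b := box_bump (n := n) (fun=> - d) (fun=> d) 0.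
have b0 x : 0 <= b x by have /andP[] := box_bump_itv (fun=> - d) (fun=> d) 0 x.
have bout x : d <= `|x| -> b x = 0.
  move=> dx; apply: box_bump_out; rewrite -cubeE// /cube/= => xd.
  by rewrite ltNge dx in xd.
have sb : smooth b by exact: smooth_box_bump.
have ib : mu.-integrable setT (EFin \o b).
  apply: (lbounded_integrable (r := d)) => //.
    by apply: continuous_measurable_rV; exact: smooth_continuous.
  by apply: continuous_lbounded; exact: smooth_continuous.
have I0 : 0 < \int[mu]_x b x.
  apply: (Rintegral_gt0 (x0 := 0)) => //; first exact: smooth_continuous.
  by apply: box_bump_gt0 => i; rewrite mxE in_itv/= oppr_lt0 d0.
exists (fun x => (\int[mu]_x b x)^-1 * b x); split.
- exact: smoothZ.
- by move=> x; rewrite mulr_ge0// invr_ge0 ltW.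
- by move=> x /bout ->; rewrite mulr0.
- by rewrite RintegralZl// mulVf// gt_eqF.
Qed.

(** A correlation: [eta] is not reflected, whence the factor [- 1] in the derivatives below. *)
Definition convol w eta x : R := \int[mu]_y (w y * eta (y - x)).

Lemma continuous_support_bounded f r : continuous f -> (forall x, r <= `|x| -> f x = 0) ->
  exists M : R, 0 <= M /\ forall x, `|f x| <= M.
Proof.
move=> cf f0; have [M [M0 MP]] := continuous_bounded r cf; exists M; split => // x.
by have [/MP//|/ltW/f0 ->] := leP `|x| r; rewrite normr0.
Qed.

Lemma continuous_shift eta x : continuous eta -> continuous (fun y : 'rV[R]_n => eta (y - x)).
Proof.
move=> ce y; have cy : z - x @[z --> y] --> y - x by exact: cvgB (@cvg_id _ _) (cvg_cst _).
exact: continuous_cvg (ce _) cy.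
Qed.

(** The margin 1 bounds the norm of a basis vector, through [rdiff_support]. *)
Lemma partial_outside eta i r : smooth eta -> (forall x, r <= `|x| -> eta x = 0) ->
  forall x, r + 1 <= `|x| -> partial i eta x = 0.
Proof.
move=> se eta0 x rx.
have re : rdiff (1 *: e_ i) eta (fun x => 1 * partial i eta x).
  apply: C1_rdiff; first by move=> y; exact: smooth_derivable.
    exact: smooth_continuous.
  exact/smooth_continuous/smooth_partial.
rewrite scale1r in re; rewrite -[LHS]mul1r.
by rewrite (rdiff_support re eta0)// (le_trans _ rx)// lerD2l norm_basis.
Qed.

Lemma convol_integrable w eta r x : continuous w -> (forall y, r <= `|y| -> w y = 0) ->
  continuous eta -> mu.-integrable setT (EFin \o (fun y : 'rV[R]_n => w y * eta (y - x))).
Proof.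
move=> cw w0 ce; have cs := @continuous_shift eta x ce.
apply: (lbounded_integrable (r := r)).
- by apply: measurable_funM; exact: continuous_measurable_rV.
- by apply: lboundedM; exact: continuous_lbounded.
- by move=> y /w0 ->; rewrite mul0r.
Qed.

Lemma cvg_convol w r (F : nat -> 'rV[R]_n -> R) f (M : R) :
  continuous w -> (forall y, r <= `|y| -> w y = 0) ->
  (forall k, continuous (F k)) -> continuous f ->
  (forall k x, `|F k x| <= M) -> (forall x, F k x @[k --> \oo] --> f x) ->
  \int[mu]_y (w y * F k y) @[k --> \oo] --> \int[mu]_y (w y * f y).
Proof.
move=> cw w0 cF cf FM Ff.
apply: (dominated_Rintegral_cvg (g := fun y => M * `|w y|)) => //.
- by move=> k; apply: measurable_funM; exact: continuous_measurable_rV.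
- by apply: measurable_funM; exact: continuous_measurable_rV.
- by apply: aeW => y _; apply: cvg_seqZ.
- apply: (lbounded_integrable (r := r)).
  + apply: measurable_funM => //; apply: measurableT_comp => //.
    exact: continuous_measurable_rV.
  + apply: lboundedM; first by move=> s; exists `|M|.
    by move=> s; have [K KP] := continuous_lbounded cw s; exists K => y /KP; rewrite normr_id.
  + by move=> y /w0 ->; rewrite normr0 mulr0.
- by apply: aeW => y k _; rewrite normrM mulrC ler_wpM2r.
Qed.

Lemma convol_continuous w eta r s : continuous w -> (forall y, r <= `|y| -> w y = 0) ->
  continuous eta -> (forall y, s <= `|y| -> eta y = 0) -> continuous (convol w eta).
Proof.
move=> cw w0 ce eta0 x; apply: continuous_at_seq => y yx.
have [M [M0 MP]] := continuous_support_bounded ce eta0.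
apply: (cvg_convol (r := r) (M := M)) => //.
- by move=> k; exact: continuous_shift.
- exact: continuous_shift.
- move=> z; apply: cvg_seq_comp; first exact: ce.
  by apply: cvgB => //; exact: cvg_cst.
Qed.

Lemma convol_derive w eta i r s x : continuous w -> (forall y, r <= `|y| -> w y = 0) ->
  smooth eta -> (forall y, s <= `|y| -> eta y = 0) ->
  is_derive x (e_ i) (convol w eta) (convol w (fun z => - 1 * partial i eta z) x).
Proof.
move=> cw w0 se eta0; apply: is_derive_seq => a a0 ac.
have ce := smooth_continuous se.
have cp : continuous (partial i eta) by exact/smooth_continuous/smooth_partial.
have [M [M0 MP]] := continuous_support_bounded cp (partial_outside i se eta0).
pose F k y := (eta (y - (x + a k *: e_ i)) - eta (y - x)) / a k.
have FE k y : exists xi : R, `|xi| <= `|a k| /\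
    F k y = - 1 * partial i eta ((y - x) + xi *: e_ i).
  have [xi [xia E]] := line_mean_value (fun z => smooth_derivable i z se) (y - x) (- a k).
  exists xi; rewrite normrN in xia; split => //.
  rewrite /F opprD addrA -scaleNr E mulrN mulNr mul1r mulNr -mulrA divff// mulr1.
  by [].
apply: (@eq_cvg_seq _ (fun k => \int[mu]_y (w y * F k y))).
  move=> k; have i1 := convol_integrable (x + a k *: e_ i) cw w0 ce.
  have i2 := convol_integrable x cw w0 ce.
  rewrite /convol -RintegralB// -RintegralZr//; last exact: (integrableB measurableT i1 i2).
  by congr (Rintegral _ _ _); apply/funext => y; rewrite /F; ring.
apply: (cvg_convol (r := r) (M := M)) => //.
- move=> k y; have c1 := @continuous_shift eta (x + a k *: e_ i) ce y.
  exact: cvgM (cvgB c1 (@continuous_shift eta x ce y)) (cvg_cst (a k)^-1).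
- by move=> y; exact: cvgM (cvg_cst (- 1 : R)) (@continuous_shift (partial i eta) x cp y).
- by move=> k y; have [xi [_ ->]] := FE k y; rewrite mulN1r normrN.
- move=> y; have /choice[xi xiP] k := FE k y.
  have xi0 : xi k @[k --> \oo] --> (0 : R).
    apply/cvgrPdist_le => e e0; move/cvgrPdist_le : ac => /(_ e e0).
    by apply: filterS => k; rewrite !sub0r !normrN; apply: le_trans; have [] := xiP k.
  have := cvg_seqZ (m := - 1) (cvg_seq_comp (cp _) (@seq_add_cvg _ _ (y - x) (e_ i) _ xi0)).
  by apply: eq_cvg_seq => k; have [_ ->] := xiP k.
Qed.

Lemma convol_smooth w eta r s : continuous w -> (forall y, r <= `|y| -> w y = 0) ->
  smooth eta -> (forall y, s <= `|y| -> eta y = 0) -> smooth (convol w eta).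
Proof.
move=> cw w0 se eta0; apply: (smooth_coind (P := fun phi => exists eta' s',
    [/\ smooth eta', (forall y, s' <= `|y| -> eta' y = 0) & phi = convol w eta'])); last first.
  by exists eta, s.
move=> _ [eta' [s' [se' eta'0 ->]]]; split.
  by apply: convol_continuous w0 _ eta'0 => //; exact: smooth_continuous.
move=> i; exists (convol w (fun z => - 1 * partial i eta' z)).
  exists (fun z => - 1 * partial i eta' z), (s' + 1); split => //.
  - by apply: smoothZ; exact: smooth_partial.
  - by move=> y /(partial_outside i se' eta'0) ->; rewrite mulr0.
by move=> x; exact: convol_derive w0 se' eta'0.
Qed.

Lemma convol_support w eta r s : (forall y, r <= `|y| -> w y = 0) ->
  (forall y, s <= `|y| -> eta y = 0) -> forall x, r + s <= `|x| -> convol w eta x = 0.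
Proof.
move=> w0 eta0 x rsx; rewrite /convol (_ : (fun y => _) = fun=> 0).
  by rewrite Rintegral_cst// mul0r.
apply/funext => y; have [ry|yr] := leP r `|y|; first by rewrite w0 ?mul0r.
rewrite eta0 ?mulr0// distrC.
have := lerB_dist x y; apply: le_trans; lra.
Qed.

(** The derivative first falls on [eta], with a sign; integration by parts, for which [w] need only
    have one-sided derivatives, moves it to [w] and removes the sign. *)
Lemma convol_partial w w' eta i r s x : rdiff (e_ i) w w' ->
  (forall y, r <= `|y| -> w y = 0) ->
  smooth eta -> (forall y, s <= `|y| -> eta y = 0) ->
  partial i (convol w eta) x = \int[mu]_y (w' y * eta (y - x)).
Proof.
move=> rw w0 se eta0; have [cw _ _] := rw.
have [_ E] := convol_derive i x cw w0 se eta0; rewrite /partial E.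
have re : rdiff (1 *: e_ i) eta (fun x => 1 * partial i eta x).
  apply: C1_rdiff; first by move=> y; exact: smooth_derivable.
    exact: smooth_continuous.
  exact/smooth_continuous/smooth_partial.
rewrite scale1r in re.
have H := rdiff_by_parts (r := r) (rdiff_translation (- x) re) rw w0.
transitivity (\int[mu]_y (eta (y - x) * w' y)); last first.
  by apply: eq_Rintegral => y _; rewrite mulrC.
rewrite H /convol; transitivity (\int[mu]_y (- 1 * (1 * partial i eta (y - x) * w y))).
  by apply: eq_Rintegral => y _; ring.
rewrite RintegralZl ?mulN1r//.
have := convol_integrable x cw w0 (smooth_continuous (smooth_partial i se)).
by congr (mu.-integrable _ (EFin \o _)); apply/funext => y; ring.
Qed.

Lemma lbounded_cst (c : R) : lbounded (fun=> c : R) (n := n).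
Proof. by move=> r; exists `|c|. Qed.

Lemma Rintegral_shift f x : measurable_fun setT f ->
  \int[mu]_y f (y - x) = \int[mu]_y f y.
Proof. by move=> mf; exact: (Rintegral_translation (- x) mf). Qed.

Lemma mollify_integrable g eta s x : measurable_fun setT g -> lbounded g ->
  smooth eta -> (forall y, s <= `|y| -> eta y = 0) ->
  mu.-integrable setT (EFin \o (fun y : 'rV[R]_n => g y * eta (y - x))).
Proof.
move=> mg bg se eta0; have cs := @continuous_shift eta x (smooth_continuous se).
apply: (lbounded_integrable (r := `|x| + s)).
- by apply: measurable_funM => //; exact: continuous_measurable_rV.
- by apply: lboundedM => //; exact: continuous_lbounded.
- move=> y sy; rewrite eta0 ?mulr0//.
  by have := lerB_dist y x; apply: le_trans; lra.
Qed.

Lemma mollify_bound g eta s x (M : R) : measurable_fun setT g ->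
  (forall y, `|g y| <= M) ->
  smooth eta -> (forall y, 0 <= eta y) -> (forall y, s <= `|y| -> eta y = 0) ->
  \int[mu]_y eta y = 1 ->
  `|\int[mu]_y (g y * eta (y - x))| <= M.
Proof.
move=> mg gM se eta_ge0 eta0 eta1.
have bg : lbounded g by move=> r; exists M.
have iM := mollify_integrable x (measurable_cst M) (lbounded_cst M) se eta0.
have ig := mollify_integrable x mg bg se eta0.
have me : measurable_fun setT eta by apply: continuous_measurable_rV; exact: smooth_continuous.
rewrite (le_trans (le_normr_Rintegral _ ig))//.
have -> : M = \int[mu]_y (M * eta (y - x)).
  rewrite RintegralZl//; first by rewrite Rintegral_shift// eta1 mulr1.
  have := mollify_integrable x (measurable_cst (1 : R)) (lbounded_cst 1) se eta0.
  by congr (mu.-integrable _ (EFin \o _)); apply/funext => y; rewrite mul1r.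
apply: le_Rintegral => //; first exact: integrable_norm.
by move=> y _; rewrite normrM (ger0_norm (eta_ge0 _)) ler_wpM2r.
Qed.

Lemma mollify_close g eta s x (e : R) : measurable_fun setT g -> lbounded g ->
  smooth eta -> (forall y, 0 <= eta y) -> (forall y, s <= `|y| -> eta y = 0) ->
  \int[mu]_y eta y = 1 ->
  (forall y, `|x - y| < s -> `|g x - g y| <= e) ->
  `|g x - \int[mu]_y (g y * eta (y - x))| <= e.
Proof.
move=> mg bg se eta_ge0 eta0 eta1 gs.
have ig := mollify_integrable x mg bg se eta0.
have ic c := mollify_integrable x (measurable_cst c) (lbounded_cst c) se eta0.
have me : measurable_fun setT eta by apply: continuous_measurable_rV; exact: smooth_continuous.
have Ec c : \int[mu]_y (c * eta (y - x)) = c.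
  rewrite RintegralZl//; first by rewrite Rintegral_shift// eta1 mulr1.
  by have := ic 1; congr (mu.-integrable _ (EFin \o _)); apply/funext => y; rewrite mul1r.
rewrite -{1}(Ec (g x)) -RintegralB//; last exact: ic.
have ib := integrableB measurableT (ic (g x)) ig.
rewrite (le_trans (le_normr_Rintegral _ ib))// -[leRHS]Ec.
apply: le_Rintegral => //; first exact: integrable_norm.
  exact: ic.
move=> y _; rewrite -mulrBl normrM (ger0_norm (eta_ge0 _)).
have [sy|ys] := leP s `|y - x|; first by rewrite eta0// !mulr0.
by rewrite ler_wpM2r// gs// distrC.
Qed.

End mollification.

(** * Monotonicity gap of the flux *)

Section power_gap.
Context (R : realType).
Implicit Types (r s : R).

Lemma ln_le_sub1 (x : R) : 0 < x -> ln x <= x - 1.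
Proof. by move=> x0; rewrite lerBrDl -{2}(lnK x0) expR_ge1Dx. Qed.

(** The minimum with 1 is there for [sigma < 1], where the power grows more slowly than [r]. Both
    sides of [alpha] follow from [ln x <= x - 1], applied to [alpha / r] above [alpha] and to
    [r / alpha] below. *)
Lemma powR_gap (alpha sigma : R) : 0 < alpha -> 0 < sigma -> exists2 c : R, 0 < c &
  forall r, 0 <= r -> c * Num.min 1 `|r - alpha| <= `|r `^ sigma - alpha `^ sigma|.
Proof.
move=> a0 s0; pose A := alpha `^ sigma.
have A0 : 0 < A by rewrite powR_gt0.
(* Above [alpha] the difference is at least [A sigma (1 - alpha / r)]. Below, with
   [s = sigma (1 - r / alpha)], it is at least [A s / (1 + s)], and [s <= sigma]. These bounds give
   [c1] and [c2]. *)
pose c1 := A * sigma / (alpha + 1); pose c2 := A * sigma / (alpha * (1 + sigma)).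
have c10 : 0 < c1 by rewrite divr_gt0 ?mulr_gt0//; lra.
have c20 : 0 < c2 by rewrite divr_gt0 ?mulr_gt0//; lra.
exists (Num.min c1 c2); first by rewrite lt_min c10.
have mc1 : Num.min c1 c2 <= c1 by rewrite ge_min lexx.
have mc2 : Num.min c1 c2 <= c2 by rewrite ge_min lexx orbT.
have mc0 : 0 <= Num.min c1 c2 by rewrite le_min !ltW.
move=> r r0; have [ar|ra] := leP alpha r.
  have rgt0 : 0 < r by exact: lt_le_trans ar.
  rewrite ger0_norm ?subr_ge0// ger0_norm; last first.
    by rewrite subr_ge0 ge0_ler_powR// ?nnegrE ltW.
  rewrite (le_trans (ler_wpM2r _ mc1))//; first by rewrite le_min ler01 subr_ge0.
  have E : r `^ sigma = A * (r / alpha) `^ sigma.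
    by rewrite -powRM ?divr_ge0 ?(ltW a0)// mulrCA divff ?mulr1// gt_eqF.
  have x0 : 0 < r / alpha by rewrite divr_gt0.
  have L : 1 + sigma * (1 - alpha / r) <= (r / alpha) `^ sigma.
    rewrite /powR gt_eqF//; apply: (le_trans _ (expR_ge1Dx _)); rewrite lerD2l ler_pM2l//.
    have := @ln_le_sub1 (alpha / r) (divr_gt0 a0 rgt0).
    by rewrite -[in ln _]invf_div lnV ?posrE//; lra.
  have -> : r `^ sigma - alpha `^ sigma = A * ((r / alpha) `^ sigma - 1) by rewrite E -/A; ring.
  rewrite (@le_trans _ _ (A * (sigma * (1 - alpha / r))))//; last first.
    by rewrite ler_pM2l//; lra.
  rewrite /c1 -!mulrA ler_pM2l// ler_pM2l//.
  have [d1|d1] := leP 1 (r - alpha).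
    rewrite mulr1 lerBrDl -lerBrDr; have -> : 1 - (alpha + 1)^-1 = alpha / (alpha + 1) by field; lra.
    by rewrite ler_pM2l// lef_pV2 ?posrE; lra.
  have -> : 1 - alpha / r = r^-1 * (r - alpha) by field; rewrite gt_eqF.
  by rewrite ler_wpM2r ?subr_ge0// lef_pV2 ?posrE; lra.
rewrite ltr0_norm ?subr_lt0// opprB ler0_norm; last first.
  by rewrite subr_le0 ge0_ler_powR// ?nnegrE ltW.
rewrite opprB (le_trans (ler_wpM2r _ mc2))//; first by rewrite le_min ler01 subr_ge0 ltW.
rewrite (@le_trans _ _ (c2 * (alpha - r)))//.
  by rewrite ler_pM2l// ge_min lexx orbT.
have [->|rn0] := eqVneq r 0.
  rewrite powR0 ?gt_eqF// !subr0 -/A /c2.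
  have -> : A * sigma / (alpha * (1 + sigma)) * alpha = A * (sigma / (1 + sigma)).
    by field; rewrite gt_eqF//=; lra.
  by rewrite ler_piMr ?(ltW A0)// ler_pdivrMr; lra.
have rgt0 : 0 < r by rewrite lt_neqAle eq_sym rn0.
have E : r `^ sigma = A * (r / alpha) `^ sigma.
  by rewrite -powRM ?divr_ge0 ?(ltW a0)// mulrCA divff ?mulr1// gt_eqF.
have x0 : 0 < r / alpha by rewrite divr_gt0.
set s := sigma * (1 - r / alpha).
have sge0 : 0 <= s by rewrite mulr_ge0 ?(ltW s0)// subr_ge0 ler_pdivrMr// mul1r ltW.
have sle : s <= sigma.
  by rewrite ler_piMr ?(ltW s0)// gerBl divr_ge0// ltW.
have L : (r / alpha) `^ sigma <= (1 + s)^-1.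
  have := @ln_le_sub1 (r / alpha) x0 => lx.
  rewrite /powR gt_eqF//; apply: (@le_trans _ _ (expR (- s))).
    by rewrite ler_expR /s -mulrN ler_pM2l//; lra.
  by rewrite expRN lef_pV2 ?posrE ?expR_gt0 ?expR_ge1Dx//; lra.
have -> : alpha `^ sigma - r `^ sigma = A * (1 - (r / alpha) `^ sigma) by rewrite E -/A; ring.
apply: (@le_trans _ _ (A * (s / (1 + sigma)))).
  rewrite /c2 /s le_eqVlt; apply/orP; left; apply/eqP; field.
  by rewrite gt_eqF//=; lra.
rewrite ler_pM2l// (@le_trans _ _ (1 - (1 + s)^-1))//; last by lra.
have -> : 1 - (1 + s)^-1 = s / (1 + s) by field; lra.
by rewrite ler_wpM2l// lef_pV2 ?posrE; lra.
Qed.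

(* With k the product below, both factors are bounded by C (k + sqrt k). *)
Lemma powR_gap_bounds (alpha sigma : R) : 0 < alpha -> 0 < sigma ->
  exists2 C : R, 0 < C & forall r, 0 <= r ->
    let k := (r `^ sigma - alpha `^ sigma) * (r - alpha) in
    [/\ 0 <= k, `|r - alpha| <= C * (k + Num.sqrt k) &
      `|r `^ sigma - alpha `^ sigma| <= C * (k + Num.sqrt k)].
Proof.
move=> a0 s0; have [c c0 cP] := powR_gap a0 s0.
have A0 : 0 < alpha `^ sigma by rewrite powR_gt0.
have s'0 : 0 < sigma^-1 by rewrite invr_gt0.
(* The inverse power at [alpha^sigma] exchanges the two factors and gives the bound on the second
   one. *)
have [c' c'0 c'P] := powR_gap A0 s'0.
(* If [x >= 1] then [d <= y], so [x] is at most [d^-1 x y]; if [x < 1] then [d x <= y], so [x^2]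
   is. *)
have aux (d x y : R) : 0 < d -> 0 <= x -> 0 <= y -> d * Num.min 1 x <= y ->
    x <= (d^-1 + Num.sqrt d^-1) * (x * y + Num.sqrt (x * y)).
  move=> d0 x0 y0; have k0 : 0 <= x * y by rewrite mulr_ge0.
  have i0 : 0 < d^-1 by rewrite invr_gt0.
  have [x1|x1] := leP 1 x.
    rewrite mulr1 => dy; apply: (@le_trans _ _ (d^-1 * (x * y))).
      by rewrite mulrCA ler_peMr// ler_pdivlMl// mulr1.
    by rewrite ler_pM ?(ltW i0)// ?lerDl ?sqrtr_ge0.
  move=> dy; have -> : x = Num.sqrt (x ^+ 2) by rewrite sqrtr_sqr ger0_norm.
  apply: (@le_trans _ _ (Num.sqrt d^-1 * Num.sqrt (x * y))).
    rewrite -sqrtrM ?(ltW i0)// ler_sqrt ?mulr_ge0 ?(ltW i0)//.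
    by rewrite expr2 mulrCA ler_wpM2l// ler_pdivlMl.
  rewrite sqrtr_sqr ger0_norm// ler_pM ?sqrtr_ge0//.
    by rewrite lerDr ltW.
  by rewrite lerDr.
pose K1 := c^-1 + Num.sqrt c^-1; pose K2 := c'^-1 + Num.sqrt c'^-1.
have K10 : 0 < K1 by rewrite ltr_wpDr ?sqrtr_ge0// invr_gt0.
have K20 : 0 < K2 by rewrite ltr_wpDr ?sqrtr_ge0// invr_gt0.
exists (K1 + K2); first by rewrite addr_gt0.
move=> r r0; set k := _ * _.
have kE : k = `|r - alpha| * `|r `^ sigma - alpha `^ sigma|.
  rewrite /k mulrC; have [ar|ra] := leP alpha r.
    rewrite !ger0_norm ?subr_ge0// ge0_ler_powR ?nnegrE//; lra.
  rewrite !ler0_norm ?subr_le0 ?mulrNN//; last exact: ltW.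
  by rewrite ge0_ler_powR ?nnegrE//; lra.
have k0 : 0 <= k by rewrite kE mulr_ge0.
have kk0 : 0 <= k + Num.sqrt k by rewrite addr_ge0 ?sqrtr_ge0.
split => //=.
- apply: (@le_trans _ _ (K1 * (k + Num.sqrt k))); last by rewrite ler_wpM2r// lerDl ltW.
  by rewrite kE; apply: aux => //; exact: cP.
- apply: (@le_trans _ _ (K2 * (k + Num.sqrt k))); last by rewrite ler_wpM2r// lerDr ltW.
  rewrite kE [`|r - alpha| * _]mulrC; apply: aux => //.
  have := c'P (r `^ sigma) (powR_ge0 _ _).
  by rewrite -!powRrM divff ?gt_eqF// !powRr1// ltW.
Qed.

End power_gap.

Section flux_gap.
Context (R : realType) (n : nat).
Implicit Types (z a zeta : 'rV[R]_n).

Lemma enormZ (c : R) z : enorm (c *: z) = `|c| * enorm z.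
Proof. by rewrite /enorm dotZl dotZr mulrA -expr2 sqrtrM ?sqr_ge0// sqrtr_sqr. Qed.

Lemma enormN z : enorm (- z) = enorm z.
Proof. by rewrite -scaleN1r enormZ normrN1 mul1r. Qed.

(* The flux of E(z) = b|z| + |z|^p/p at z, zeta being a subgradient of the norm
   at z; the scalar is b + |z|^(p-1) with sigma = p - 1. *)
Definition flux (b sigma : R) z zeta : 'rV[R]_n := (b + enorm z `^ sigma) *: zeta.

(** The gap splits into three nonnegative terms: one for the moduli, handled by [powR_gap_bounds],
    and the two Cauchy-Schwarz defects [s1], for the direction of [zeta], and [s2], for that of [z].
    Their coefficients are at least [b > 0], so each term is controlled by [g]. *)
Lemma flux_gap (b sigma : R) a : 0 < b -> 0 < sigma -> a != 0 ->
  exists2 C : R, 0 < C & forall z zeta, enorm zeta <= 1 -> dot zeta z = enorm z ->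
    let g := dot (flux b sigma z zeta - flux b sigma a ((enorm a)^-1 *: a)) (z - a) in
    [/\ 0 <= g, enorm (z - a) <= C * (g + Num.sqrt g) &
      enorm (flux b sigma z zeta - flux b sigma a ((enorm a)^-1 *: a)) <= C * (g + Num.sqrt g)].
Proof.
move=> b0 s0 an0; set alpha := enorm a.
have al0 : 0 < alpha by rewrite lt_neqAle eq_sym enorm_eq0 an0 enorm_ge0.
have [ah ahE] : exists v, v = alpha^-1 *: a by exists (alpha^-1 *: a).
rewrite -ahE; have ahn : enorm ah = 1 by rewrite ahE enormZ ger0_norm ?invr_ge0 ?(ltW al0)// mulVf// gt_eqF.
have [C0 C00 C0P] := powR_gap_bounds al0 s0.
pose A := alpha `^ sigma; have A0 : 0 < A by rewrite powR_gt0.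
pose C1 := Num.sqrt (2 * alpha / b); pose C2 := (b + A) * Num.sqrt (2 / (alpha * b)).
have C10 : 0 <= C1 by exact: sqrtr_ge0.
have C20 : 0 <= C2 by rewrite mulr_ge0 ?sqrtr_ge0//; lra.
exists (C0 + C1 + C2); first by lra.
move=> z zeta zn zz; set g := dot _ _; rewrite /=.
set r := enorm z; have r0 : 0 <= r by exact: enorm_ge0.
pose S := r `^ sigma; have S0 : 0 <= S by exact: powR_ge0.
pose k := (S - A) * (r - alpha).
pose s1 := alpha - dot zeta a; pose s2 := r - dot ah z.
have s10 : 0 <= s1.
  by rewrite subr_ge0 (le_trans (dot_le_enorm _ _))// ler_piMl// enorm_ge0.
have s20 : 0 <= s2.
  by rewrite subr_ge0 (le_trans (dot_le_enorm _ _))// ahn mul1r.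
have aha : dot ah a = alpha.
  by rewrite ahE dotZl -enorm_sqr -/alpha; field; rewrite gt_eqF.
have gE : g = k + (b + S) * s1 + (b + A) * s2.
  rewrite /g /flux -/r -/alpha -/S -/A.
  rewrite !(dotDl, dotDr, dotNl, dotNr, dotZl) zz aha -/r /k /s1 /s2; ring.
have [k0 kr kS] := C0P r r0; rewrite -/S -/A -/k in k0 kr kS.
have bs1 : b * s1 <= g.
  rewrite gE; have := mulr_ge0 S0 s10; have := mulr_ge0 (ltW A0) s20.
  by have := mulr_ge0 (ltW b0) s20; nra.
have bs2 : b * s2 <= g.
  rewrite gE; have := mulr_ge0 S0 s10; have := mulr_ge0 (ltW A0) s20.
  by have := mulr_ge0 (ltW b0) s10; nra.
have kg : k <= g.
  rewrite gE; have := mulr_ge0 S0 s10; have := mulr_ge0 (ltW A0) s20.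
  by have := mulr_ge0 (ltW b0) s10; have := mulr_ge0 (ltW b0) s20; nra.
have g0 : 0 <= g by exact: le_trans kg.
have sg0 : 0 <= Num.sqrt g by exact: sqrtr_ge0.
have kkg : C0 * (k + Num.sqrt k) <= C0 * (g + Num.sqrt g).
  by rewrite ler_pM2l// lerD// ler_sqrt.
split => //.
(* Law of cosines: the error is that of the moduli plus a multiple of the defect [s2]. *)
- have N2 : enorm (z - a) ^+ 2 = (r - alpha) ^+ 2 + 2 * alpha * s2.
    rewrite enorm_sqr !(dotDl, dotDr, dotNl, dotNr) (dotC a z) -!enorm_sqr -/r -/alpha /s2.
    by rewrite ahE dotZl (dotC a z); field; rewrite gt_eqF.
  have : enorm (z - a) <= `|r - alpha| + C1 * Num.sqrt g.
    rewrite -(@ler_pXn2r _ 2)// ?nnegrE ?enorm_ge0 ?addr_ge0 ?mulr_ge0//.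
    rewrite N2 [leRHS]sqrrD real_normK ?num_real// exprMn !sqr_sqrtr//; last first.
      by rewrite divr_ge0 ?mulr_ge0// ltW.
    have : 2 * alpha * s2 <= 2 * alpha / b * g.
      by rewrite -!mulrA ler_pM2l// ler_pM2l// ler_pdivlMl.
    have : 0 <= `|r - alpha| * (C1 * Num.sqrt g) by rewrite !mulr_ge0.
    by lra.
  move/le_trans; apply; apply: (@le_trans _ _ (C0 * (g + Num.sqrt g) + C1 * Num.sqrt g)).
    by rewrite lerD2r (le_trans kr).
  have := mulr_ge0 C10 g0; have := mulr_ge0 C20 g0; have := mulr_ge0 C20 sg0; nra.
- rewrite /flux -/r -/alpha -/S -/A.
  (* A change of modulus along [zeta] plus a change of direction; the latter is of order [sqrt s1],
     because [zeta] has norm at most 1. *)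
  have -> : (b + S) *: zeta - (b + A) *: ah = (S - A) *: zeta + (b + A) *: (zeta - ah).
    by apply/rowP => i; rewrite !mxE; ring.
  have Z2 : enorm (zeta - ah) <= Num.sqrt (2 / (alpha * b)) * Num.sqrt g.
    rewrite -sqrtrM ?divr_ge0 ?mulr_ge0 ?(ltW al0) ?(ltW b0)//.
    rewrite /enorm ler_sqrt; last by rewrite mulr_ge0// divr_ge0// mulr_ge0// ltW.
    rewrite !(dotDl, dotDr, dotNl, dotNr) (dotC ah zeta) -!enorm_sqr ahn expr1n.
    have z1 : enorm zeta ^+ 2 <= 1 by rewrite expr_le1// enorm_ge0.
    have zE : dot zeta ah = 1 - s1 / alpha.
      by rewrite ahE dotZr /s1; field; rewrite gt_eqF.
    have : 2 * (s1 / alpha) <= 2 / (alpha * b) * g.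
      have -> : 2 / (alpha * b) * g = 2 * ((g / b) / alpha) by field; rewrite !gt_eqF.
      by rewrite ler_pM2l// ler_wpM2r ?invr_ge0 ?(ltW al0)// ler_pdivlMr// mulrC.
    lra.
  rewrite (le_trans (enormD _ _))// !enormZ (ger0_norm (ltW (addr_gt0 b0 A0))).
  apply: (@le_trans _ _ (C0 * (g + Num.sqrt g) + C2 * Num.sqrt g)).
    rewrite lerD//.
      by rewrite (le_trans _ kkg)// (le_trans _ kS)// ler_piMr.
    by rewrite /C2 -mulrA ler_pM2l// addr_gt0.
  have := mulr_ge0 C10 g0; have := mulr_ge0 C10 sg0; have := mulr_ge0 C20 g0; nra.
Qed.

End flux_gap.

(** * Euclidean balls are Lipschitz domains *)

Section euclidean_ball.
Context (R : realType) (n : nat).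
Implicit Types (x y z : 'rV[R]_n) (r rho : R).

Lemma ler_norm_enorm z : `|z| <= enorm z.
Proof.
apply/rV_norm_leP => [|i]; first exact: enorm_ge0.
rewrite -(@ler_pXn2r _ 2)// ?nnegrE ?enorm_ge0// enorm_sqr real_normK ?num_real//.
by rewrite /dot (bigD1 i)//= -expr2 lerDl sumr_ge0// => j _; rewrite -expr2 sqr_ge0.
Qed.

Lemma enorm_le_norm z : enorm z <= n%:R * `|z|.
Proof.
rewrite -(@ler_pXn2r _ 2)// ?nnegrE ?enorm_ge0 ?mulr_ge0// enorm_sqr.
apply: (@le_trans _ _ (\sum_(i < n) `|z| ^+ 2)).
  apply: ler_sum => i _; rewrite -expr2 -[leLHS]real_normK ?num_real//.
  by rewrite ler_pXn2r ?nnegrE// ler_coord_norm.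
rewrite sumr_const card_ord -[_ *+ n]mulr_natl [leRHS]exprMn ler_wpM2r ?sqr_ge0//.
by rewrite -natrX ler_nat expnS expn1; case: (n) => // k; rewrite leq_pmulr.
Qed.

Lemma enorm_distl x y : `|enorm x - enorm y| <= enorm (x - y).
Proof.
rewrite ler_norml; apply/andP; split.
  by rewrite lerNl opprB lerBlDr -[enorm (x - y)]enormN opprB -{1}(subrK x y) enormD.
by rewrite lerBlDr -{1}(subrK y x) enormD.
Qed.

Lemma continuous_enorm : continuous (@enorm R n).
Proof.
move=> x; have := @sqrt_continuous R (dot x x).
by move=> H; exact: (@continuous_cvg _ _ _ (nbhs x) (nbhs_filter x) _ _ _ H (@continuous_dot_sqr R n x)).
Qed.

Definition eball rho : set 'rV[R]_n := [set x | enorm x < rho].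

Lemma open_eball rho : open (eball rho).
Proof.
apply: (@open_comp _ _ (@enorm R n) [set y | y < rho]); last exact: open_lt.
by move=> x _; exact: continuous_enorm.
Qed.

Lemma eball_sub_cube rho : eball rho `<=` cube rho.
Proof. by move=> x; exact: le_lt_trans (ler_norm_enorm x). Qed.

Lemma measurable_eball rho : measurable (eball rho).
Proof. by apply: open_measurable_rV; exact: open_eball. Qed.

Lemma eball_fin rho : (lebesgue_rV R n (eball rho) < +oo)%E.
Proof.
apply: le_lt_trans (cube_fin n rho); apply: le_measure.
- by rewrite inE; exact: measurable_eball.
- by rewrite inE; exact: measurable_cube.
- exact: eball_sub_cube.
Qed.

Lemma connected_eball rho : 0 < rho -> connected (eball rho).
Proof.
move=> r0; pose seg x := (fun t : R => t *: x) @` `[0, 1]%classic.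
have -> : eball rho = \bigcup_(x in eball rho) seg x.
  apply/seteqP; split => [x xr|y [x xr [t /= + <-]]].
    by exists x => //; exists 1; rewrite ?scale1r//= in_itv/= ler01 lexx.
  rewrite in_itv/= => /andP[t0 t1]; rewrite /eball/= enormZ ger0_norm//.
  by apply: le_lt_trans xr; rewrite ler_piMl// enorm_ge0.
apply: bigcup_connected.
  by exists 0 => x _; exists 0; rewrite ?scale0r//= in_itv/= lexx ler01.
move=> x _; apply: connected_continuous_connected; first exact: segment_connected.
by apply: continuous_subspaceT => t; exact: scalel_continuous.
Qed.

(* Lower half sphere, truncated to be Lipschitz on the whole space. *)
Definition cap rho y : R := - Num.sqrt (rho ^+ 2 - Num.min (enorm y) (rho / 2) ^+ 2).

(** The truncation keeps the radicands above [(rho/2)^2], so the difference of the roots,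
    [|m - m'| (m + m') / (sqrt A + sqrt B)], is at most [|m - m'|]. The constant [n] passes from the
    Euclidean norm to the sup norm. *)
Lemma lipschitz_cap rho : 0 < rho -> lipschitz (cap rho).
Proof.
move=> r0; apply: (@klipschitzW _ _ _ n%:R).
  exact: (@globally_properfilter _ _ (0, 0)).
move=> [x y] _ /=; apply: (@le_trans _ _ (enorm (x - y))); last exact: enorm_le_norm.
apply: le_trans (enorm_distl x y).
set m := Num.min (enorm x) (rho / 2); set m' := Num.min (enorm y) (rho / 2).
have mm : `|m - m'| <= `|enorm x - enorm y|.
  rewrite /m /m'; case: (leP (enorm x)) => hx; case: (leP (enorm y)) => hy //.
  - rewrite ler_norml; have := ler_norm (- (enorm x - enorm y)).
    by have := ler_norm (enorm x - enorm y); rewrite normrN; lra.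
  - rewrite ler_norml; have := ler_norm (- (enorm x - enorm y)).
    by have := ler_norm (enorm x - enorm y); rewrite normrN; lra.
  - by rewrite subrr normr0.
apply: le_trans mm.
have m0 : 0 <= m <= rho / 2 by rewrite le_min enorm_ge0/= ge_min lexx orbT andbT; lra.
have m'0 : 0 <= m' <= rho / 2 by rewrite le_min enorm_ge0/= ge_min lexx orbT andbT; lra.
rewrite /cap -/m -/m'; set A := rho ^+ 2 - m ^+ 2; set B := rho ^+ 2 - m' ^+ 2.
have A4 : (rho / 2) ^+ 2 <= A by rewrite /A; case/andP: m0 => *; nra.
have B4 : (rho / 2) ^+ 2 <= B by rewrite /B; case/andP: m'0 => *; nra.
have sA : rho / 2 <= Num.sqrt A.
  by rewrite -[rho / 2]ger0_norm ?divr_ge0 ?(ltW r0)// -sqrtr_sqr ler_sqrt// (le_trans _ A4)// sqr_ge0.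
have sB : rho / 2 <= Num.sqrt B.
  by rewrite -[rho / 2]ger0_norm ?divr_ge0 ?(ltW r0)// -sqrtr_sqr ler_sqrt// (le_trans _ B4)// sqr_ge0.
have sqA : Num.sqrt A ^+ 2 = A by rewrite sqr_sqrtr// (le_trans _ A4)// sqr_ge0.
have sqB : Num.sqrt B ^+ 2 = B by rewrite sqr_sqrtr// (le_trans _ B4)// sqr_ge0.
set a := Num.sqrt A in sA sqA *; set b := Num.sqrt B in sB sqB *.
have E : (a - b) * (a + b) = (m' - m) * (m' + m).
  by rewrite -!subr_sqr sqA sqB /A /B; ring.
have ab0 : rho <= a + b by lra.
have : `|a - b| * (a + b) <= `|m - m'| * (a + b).
  have -> : `|a - b| * (a + b) = `|(a - b) * (a + b)| by rewrite normrM (ger0_norm (_ : 0 <= a + b))//; lra.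
  rewrite E normrM [`|m' - m|]distrC ler_wpM2l// ger0_norm; last by case/andP: m0; case/andP: m'0; lra.
  by case/andP: m0; case/andP: m'0; lra.
rewrite ler_pM2r; last by lra.
by rewrite -opprD normrN.
Qed.

(** The equation is only given on bounded Lipschitz domains; balls are such domains and exhaust the
    space. *)
Lemma eball_lipschitz_domain rho : 0 < rho -> bounded_lipschitz_domain (eball rho).
Proof.
move=> r0; split.
- exact: open_eball.
- exact: connected_eball.
- by exists 0; rewrite /eball/= enorm0.
- exists rho; split; first exact: num_real.
  move=> s rs x /eball_sub_cube xr /=; exact: le_trans (ltW xr) (ltW rs).
- move=> x0 [cx Nx].
  have x0r : enorm x0 = rho.
    apply/eqP; rewrite eq_le; apply/andP; split; last by rewrite leNgt; apply/negP.
    have cB : closed [set x : 'rV[R]_n | enorm x <= rho].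
      apply: (@closed_comp _ _ (@enorm R n) [set y | y <= rho]); last exact: closed_le.
      by move=> x _; exact: continuous_enorm.
    have : closure (eball rho) `<=` [set x | enorm x <= rho].
      rewrite [X in _ `<=` X](closure_id _).1//; apply: closure_subset => x.
      exact: ltW.
    exact.
  (* The inward normal: near [x0] the ball lies above its lower half sphere in the direction [e]. *)
  pose e := - rho^-1 *: x0.
  have e1 : enorm e = 1.
    by rewrite enormZ normrN ger0_norm ?invr_ge0 ?(ltW r0)// x0r mulVf// gt_eqF.
  have ee : dot e e = 1 by rewrite -enorm_sqr e1 expr1n.
  have x0E : x0 = - rho *: e by rewrite scalerA mulrNN divff ?gt_eqF// scale1r.
  clearbody e.
  exists (rho / 2), e, (cap rho); split => //; [by lra|exact: lipschitz_cap|].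
  move=> x xx0; pose t := dot x e; pose y := x - t *: e.
  have tE : t = - rho + dot (x - x0) e.
    by rewrite /t -{1}(subrK x0 x) dotDl x0E dotZl ee; ring.
  have d1 : dot (x - x0) e <= enorm (x - x0) by have := dot_le_enorm (x - x0) e; rewrite e1 mulr1.
  have tneg : t < 0 by lra.
  have yE : dot y y = dot x x - t ^+ 2.
    rewrite /y !(dotDl, dotDr, dotNl, dotNr, dotZl, dotZr) ee (dotC e x) -/t; ring.
  (* Within [rho / 2] of [x0] the tangential part is at most [rho / 2], so the truncation in [cap]
     is inactive. *)
  have y2 : enorm y <= rho / 2.
    have yE' : dot y y = dot (x - x0) (x - x0) - (dot (x - x0) e) ^+ 2.
      have -> : y = (x - x0) - dot (x - x0) e *: e.
        rewrite /y tE {2}x0E; apply/rowP => i; rewrite !mxE; ring.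
      move: (x - x0) => z.
      rewrite !(dotDl, dotDr, dotNl, dotNr, dotZl, dotZr) ee (dotC e z); ring.
    rewrite -(@ler_pXn2r _ 2)// ?nnegrE ?enorm_ge0 ?divr_ge0 ?(ltW r0)// enorm_sqr yE'.
    have := sqr_ge0 (dot (x - x0) e).
    have : enorm (x - x0) ^+ 2 <= (rho / 2) ^+ 2.
      by rewrite ler_pXn2r ?nnegrE ?enorm_ge0 ?divr_ge0 ?(ltW r0)// ltW.
    rewrite enorm_sqr; lra.
  rewrite /eball/= /cap -/t -/y min_l//.
  set q := rho ^+ 2 - _.
  have q0 : 0 < q.
    have : enorm y ^+ 2 <= (rho / 2) ^+ 2.
      by rewrite ler_pXn2r ?nnegrE ?enorm_ge0 ?divr_ge0 ?(ltW r0).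
    rewrite /q; nra.
  have -> : (enorm x < rho) = (t ^+ 2 < q).
    rewrite -(@ltr_pXn2r _ 2)// ?nnegrE ?enorm_ge0 ?(ltW r0)// /q !enorm_sqr yE.
    by apply/idP/idP; lra.
  have -> : (t ^+ 2 < q) = (- Num.sqrt q < t).
    rewrite ltrNl -[t ^+ 2]sqrrN -{1}[q]sqr_sqrtr ?(ltW q0)//.
    by rewrite ltr_pXn2r ?nnegrE ?sqrtr_ge0//; lra.
  by [].
Qed.

End euclidean_ball.

(** * The weak equation for Lipschitz test functions *)

Section Lp_spaces.
Context (R : realType) (n : nat).
Local Notation mu := (lebesgue_rV R n).
Implicit Types (f g : 'rV[R]_n -> R) (G : 'rV[R]_n -> 'rV[R]_n) (D E : set 'rV[R]_n).

Lemma Lp_norm_powR (p : R) D f : 0 < p ->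
  (Lp_norm p%:E D f `^ p)%E = (\int[mu]_(x in D) (`|f x| `^ p)%:E)%E.
Proof.
move=> p0; rewrite [RHS]integral_mkcond /Lp_norm.
rewrite [LHS](@poweR_Lnorm _ _ _ mu (EFin \o (f \_ D)) p) ?gt_eqF//.
apply: eq_integral => x _; rewrite /= !patchE.
by case: ifPn => _; rewrite /= ?normr0 ?powR0 ?gt_eqF.
Qed.

Lemma bounded_Lp (p M : R) D f : 0 < p -> measurable D -> (mu D < +oo)%E ->
  measurable_fun D f -> (forall x, D x -> `|f x| <= M) -> Lp p%:E D f.
Proof.
move=> p0 mD Doo mf fM; split=> //.
apply: (@lty_poweRy _ _ p); rewrite ?gt_eqF// Lp_norm_powR//.
have M0 x : D x -> 0 <= M by move=> /fM; exact: le_trans.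
have : mu.-integrable D (EFin \o (fun x => `|f x| `^ p)).
  apply: (integrable_of_bounded (M := M `^ p)) => //.
    have mN : measurable_fun D (fun x => `|f x|) by exact: measurableT_comp.
    exact: (@measurableT_comp _ _ _ _ _ _ (fun x : R => x `^ p) _ _ _ mN).
  move=> x Dx; rewrite ger0_norm ?powR_ge0// ge0_ler_powR ?nnegrE ?(ltW p0)//.
    exact: M0 Dx.
  exact: fM.
by move=> /integrable_fin_num -/(_ mD) h; rewrite ltey_eq h.
Qed.

(** On a set of finite measure, [|G_i| <= 1 + |G|^p] suffices. *)
Lemma Lp_vec_integrable (p : R) E G i : 1 < p -> measurable E -> (mu E < +oo)%E ->
  Lp_vec p%:E E G -> mu.-integrable E (EFin \o (fun x => G x ord0 i)).
Proof.
move=> p1 mE Eoo [mG Goo].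
have p0 : 0 < p by lra.
have mGi : measurable_fun E (fun x => G x ord0 i).
  exact: (measurableT_comp (measurable_coord i) mG).
have mN : measurable_fun E (fun x => enorm (G x)).
  apply: (measurableT_comp _ mG); apply: continuous_measurable_rV.
  exact: continuous_enorm.
have iG : mu.-integrable E (EFin \o (fun x => enorm (G x) `^ p)).
  apply/integrableP; split.
    apply/measurable_EFinP.
    exact: (@measurableT_comp _ _ _ _ _ _ (fun x : R => x `^ p) _ _ _ mN).
  have := Lp_norm_powR E (enorm \o G) p0.
  have -> : (\int[mu]_(x in E) (`|(enorm \o G) x| `^ p)%:E =
             \int[mu]_(x in E) `|(EFin \o (fun x => (enorm (G x) `^ p)%R)) x|)%E.
    by apply: eq_integral => x _ /=; rewrite !ger0_norm ?powR_ge0 ?enorm_ge0.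
  by move=> <-; exact: poweR_lty.
have i1 : mu.-integrable E (EFin \o (fun=> 1 : R)).
  by apply: (integrable_of_bounded (M := 1)) => // x _; rewrite normr1.
apply: le_integrable (integrableD mE i1 iG) => //; first exact/measurable_EFinP.
move=> x Ex /=; rewrite lee_fin [leRHS]ger0_norm; last first.
  by rewrite addr_ge0// powR_ge0.
apply: (@le_trans _ _ (enorm (G x))).
  exact: le_trans (ler_coord_norm _ _) (ler_norm_enorm _).
have [h|h] := leP (enorm (G x)) 1; first by have := powR_ge0 (enorm (G x)) p; lra.
have : enorm (G x) `^ 1 <= enorm (G x) `^ p by rewrite ler_powR// ltW.
by rewrite powRr1 ?enorm_ge0//; lra.
Qed.

Lemma continuous_Lp (p r : R) D f : 0 < p -> measurable D -> D `<=` cube r ->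
  continuous f -> Lp p%:E D f.
Proof.
move=> p0 mD Dr cf; have [M [_ fM]] := continuous_bounded r cf.
apply: (bounded_Lp (M := M)) => //.
- apply: le_lt_trans (cube_fin n r); apply: le_measure; rewrite ?inE//.
  exact: measurable_cube.
- apply: (measurable_funS measurableT) => //; exact: continuous_measurable_rV.
- by move=> x /Dr xr; apply: fM; exact: ltW.
Qed.

End Lp_spaces.

Section weak_gradients.
Context (R : realType) (n : nat).
Local Notation mu := (lebesgue_rV R n).
Local Notation e_ := (@basis_rV R n).
Implicit Types (f g phi : 'rV[R]_n -> R) (G : 'rV[R]_n -> 'rV[R]_n) (D E : set 'rV[R]_n).

Lemma compact_closure_cube (r : R) : compact (closure (cube r : set 'rV[R]_n)).
Proof.
have cC : closed [set x : 'rV[R]_n | `|x| <= r].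
  apply: (@closed_comp _ _ (fun x : 'rV[R]_n => `|x|) [set y | y <= r]); last exact: closed_le.
  by move=> x _; exact: norm_continuous.
have sub : closure (cube r : set 'rV[R]_n) `<=` [set x | `|x| <= r].
  by rewrite [X in _ `<=` X](closure_id _).1//; apply: closure_subset => x /ltW.
apply: bounded_closed_compact; last exact: closed_closure.
exists r; split; first exact: num_real.
by move=> s rs x /sub xr /=; exact: le_trans xr (ltW rs).
Qed.

Lemma cube_weighted_integrable f phi (r s : R) : measurable_fun setT f ->
  mu.-integrable (cube s) (EFin \o f) -> continuous phi -> r <= s ->
  (forall x, r <= `|x| -> phi x = 0) -> mu.-integrable setT (EFin \o (fun x => f x * phi x)).
Proof.
move=> mf lf cp rs p0; have [M [M0 Mp]] := continuous_support_bounded cp p0.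
have fs : mu.-integrable setT (EFin \o (fun x => M * (f x * \1_(cube s) x))).
  apply: (@eq_integrable _ _ _ _ setT measurableT (fun x => (M%:E * (f x * \1_(cube s) x)%:E)%E)) => //.
  apply: integrableZl => //.
  rewrite (integrable_mkcond _ (measurable_cube s)) in lf.
  congr (mu.-integrable _ _): lf; apply/funext => x; rewrite patchE /= indicE.
  by case: ifP; rewrite ?mulr1 ?mulr0.
apply: le_integrable fs => //.
  by apply/measurable_EFinP; apply: measurable_funM => //; exact: continuous_measurable_rV.
move=> x _ /=; rewrite lee_fin mulrC [leRHS]normrM normrM.
have [xr|xr] := leP r `|x|; first by rewrite p0// normr0 mul0r mulr_ge0.
rewrite indicE mem_set /=; last exact: lt_le_trans rs.
by rewrite mulr1 ler_wpM2r// (le_trans (Mp x))// ler_norm.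
Qed.

(** By [rdiff_by_parts] the one-sided derivative [u'] is also a weak derivative along [c e_i], and
    the fundamental lemma identifies the two. *)
Lemma weak_gradient_rdiff u (u' : 'rV[R]_n -> R) G i (c : R) :
  rdiff (c *: e_ i) u u' -> measurable_fun setT (fun x => G x ord0 i) ->
  (forall r, mu.-integrable (cube r) (EFin \o (fun x => G x ord0 i))) ->
  (forall r, weak_gradient (cube r) u G) ->
  {ae mu, forall x, c * G x ord0 i - u' x = 0}.
Proof.
move=> du mG lG wG.
have mu' := rdiff_measurable du; have lu' := rdiff_lbounded du.
have iu' r : mu.-integrable (cube r) (EFin \o u').
  by have [M uM] := lu' r; apply: (cube_integrable (M := M)) => // x /ltW/uM.
have mf : measurable_fun setT (fun x => c * G x ord0 i - u' x).
  by apply: measurable_funB => //; exact: measurable_funM.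
apply: smooth_null => // [r|phi r sp p0].
  apply: (@eq_integrable _ _ _ _ _ (measurable_cube r)
    (fun x => (c%:E * (G x ord0 i)%:E) - (u' x)%:E)%E) => //.
  apply: (integrableB (measurable_cube r) _ (iu' r)).
  by apply: (integrableZl (measurable_cube r)); exact: lG.
have cp := smooth_continuous sp.
have tp : test_function (cube (r + 1)) phi.
  by apply: (smooth_test_function (r := r)) => // x xr; rewrite /cube/=; lra.
have := wG (r + 1) phi tp i.
rewrite -Rintegral_setTE; last first.
  by move=> x; rewrite /cube/= => /negP; rewrite -leNgt => xr; rewrite (partial_outside i sp p0)// mulr0.
rewrite -[in X in _ = X -> _]Rintegral_setTE; last first.
  by move=> x; rewrite /cube/= => /negP; rewrite -leNgt => xr; rewrite p0 ?mulr0//; lra.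
move=> wE.
have dphi : rdiff (c *: e_ i) phi (fun x => c * partial i phi x).
  by apply: C1_rdiff => // [x|]; [exact: smooth_derivable|exact/smooth_continuous/smooth_partial].
have := rdiff_by_parts du dphi p0.
have i1 : mu.-integrable setT (EFin \o (fun x => u x * partial i phi x)).
  have [cu _ _] := du.
  apply: (lbounded_integrable (r := r + 1)).
  - by apply: measurable_funM; apply: continuous_measurable_rV => //; exact/smooth_continuous/smooth_partial.
  - by apply: lboundedM; apply: continuous_lbounded => //; exact/smooth_continuous/smooth_partial.
  - by move=> x xr; rewrite (partial_outside i sp p0)// mulr0.
have i2 : mu.-integrable setT (EFin \o (fun x => G x ord0 i * phi x)).
  exact: (cube_weighted_integrable mG (lG r)).
have i3 : mu.-integrable setT (EFin \o (fun x => u' x * phi x)).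
  exact: (cube_weighted_integrable mu' (iu' r)).
under eq_Rintegral do rewrite mulrCA.
rewrite RintegralZl// wE => dE.
under eq_Rintegral do rewrite mulrBl -mulrA.
rewrite RintegralB//; last first.
  apply: (@eq_integrable _ _ _ _ _ measurableT
    (fun x => (c%:E * (G x ord0 i * phi x)%:E))%E) => //.
  exact: integrableZl.
by rewrite RintegralZl//; lra.
Qed.

Lemma sobolev_loc_integrable (p : R) u G i : 1 < p -> sobolev_loc p%:E setT u G ->
  measurable_fun setT (fun x => G x ord0 i) /\
  forall r, mu.-integrable (cube r) (EFin \o (fun x => G x ord0 i)).
Proof.
move=> p1 uG.
have lG r : mu.-integrable (cube r) (EFin \o (fun x => G x ord0 i)).
  have [_ LG _] := uG (cube r) (@open_cube _ _ r) (@compact_closure_cube r) (fun=> fun=> I).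
  exact: (Lp_vec_integrable i p1 (measurable_cube r) (cube_fin n r) LG).
split=> //.
have <- : \bigcup_k cube k%:R = [set: 'rV[R]_n].
  rewrite -subTset => x _; exists (Num.truncn `|x|).+1 => //.
  exact: truncnS_gt.
apply/measurable_fun_bigcup => k; first exact: measurable_cube.
by have /measurable_int/measurable_EFinP := lG k%:R.
Qed.

(** The right derivatives along [e_i] and [- e_i] equal [G_i] and [- G_i] almost everywhere, hence
    are opposite there. Differentiability almost everywhere thus comes out of the existence of a
    weak gradient. *)
Lemma convex_weak_gradient (p : R) (u : 'rV[R]_n -> R) G : (0 < n)%N -> 1 < p ->
  (forall x y (t : R), 0 <= t <= 1 ->
    u (t *: x + (1 - t) *: y) <= t * u x + (1 - t) * u y) ->
  sobolev_loc p%:E setT u G ->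
  {ae mu, forall x, differentiable_pt u x /\ G x = right_grad u x}.
Proof.
move=> n0 p1 cu uG.
have H i (c : R) : {ae mu, forall x, c * G x ord0 i - dd u (c *: e_ i) x = 0}.
  have [mG lG] := sobolev_loc_integrable i p1 uG.
  apply: (weak_gradient_rdiff (u := u)) => //; first exact: (convex_rdiff n0 cu).
  move=> r.
  by have [] := uG (cube r) (@open_cube _ _ r) (@compact_closure_cube r) (fun=> fun=> I).
have H1 : {ae mu, forall x i, 1 * G x ord0 i - dd u (1 *: e_ i) x = 0}.
  (* Countable intersections are indexed by [nat]; the indices outside ['I_n] carry the trivial
     condition. *)
  have : {ae mu, forall x (k : nat), if insub k is Some i then
      1 * G x ord0 i - dd u (1 *: e_ i) x = 0 else True}.
    apply/ae_foralln => k; case: insubP => [i _ _|_]; last exact: aeW.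
    exact: H.
  by apply: filterS => x Hx i; have := Hx (val i); rewrite valK.
have H2 : {ae mu, forall x i, -1 * G x ord0 i - dd u (-1 *: e_ i) x = 0}.
  have : {ae mu, forall x (k : nat), if insub k is Some i then
      -1 * G x ord0 i - dd u (-1 *: e_ i) x = 0 else True}.
    apply/ae_foralln => k; case: insubP => [i _ _|_]; last exact: aeW.
    exact: H.
  by apply: filterS => x Hx i; have := Hx (val i); rewrite valK.
apply: filterS2 H1 H2 => x h1 h2.
have g1 i : G x ord0 i = dd u (e_ i) x.
  by have := h1 i; rewrite scale1r; lra.
split; last by apply/rowP => i; rewrite mxE g1.
by move=> i; have := h2 i; rewrite scaleN1r g1; lra.
Qed.

(** The constant sequence [phi] is an approximating sequence. *)
Lemma smooth_sobolev0 (p r s : R) phi : 0 < p -> smooth phi ->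
  (forall x, r <= `|x| -> phi x = 0) ->
  forall D, open D -> D `<=` cube s ->
    (forall x, `|x| <= r -> D x) -> sobolev0 p%:E D phi (grad phi).
Proof.
move=> p0 sp phi0 D oD Ds rD.
have mD := open_measurable_rV oD.
have cp := smooth_continuous sp.
have cd i : continuous (partial i phi) by exact/smooth_continuous/smooth_partial.
have mgrad : measurable_fun setT (grad phi).
  apply: measurable_fun_rV => i.
  rewrite (_ : (fun x => _) = partial i phi); first exact: continuous_measurable_rV.
  by apply/funext => x; rewrite mxE.
have [Mp Mpb] : exists M : R, forall x, `|x| <= s -> enorm (grad phi x) <= M.
  have cN : continuous (fun x => \sum_i partial i phi x * partial i phi x).
    by apply: continuous_sum => i x; exact: cvgM (cd i x) (cd i x).
  have [M [M0 HM]] := continuous_bounded s cN.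
  exists (Num.sqrt M) => x /HM xM; rewrite ler_wsqrtr//.
  apply: le_trans (le_trans (ler_norm _) xM).
  by rewrite /dot le_eqVlt; apply/orP; left; apply/eqP/eq_bigr => i _; rewrite !mxE.
have tphi : test_function D phi by apply: (smooth_test_function (r := r)).
have zero (h : 'rV[R]_n -> R) : h =1 (fun=> 0) -> Lp_norm p%:E D h = 0%E.
  move=> h0; rewrite /Lp_norm -[RHS](@Lnorm0 _ _ R mu p%:E); last by rewrite eqe gt_eqF.
  by apply: eq_Lnorm => x /=; rewrite patchE h0 if_same.
split; last first.
  exists (fun=> phi); split => //.
    by rewrite zero => [|x]; [exact: cvg_cst|rewrite subrr].
  by rewrite zero => [|x]; [exact: cvg_cst|rewrite subrr enorm0].
split.
- exact: continuous_Lp Ds cp.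
- split; first exact: (measurable_funS measurableT).
  have mN : measurable_fun D (enorm \o grad phi).
    apply: (measurable_funS measurableT) => //.
    apply: measurableT_comp => //; apply: continuous_measurable_rV.
    exact: continuous_enorm.
  have Doo : (mu D < +oo)%E.
    apply: le_lt_trans (cube_fin n s); apply: le_measure; rewrite ?inE//.
    exact: measurable_cube.
  have [] // := @bounded_Lp R n p Mp D (enorm \o grad phi) p0 mD Doo mN.
  by move=> x /Ds/ltW xs; rewrite ger0_norm ?enorm_ge0//; exact: Mpb.
- move=> psi [Cpsi _ psiD] i.
  have spsi : smooth psi by exact: Cpsi.
  have psi0 x : ~ D x -> psi x = 0.
    move=> Dx; apply: contrapT => /eqP px; apply: Dx; apply: psiD.
    exact: subset_closure.
  have dpsi0 x : ~ D x -> partial i psi x = 0.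
    by move=> Dx; apply: partial_support => /psiD.
  have dE f : (forall x, is_derive x (e_ i) f (partial i f x)) -> smooth f ->
      rdiff (1 *: e_ i) f (fun x => 1 * partial i f x).
    by move=> df sf; apply: C1_rdiff => //; [exact: smooth_continuous|exact/smooth_continuous/smooth_partial].
  rewrite -[LHS]Rintegral_setTE; last by move=> x /dpsi0 ->; rewrite mulr0.
  rewrite -[in RHS]Rintegral_setTE; last by move=> x /psi0 ->; rewrite mulr0.
  have := @rdiff_by_parts _ _ (1 *: e_ i) phi _ psi _ s
    (dE phi (fun x => smooth_derivable i x sp) sp)
    (dE psi (fun x => smooth_derivable i x spsi) spsi).
  under eq_Rintegral do rewrite mul1r.
  move=> ->; last first.
    by move=> x xs; apply: psi0 => /Ds; rewrite /cube/=; lra.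
  by congr (- _); apply: eq_Rintegral => x _; rewrite mul1r mxE.
Qed.

End weak_gradients.

Section weak_equation.
Context (R : realType) (n : nat).
Local Notation mu := (lebesgue_rV R n).
Local Notation e_ := (@basis_rV R n).
Implicit Types (w phi : 'rV[R]_n -> R) (V : 'rV[R]_n -> 'rV[R]_n).

Lemma rdiff_bounded v w w' (s : R) : rdiff v w w' -> (forall x, s <= `|x| -> w x = 0) ->
  exists M : R, 0 <= M /\ forall x : 'rV[R]_n, `|w' x| <= M.
Proof.
move=> dw w0; have [M [M0 wM]] := rdiff_quot_bound (s + `|v|) dw.
exists M; split=> // x; have [xs|xs] := leP `|x| (s + `|v|); first by have [] := wM x xs.
by rewrite (rdiff_support dw w0) ?normr0// ltW.
Qed.

Lemma cvg_seq_sum (I : Type) (s : seq I) (a : I -> nat -> R) (l : I -> R) :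
  (forall i, a i k @[k --> \oo] --> l i) ->
  \sum_(i <- s) a i k @[k --> \oo] --> \sum_(i <- s) l i.
Proof.
move=> al; elim: s => [|i s IHs].
  by apply: (@eq_cvg_seq _ (fun=> 0)) => [k|]; rewrite big_nil//; exact: cvg_cst.
apply: (@eq_cvg_seq _ (fun k => a i k + \sum_(j <- s) a j k)) => [k|].
  by rewrite big_cons.
by rewrite big_cons; exact: cvg_seqD.
Qed.

(** Mollify [w] with radius [1/(k+1)], which explains the margin 1 in the support of [phi]. The
    mollified partial derivatives are uniformly bounded and converge wherever [w' i] is continuous,
    so the equation passes to the limit by bounded convergence. *)
Lemma equation_rdiff V (M rho s : R) w (w' : 'I_n -> 'rV[R]_n -> R) :
  (forall i, measurable_fun setT (fun x => V x ord0 i)) ->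
  (forall x i, `|V x ord0 i| <= M) ->
  (forall x, rho <= `|x| -> V x = 0) ->
  (forall phi, smooth phi -> (forall x, s + 1 <= `|x| -> phi x = 0) ->
    \int[mu]_x (\sum_i V x ord0 i * partial i phi x) = 0) ->
  continuous w -> (forall i, rdiff (e_ i) w (w' i)) -> (forall x, s <= `|x| -> w x = 0) ->
  {ae mu, forall x i, {for x, continuous (w' i)}} ->
  \int[mu]_x (\sum_i V x ord0 i * w' i x) = 0.
Proof.
move=> mV VM V0 eqV cw dw w0 cw'.
have cE (h : 'I_n -> 'rV[R]_n -> R) : \int[mu]_x (\sum_i V x ord0 i * h i x) =
    \int[mu]_(x in cube rho) (\sum_i V x ord0 i * h i x).
  apply: Rintegral_setTE => x; rewrite /cube/= => /negP; rewrite -leNgt => xr.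
  by rewrite big1// => i _; rewrite V0// mxE mul0r.
have mw' i := rdiff_measurable (dw i).
have [L wL] : exists L : R, forall i, 0 <= L /\ forall x, `|w' i x| <= L.
  have /choice[L HL] := fun i => rdiff_bounded (dw i) w0.
  exists (\sum_i L i) => i; split; first by apply: sumr_ge0 => j _; have [] := HL j.
  move=> x; apply: le_trans ((HL i).2 x) _.
  by rewrite (bigD1 i)//= lerDl sumr_ge0// => j _; have [] := HL j.
have /choice[eta Heta] := fun k : nat => mollifier_exists n (invS_gt0 R k).
pose phi k := convol w (eta k).
have phiE k i x : partial i (phi k) x = \int[mu]_y (w' i y * eta k (y - x)).
  by have [se _ e0 _] := Heta k; exact: (convol_partial x (dw i) w0 se e0).
have phi_smooth k : smooth (phi k).
  by have [se _ e0 _] := Heta k; exact: (convol_smooth cw w0 se e0).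
have phi0 k x : s + 1 <= `|x| -> phi k x = 0.
  have [_ _ e0 _] := Heta k; move=> xs; apply: (convol_support w0 e0).
  by apply: le_trans xs; rewrite lerD2l; have /andP[] := invS_itv R k.
have phiL k i x : `|partial i (phi k) x| <= L.
  have [se ep e0 e1] := Heta k; rewrite phiE.
  exact: (mollify_bound x (mw' i) (wL i).2 se ep e0 e1).
have phi_cvg : {ae mu, forall x i, partial i (phi k) x @[k --> \oo] --> w' i x}.
  apply: filterS cw' => x cx i; apply/cvgrPdist_le => e e0.
  have /cvgrPdist_le/(_ e e0)/nbhs_ballP[d /= d0 dE] := cx i.
  have /cvgrPdist_lt/(_ d d0) := @cvg_invS R; apply: filterS => k.
  rewrite sub0r normrN ger0_norm ?(ltW (invS_gt0 _ _))// => kd.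
  have [se ep e0' e1] := Heta k; rewrite phiE.
  apply: (mollify_close (mw' i) (rdiff_lbounded (dw i)) se ep e0' e1) => y xy.
  by apply: dE; rewrite -ball_normE /=; exact: lt_trans xy kd.
have /= lim : \int[mu]_(x in cube rho) (\sum_i V x ord0 i * partial i (phi k) x) @[k --> \oo]
    --> \int[mu]_(x in cube rho) (\sum_i V x ord0 i * w' i x).
  apply: (bounded_Rintegral_cvg (M := \sum_(i < n) M * L)).
  - exact: measurable_cube.
  - exact: cube_fin.
  - move=> k; apply: (measurable_funS measurableT) => //.
    apply: measurable_sum => i; apply: measurable_funM => //.
    by apply: continuous_measurable_rV; exact/smooth_continuous/smooth_partial.
  - apply: (measurable_funS measurableT) => //.
    by apply: measurable_sum => i; exact: measurable_funM.
  - apply: filterS phi_cvg => x cx _; apply: cvg_seq_sum => i.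
    by apply: cvg_seqZ; exact: cx.
  - apply: aeW => x k _; apply: le_trans (ler_norm_sum _ _ _) _.
    by apply: ler_sum => i _; rewrite normrM ler_pM.
rewrite cE; apply: (cvg_unique _ lim) => //.
rewrite (_ : (fun k => _) = fun=> 0); first exact: cvg_cst.
by apply/funext => k; apply: (etrans (esym (cE _))); apply: eqV; [exact: phi_smooth|exact: phi0].
Qed.

Lemma flux_subdifferential (b p : R) (H Z : 'rV[R]_n) : 1 < p ->
  subdifferential enorm H Z ->
  [/\ enorm Z <= 1, dot Z H = enorm H &
    b *: Z + enorm H `^ (p - 2) *: H = flux b (p - 1) H Z].
Proof.
move=> p1; rewrite subdifferential_enorm; case: eqP => [->|/eqP H0] /= ZH.
  (* At [H = 0] the vector [Z] is arbitrary in the unit ball; the power [p - 2] multiplies the zero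
     vector, and the power [p - 1] of 0 is 0. *)
  by rewrite enorm0 -[X in dot Z X](scale0r 0) dotZr mul0r scaler0 addr0 /flux enorm0 powR0 ?addr0//; lra.
have N0 : enorm H != 0 by rewrite enorm_eq0.
split.
- by rewrite ZH enormZ ger0_norm ?invr_ge0 ?enorm_ge0// mulVf.
- by rewrite ZH dotZl -enorm_sqr expr2 mulKf.
- rewrite /flux scalerDl; congr (_ + _); rewrite ZH scalerA; congr (_ *: _).
  by rewrite -powR_inv1 ?enorm_ge0// -powRD ?N0 ?implybT//; congr (_ `^ _); ring.
Qed.

(** On each ball the total flux is represented by a field [V] that is measurable and bounded on the
    whole space, so that integrals over the ball become integrals over the space. The condition on
    [rho] places the cube of radius [s + 1], which contains the supports of the mollified test
    functions, inside the Euclidean ball. *)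
Lemma weak_equation (b p : R) u : (0 < n)%N -> 1 < p ->
  (forall x y (t : R), 0 <= t <= 1 ->
    u (t *: x + (1 - t) *: y) <= t * u x + (1 - t) * u y) ->
  weak_solution b p u ->
  {ae mu, forall x, differentiable_pt u x} /\
  forall rho, 0 < rho -> exists V (M : R),
  [/\ forall i, measurable_fun setT (fun x => V x ord0 i),
      forall x i, `|V x ord0 i| <= M,
      forall x, ~ eball rho x -> V x = 0,
      {ae mu, forall x, eball rho x -> exists zeta,
        [/\ enorm zeta <= 1, dot zeta (right_grad u x) = enorm (right_grad u x) &
          V x = flux b (p - 1) (right_grad u x) zeta]} &
      forall w (w' : 'I_n -> 'rV[R]_n -> R) (s : R), continuous w -> (forall i, rdiff (e_ i) w (w' i)) ->
        (forall x i, differentiable_pt u x -> {for x, continuous (w' i)}) ->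
        (forall x, s <= `|x| -> w x = 0) -> n%:R * (s + 1) < rho ->
        \int[mu]_x (\sum_i V x ord0 i * w' i x) = 0].
Proof.
move=> n0 p1 cu [G uG eqG].
have Gae := convex_weak_gradient n0 p1 cu uG.
have mG : measurable_fun setT G.
  by apply: measurable_fun_rV => i; have [] := sobolev_loc_integrable i p1 uG.
split; first by apply: filterS Gae => x [].
move=> rho rho0.
have [Z [[mZ _] Zsub eqZ]] := eqG _ (eball_lipschitz_domain n rho0).
set H := right_grad u; set D := eball rho.
have mD : measurable D := measurable_eball rho.
have Doo : (mu D < +oo)%E := eball_fin n rho.
(* The bound on [Z] holds only almost everywhere; replacing [Z] by 0 outside [A] makes it hold
   everywhere without changing the integrals. *)
pose A := D `&` (Z @^-1` [set z | enorm z <= 1]).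
have mA : measurable A.
  apply: mZ => //.
  rewrite -[X in measurable X]setCK; apply: measurableC; apply: open_measurable_rV.
  apply: closed_openC.
  apply: (@closed_comp _ _ (@enorm R n) [set y | y <= 1]); last exact: closed_le.
  by move=> x _; exact: continuous_enorm.
pose Zt i := (fun x => Z x ord0 i) \_ A.
have mZt i : measurable_fun setT (Zt i).
  apply/(measurable_restrictT _ mA).
  apply: (measurableT_comp (measurable_coord i)).
  by apply: measurable_funS mZ => // x [].
have Zt1 i x : `|Zt i x| <= 1.
  rewrite /Zt patchE; case: ifPn => [/set_mem[_ /= x1]|_]; last by rewrite normr0.
  exact: le_trans (ler_coord_norm _ _) (le_trans (ler_norm_enorm _) x1).
have dH i := convex_rdiff n0 cu (e_ i).
have mH : measurable_fun setT H.
  apply: measurable_fun_rV => i; rewrite (_ : (fun x => _) = dd u (e_ i)).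
    exact: rdiff_measurable (dH i).
  by apply/funext => x; rewrite mxE.
pose K x := enorm (H x) `^ (p - 2) *: H x.
have mHi i : measurable_fun setT (fun x => H x ord0 i).
  exact: (measurableT_comp (measurable_coord i) mH).
have mp (J : 'rV[R]_n -> 'rV[R]_n) i : measurable_fun setT J ->
    measurable_fun setT (fun x => (enorm (J x) `^ (p - 2) *: J x) ord0 i).
  move=> mJ; rewrite (_ : (fun x => _) = (fun x => enorm (J x) `^ (p - 2) * J x ord0 i)); last first.
    by apply/funext => x; rewrite mxE.
  apply: measurable_funM; last exact: (measurableT_comp (measurable_coord i) mJ).
  have mN : measurable_fun setT (fun x => enorm (J x)).
    apply: measurableT_comp => //; apply: continuous_measurable_rV.
    exact: continuous_enorm.
  exact: (@measurableT_comp _ _ _ _ _ _ (fun x : R => x `^ (p - 2)) _ _ _ mN).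
have mK i : measurable_fun setT (fun x => K x ord0 i) := mp H i mH.
have [L HL] : exists L : R, forall x, D x -> enorm (H x) <= L.
  have /choice[L HL] := fun i => rdiff_lbounded (dH i) rho.
  exists (n%:R * \sum_i `|L i|) => x Dx; apply: le_trans (enorm_le_norm _) _.
  rewrite ler_wpM2l//; apply/rV_norm_leP => [|i]; first exact: sumr_ge0.
  rewrite mxE; apply: le_trans (HL i x _) _; first exact: ltW (eball_sub_cube Dx).
  apply: le_trans (ler_norm _) _.
  by rewrite [leRHS](bigD1 i)//= lerDl sumr_ge0.
(* For [p < 2] the factor [|H|^(p-2)] alone is unbounded near [H = 0], but [K] has norm
   [|H|^(p-1)]. *)
have KL i x : D x -> `|K x ord0 i| <= L `^ (p - 1).
  move=> Dx; apply: le_trans (ler_coord_norm _ _) (le_trans (ler_norm_enorm _) _).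
  rewrite /K enormZ ger0_norm ?powR_ge0//.
  have -> : enorm (H x) `^ (p - 2) * enorm (H x) = enorm (H x) `^ (p - 1).
    have [->|x0] := eqVneq (enorm (H x)) 0; first by rewrite mulr0 powR0//; lra.
    rewrite -{2}[enorm (H x)]powRr1 ?enorm_ge0// -powRD ?x0 ?implybT//.
    by congr (_ `^ _); ring.
  rewrite ge0_ler_powR ?nnegrE ?enorm_ge0//; [lra| |exact: HL].
  exact: le_trans (enorm_ge0 _) (HL x Dx).
pose V x : 'rV[R]_n := \row_i ((fun x => b * Zt i x + K x ord0 i) \_ D) x.
have VE i : (fun x => V x ord0 i) = (fun x => b * Zt i x + K x ord0 i) \_ D.
  by apply/funext => x; rewrite mxE.
have mV i : measurable_fun setT (fun x => V x ord0 i).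
  rewrite VE; apply/(measurable_restrictT _ mD); apply: (measurable_funS measurableT) => //.
  by apply: measurable_funD => //; exact: measurable_funM.
have V0 x : ~ D x -> V x = 0.
  by move=> Dx; apply/rowP => i; rewrite !mxE patchE memNset.
exists V, (`|b| + L `^ (p - 1)).
have Zae : {ae mu, forall x, D x -> A x /\ subdifferential enorm (H x) (Z x)}.
  apply: filterS2 Gae Zsub => x [_ ->] Zx Dx; have Zx' := Zx Dx.
  by split=> //; split=> //=; have [] := flux_subdifferential b p1 Zx'.
split => //.
- move=> x i; rewrite mxE patchE; case: ifPn => [/set_mem Dx|_]; last first.
    by rewrite normr0 addr_ge0// powR_ge0.
  apply: le_trans (ler_normD _ _) _; apply: lerD; last exact: KL.
  by rewrite normrM ler_piMr.
- apply: filterS Zae => x HZ Dx; have [Ax Zx] := HZ Dx.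
  exists (Z x); have [Z1 ZH VF] := flux_subdifferential b p1 Zx; split => //.
  rewrite -VF; apply/rowP => i; rewrite mxE patchE mem_set// /Zt patchE mem_set//.
  by rewrite !mxE.
move=> w w' s cw dw cw' w0 srho.
apply: (equation_rdiff (M := `|b| + L `^ (p - 1)) (rho := rho) (s := s) (w := w)) => //.
- move=> x i; rewrite mxE patchE; case: ifPn => [/set_mem Dx|_]; last first.
    by rewrite normr0 addr_ge0// powR_ge0.
  apply: le_trans (ler_normD _ _) _; apply: lerD; last exact: KL.
  by rewrite normrM ler_piMr.
- by move=> x xr; apply: V0 => /eball_sub_cube; rewrite /cube/=; lra.
- move=> phi sphi phi0.
  have p0 : 0 < p by lra.
  have sob : sobolev0 p%:E D phi (grad phi).
    have sD x : `|x| <= s + 1 -> D x.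
      move=> xs; apply: le_lt_trans (enorm_le_norm x) (le_lt_trans _ srho).
      by rewrite ler_wpM2l.
    exact: (smooth_sobolev0 p0 sphi phi0 (@open_eball _ _ rho) (@eball_sub_cube _ _ rho) sD).
  have cd i : continuous (partial i phi) by exact/smooth_continuous/smooth_partial.
  have md i : measurable_fun D (partial i phi).
    by apply: (measurable_funS measurableT) => //; exact: continuous_measurable_rV.
  have := eqZ phi (grad phi) sob.
  have -> : \int[mu]_(x in D) dot (Z x) (grad phi x) =
      \int[mu]_(x in D) (\sum_i Zt i x * partial i phi x).
    apply: eq_Rintegral_ae => //.
    + apply: measurable_sum => i; apply: measurable_funM => //.
        exact: (measurableT_comp (measurable_coord i) mZ).
      apply: eq_measurable_fun (md i) => x _; by rewrite mxE.
    + apply: measurable_sum => i; apply: measurable_funM => //.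
      exact: (measurable_funS measurableT).
    + apply: filterS Zae => x HZ Dx; have [Ax _] := HZ Dx.
      by apply: eq_bigr => i _; rewrite mxE /Zt patchE mem_set.
  have mKD i : measurable_fun D (fun x => K x ord0 i) by exact: (measurable_funS measurableT).
  have mZD i : measurable_fun D (Zt i) by exact: (measurable_funS measurableT).
  have mKs : measurable_fun D (fun x => \sum_i K x ord0 i * partial i phi x).
    by apply: measurable_sum => i; exact: measurable_funM.
  have mZs : measurable_fun D (fun x => \sum_i Zt i x * partial i phi x).
    by apply: measurable_sum => i; exact: measurable_funM.
  have -> : \int[mu]_(x in D) dot (enorm (G x) `^ (p - 2) *: G x) (grad phi x) =
      \int[mu]_(x in D) (\sum_i K x ord0 i * partial i phi x).
    apply: eq_Rintegral_ae => //.
    + apply: measurable_sum => i; apply: measurable_funM => //; last first.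
        apply: eq_measurable_fun (md i) => x _; by rewrite mxE.
      exact: (measurable_funS measurableT _ (mp G i mG)).
    + apply: filterS Gae => x [_ ->] Dx.
      by apply: eq_bigr => i _; congr (_ * _); rewrite mxE.
  have [P [P0 HP]] : exists P : R, 0 <= P /\ forall x i, D x -> `|partial i phi x| <= P.
    have /choice[P HP] := fun i => continuous_bounded rho (cd i).
    exists (\sum_i P i); split; first by apply: sumr_ge0 => i _; have [] := HP i.
    move=> x i Dx; apply: le_trans ((HP i).2 x (ltW (eball_sub_cube Dx))) _.
    by rewrite [leRHS](bigD1 i)//= lerDl sumr_ge0// => j _; have [] := HP j.
  have iKs : mu.-integrable D (EFin \o (fun x => \sum_i K x ord0 i * partial i phi x)).
    apply: (integrable_of_bounded (M := \sum_(i < n) L `^ (p - 1) * P)) => // x Dx.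
    apply: le_trans (ler_norm_sum _ _ _) _; apply: ler_sum => i _.
    by rewrite normrM ler_pM//; [exact: KL|exact: HP].
  have iZs : mu.-integrable D (EFin \o (fun x => \sum_i Zt i x * partial i phi x)).
    apply: (integrable_of_bounded (M := \sum_(i < n) 1 * P)) => // x Dx.
    apply: le_trans (ler_norm_sum _ _ _) _; apply: ler_sum => i _.
    by rewrite normrM ler_pM//; exact: HP.
  rewrite -RintegralZl// -RintegralD//; last first.
    apply: (@eq_integrable _ _ _ _ _ mD (fun x => (b%:E * (\sum_i Zt i x * partial i phi x)%:E)%E)) => //.
    exact: integrableZl.
  move=> E0; rewrite (@Rintegral_setTE _ _ D); last first.
    by move=> x Dx; apply: big1 => i _; rewrite V0// mxE mul0r.
  rewrite -[RHS]E0; apply: eq_Rintegral => x /[!inE] Dx.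
  rewrite mulr_sumr -big_split; apply: eq_bigr => i _.
  by rewrite mxE patchE mem_set// mulrDl mulrA.
- by apply: filterS Gae => x [gx _] i; exact: cw'.
Qed.

End weak_equation.

(** * The energy estimate *)

Section integrable_weight.
Context (R : realType).
Local Notation leb := (@lebesgue_measure R).

Lemma measurable_coordprod (n : nat) (f : R -> R) : measurable_fun setT f ->
  measurable_fun setT (fun x : 'rV[R]_n => \prod_(i < n) f (x ord0 i)).
Proof.
move=> mf; apply: measurable_prod => i _.
exact: (measurableT_comp mf (measurable_coord i)).
Qed.

(** Induction on the dimension: [lebesgue_rV] is built through [rV_cons], so Tonelli's theorem
    splits off the first coordinate. *)
Lemma integral_coordprod (n : nat) (f : R -> R) : measurable_fun setT f -> (forall s, 0 <= f s) ->
  (\int[lebesgue_rV R n]_x (\prod_(i < n) f (x ord0 i))%:E =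
   (\int[leb]_s (f s)%:E) ^+ n)%E.
Proof.
move=> mf f0; elim: n => [|n IHn].
  rewrite expe0 /= integral_dirac//; last first.
    by apply/measurable_EFinP; exact: (@measurable_coordprod 0 f).
  by rewrite diracT mul1e big_ord0.
have mg := @measurable_coordprod n.+1 f mf.
have mg' := @measurable_coordprod n f mf.
have consE z : \prod_(i < n.+1) f (rV_cons z ord0 i) = f z.1 * \prod_(i < n) f (z.2 ord0 i).
  have z0 : rV_cons z ord0 ord0 = z.1 by rewrite -[in RHS](rV_consK z).
  have zi i : rV_cons z ord0 (lift ord0 i) = z.2 ord0 i by rewrite -[in RHS](rV_consK z) /= mxE.
  by rewrite big_ord_recl z0; congr (_ * _); apply: eq_bigr => i _; rewrite zi.
transitivity (\int[(leb \x lebesgue_rV R n)%E]_z (f z.1 * \prod_(i < n) f (z.2 ord0 i))%:E)%E.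
  rewrite [LHS](@ge0_integral_pushforward _ _ _ _ _ _ (@measurable_rV_cons R n)) //=.
  - by apply: eq_integral => z _ /=; rewrite consE.
  - exact/measurable_EFinP.
  - by move=> x _; rewrite lee_fin prodr_ge0.
have mF : measurable_fun setT
    (fun z : measurableTypeR R * 'rV[R]_n => (f z.1 * \prod_(i < n) f (z.2 ord0 i))%:E).
  apply/measurable_EFinP; apply: measurable_funM.
    exact: (measurableT_comp mf measurable_fst).
  exact: (measurableT_comp mg' measurable_snd).
rewrite [LHS](fubini_tonelli1 _ mF); last first.
  by move=> z; rewrite lee_fin mulr_ge0// prodr_ge0.
rewrite /fubini_F expeS -IHn -ge0_integralZr//; last 3 first.
- exact/measurable_EFinP.
- by move=> s _; rewrite lee_fin.
- by apply: integral_ge0 => x _; rewrite lee_fin prodr_ge0.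
apply: eq_integral => s _ /=.
under eq_integral do rewrite EFinM.
rewrite ge0_integralZl//.
- exact/measurable_EFinP.
- by move=> x _; rewrite lee_fin prodr_ge0.
- by rewrite lee_fin.
Qed.

Lemma integral_oneDsqr : (\int[leb]_s ((oneDsqr s)^-1)%:E < +oo)%E.
Proof.
rewrite ge0_symfun_integralT.
- by rewrite -set_itvcy integral0y_oneDsqr -EFinM ltry.
- by move=> x; rewrite invr_ge0.
- exact: continuous_oneDsqrV.
- by move=> x; rewrite /= /oneDsqr sqrrN.
Qed.

(** Decay of order [2 n] is enough for integrability in dimension [n], and, unlike a cutoff with
    compact support, this function has a gradient bounded by a small multiple of itself. *)
Definition weight n (gam : R) (x : 'rV[R]_n) : R := ((1 + gam ^+ 2 * dot x x) ^+ n)^-1.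

Lemma weight_ge1 n (gam : R) (x : 'rV[R]_n) : 1 <= 1 + gam ^+ 2 * dot x x.
Proof. by rewrite lerDl mulr_ge0 ?sqr_ge0 ?dot_ge0. Qed.

Lemma weight_gt0 n (gam : R) (x : 'rV[R]_n) : 0 < weight gam x.
Proof. by rewrite /weight invr_gt0 exprn_gt0// (lt_le_trans ltr01)// weight_ge1. Qed.

Lemma weight_continuous n (gam : R) : continuous (@weight n gam).
Proof.
move=> x; apply: (@cvgV R _ (nbhs x) (nbhs_filter x)).
  by rewrite gt_eqF// exprn_gt0// (lt_le_trans ltr01)// weight_ge1.
have H := @exprn_continuous R n (1 + gam ^+ 2 * dot x x).
apply: (@continuous_cvg _ _ _ (nbhs x) (nbhs_filter x) _ _ _ H).
apply: cvgD; first exact: cvg_cst.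
by apply: cvgM; [exact: cvg_cst|exact: continuous_dot_sqr].
Qed.

(** Since [|x|^2 >= x_i^2] for each [i], the [n]-th power dominates the product of the factors
    [1 + gam^2 x_i^2], and [gam <= 1] bounds each from below by [gam^2 (1 + x_i^2)]. The integral is
    thus at most the [n]-th power of an arctangent integral. *)
Lemma weight_integrable n (gam : R) : 0 < gam <= 1 ->
  (lebesgue_rV R n).-integrable setT (EFin \o @weight n gam).
Proof.
move=> /andP[g0 g1].
pose f (s : R) := gam ^- 2 * (oneDsqr s)^-1.
have mi : measurable_fun setT (fun s : R => (oneDsqr s)^-1).
  by apply: continuous_measurable_fun; exact: continuous_oneDsqrV.
have mf : measurable_fun setT f by exact: measurable_funM.
have f0 s : 0 <= f s by rewrite /f mulr_ge0 ?invr_ge0 ?sqr_ge0.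
have fE : (\int[leb]_s (f s)%:E < +oo)%E.
  under eq_integral do rewrite EFinM.
  rewrite ge0_integralZl//.
  - by rewrite lte_mul_pinfty// ?lee_fin ?invr_ge0 ?sqr_ge0//; exact: integral_oneDsqr.
  - exact/measurable_EFinP.
  - by rewrite lee_fin invr_ge0 sqr_ge0.
have wf x : weight gam x <= \prod_(i < n) f (x ord0 i).
  rewrite /weight -exprVn -[X in _ ^+ X](card_ord n) -prodr_const.
  apply: ler_prod => i _; rewrite invr_ge0 (le_trans ler01) ?weight_ge1//=.
  rewrite /f -invfM lef_pV2 ?posrE ?mulr_gt0 ?exprn_gt0//; last first.
    by rewrite (lt_le_trans ltr01)// weight_ge1.
  rewrite /oneDsqr mulrDr mulr1 lerD ?exprn_ile1// ?(ltW g0)//.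
  rewrite ler_wpM2l ?sqr_ge0// /dot (bigD1 i)//= -expr2 lerDl sumr_ge0// => j _.
  by rewrite -expr2 sqr_ge0.
apply/integrableP; split.
  by apply/measurable_EFinP; apply: continuous_measurable_rV; exact: weight_continuous.
apply: (@le_lt_trans _ _ (\int[lebesgue_rV R n]_x (\prod_(i < n) f (x ord0 i))%:E)%E).
  apply: ge0_le_integral => //.
  - apply: measurableT_comp => //; apply/measurable_EFinP.
    by apply: continuous_measurable_rV; exact: weight_continuous.
  - apply/measurable_EFinP; exact: measurable_coordprod.
  - by move=> x _ /=; rewrite lee_fin ger0_norm// ltW// weight_gt0.
rewrite integral_coordprod//.
have : (0 <= \int[leb]_s (f s)%:E)%E by apply: integral_ge0 => s _; rewrite lee_fin.
by move: fE; case: (\int[leb]_s _)%E => // r _ _; rewrite -EFin_expe ltry.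
Qed.

End integrable_weight.

(** * Powers of the positive part and gradient of the weight *)

Section cutoff.
Context (R : realType).

(** From exponent 2 on, powers of the positive part are C^1; the positive part itself would leave a
    jump of the gradient on the boundary of the support. *)
Lemma posX_derive m (s : R) : is_derive s 1 (fun t : R => Num.max 0 t ^+ m.+2)
  (m.+2%:R * Num.max 0 s ^+ m.+1).
Proof.
have [s0|s0|->] := ltgtP s 0.
- rewrite expr0n/= mulr0.
  apply: (near_eq_is_derive (f := fun=> 0)).
    by near=> t; rewrite max_l ?expr0n//; near: t; exact: lt_le_nbhsl.
- have nE : \near s, (fun t : R => t ^+ m.+2) s = Num.max 0 s ^+ m.+2.
    by near=> t; rewrite max_r//; apply: ltW; near: t; exact: lt_nbhsr.
  have dX := @is_deriveX R R id m.+2 s 1 1 (is_derive_id _ _).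
  have fE : (id ^+ m.+2 : R -> R) = (fun t => t ^+ m.+2).
    by apply/funext => t; rewrite exprfctE.
  rewrite fE in dX; apply: is_derive_eq (near_eq_is_derive nE dX) _.
  by rewrite /GRing.scale/= mulr1.
- rewrite expr0n/= mulr0.
  pose f (t : R) := Num.max 0 t ^+ m.+2.
  have H : h^-1 *: (f (h *: 1 + 0) - f 0) @[h --> (0 : R)^'] --> (0 : R).
    apply/cvgrPdist_le => e e0; near=> h.
    rewrite addr0 [h%:A]mulr1 /f maxxx expr0n/= subr0 sub0r normrN normrM.
    have h0 : h != 0 by near: h; exact: nbhs_dnbhs_neq.
    rewrite normfV ler_pdivrMl ?normr_gt0//.
    have h1 : `|h| <= 1 by near: h; exact: (@dnbhs0_le _ R).
    have he : `|h| <= e by near: h; exact: (@dnbhs0_le _ R).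
    apply: (@le_trans _ _ (`|h| ^+ m.+2)).
      rewrite normrX ler_pXn2r ?nnegrE//.
      by case: (leP 0 h) => hh; rewrite ?normr0.
    rewrite exprS ler_wpM2l// exprSr; apply: le_trans he.
    by rewrite ler_piMl// exprn_ile1.
  by apply: DeriveDef; [apply/cvg_ex; exists 0|apply/cvg_lim].
Unshelve. all: by end_near. Qed.

Lemma posX_continuous m : continuous (fun s : R => m.+2%:R * Num.max 0 s ^+ m.+1).
Proof.
move=> s; apply: cvgM; first exact: cvg_cst.
have H := @exprn_continuous R m.+1 (Num.max 0 s).
apply: (@continuous_cvg _ _ _ (nbhs s) (nbhs_filter s) _ _ _ H).
by apply: continuous_max; [exact: cvg_cst|exact: cvg_id].
Qed.

Context (n : nat).
Implicit Types (x v : 'rV[R]_n) (F : 'rV[R]_n -> R).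

Lemma rdiff_posX v F F' m : rdiff v F F' ->
  rdiff v (fun x => Num.max 0 (F x) ^+ m.+2)
    (fun x => m.+2%:R * Num.max 0 (F x) ^+ m.+1 * F' x).
Proof.
by move=> dF; exact: (rdiff_comp dF (@posX_derive m) (@posX_continuous m)).
Qed.

(** The logarithmic gradient of [weight gam] at [x] is [- weight_coef gam x *: x]. *)
Definition weight_coef (gam : R) x : R := 2 * n%:R * gam ^+ 2 / (1 + gam ^+ 2 * dot x x).

Lemma weight_coef_ge0 gam x : 0 <= weight_coef gam x.
Proof. apply: divr_ge0; last exact: le_trans (weight_ge1 gam x).
by apply: mulr_ge0; [exact: mulr_ge0|exact: sqr_ge0]. Qed.

Lemma weight_coef_le gam x : 0 <= gam -> weight_coef gam x * enorm x <= n%:R * gam.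
Proof.
move=> g0; rewrite /weight_coef mulrAC ler_pdivrMr; last first.
  by rewrite (lt_le_trans ltr01)// weight_ge1.
rewrite -enorm_sqr; have := sqr_ge0 (1 - gam * enorm x).
have n0 : (0 : R) <= n%:R by [].
have e0 := enorm_ge0 x.
move: (enorm x) (n%:R : R) n0 e0 => r k k0 r0 H.
rewrite (_ : 2 * k * _ * r = k * gam * (2 * (gam * r))); last by ring.
by rewrite ler_wpM2l ?mulr_ge0//; nra.
Qed.

Lemma weight_coef_continuous gam : continuous (weight_coef gam).
Proof.
move=> x.
have H : (1 + gam ^+ 2 * dot y y)^-1 @[y --> x] --> (1 + gam ^+ 2 * dot x x)^-1.
  apply: (@cvgV R _ (nbhs x) (nbhs_filter x)).
    by rewrite gt_eqF// (lt_le_trans ltr01)// weight_ge1.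
  apply: cvgD; first exact: cvg_cst.
  by apply: cvgM; [exact: cvg_cst|exact: continuous_dot_sqr].
exact: (cvgM (cvg_cst (2 * n%:R * gam ^+ 2)) H).
Qed.

Lemma weight_rdiff gam v : (0 < n)%N ->
  rdiff v (weight gam) (fun x => - (weight_coef gam x * dot x v * weight gam x)).
Proof.
move=> n0.
have dq : rdiff v (fun x => 1 + gam ^+ 2 * dot x x) (fun x => 0 + gam ^+ 2 * (2 * dot x v)).
  by apply: rdiffD; [exact: rdiff_cst|apply: rdiffZ; exact: rdiff_sqr].
have n1 : n = n.-1.+1 by rewrite prednK.
have dX := rdiffX n.-1 dq; rewrite -n1 in dX.
have dV := rdiffV dX (fun x => exprn_ege1 _ (weight_ge1 gam x)).
congr (rdiff _ _ _) : dV; apply/funext => x; congr (- _).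
have := weight_ge1 gam x.
rewrite /weight_coef /weight; set Q := 1 + _ => Q1.
have Q0 : Q != 0 by rewrite gt_eqF// (lt_le_trans ltr01).
have QE : Q ^+ n = Q * Q ^+ n.-1 by rewrite -exprS -n1.
have P0 : Q ^+ n.-1 != 0 by rewrite expf_neq0.
rewrite QE; move: (Q ^+ n.-1) P0 => P P0.
by field; rewrite Q0 P0.
Qed.

End cutoff.

(** * Absorption of the error terms *)

Section scalar_estimate.
Context (R : realType).

Lemma young_le (a b th : R) : 0 < th -> a * b <= th * a ^+ 2 + b ^+ 2 / (4 * th).
Proof.
move=> th0; have -> : th * a ^+ 2 + b ^+ 2 / (4 * th) = a * b + (2 * th * a - b) ^+ 2 / (4 * th).
  by field; rewrite gt_eqF.
by rewrite lerDl divr_ge0 ?sqr_ge0// mulr_ge0// ltW.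
Qed.

(** Here [D = |d|], [K] bounds [|<d|x>|] on the support of [t], [T] bounds [t], and [N], [M], [X]
    stand for the norms of the gradient difference, the flux difference and [x]. Three errors, each
    at most [D^2 t^2 / 4], are taken from [D^2 t^2]. Of the [2 kap g] coming from the equation, one
    [kap g] absorbs [t N] and the other absorbs the product of [M] with the cutoff terms. *)
Lemma scalar_estimate (C T K D : R) : 0 < C -> 0 < T -> 0 < K -> 0 < D ->
  exists nu kap C' e0 : R, [/\ 0 < nu <= 1, 0 <= kap, 0 < C', 0 < e0 &
    forall e t g N M X, 0 < e <= e0 -> 0 <= t <= T -> 0 <= g ->
      N <= C * (g + Num.sqrt g) -> 0 <= M <= C * (g + Num.sqrt g) ->
      0 <= X -> e * X ^+ 2 <= T ->
      D ^+ 2 / 4 * t ^+ 2 <= D ^+ 2 * t ^+ 2 - K * D * (3 * t * N + 6 * t * e * X + t ^+ 2 * nu) +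
        kap * (2 * g - M * (4 * e * X + t * nu)) + e * C'].
Proof.
move=> C0 T0 K0 D0.
(* Young's inequality is used with total weight 9, three times for [t N] and six for [t e X], and
   [9 K D th = D^2 / 4]. *)
pose th := D / (36 * K).
have th0 : 0 < th by rewrite divr_gt0// mulr_gt0.
have Kth : K * th = D / 36 by rewrite /th; field; rewrite gt_eqF.
pose Ct := T * C + C ^+ 2 / (4 * th).
have Ct0 : 0 < Ct.
  by apply: addr_gt0; [exact: mulr_gt0|apply: divr_gt0; [exact: exprn_gt0|exact: mulr_gt0]].
(* Exactly the coefficient of [g] left by [t N <= th t^2 + Ct g]. *)
pose kap := 3 * K * D * Ct.
have kap0 : 0 < kap by rewrite !mulr_gt0.
(* The last three bounds make, in turn, the weight term in the Poincare part, the weight term in the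
   equation, and [C T nu] small. The last one, with the choice of [e0], gives [C S <= 1/2] below. *)
pose nu := Num.min (Num.min 1 (D / (4 * K))) (Num.min (D ^+ 2 / (4 * (kap * C ^+ 2))) (4 * C * T)^-1).
have C20 : 0 < C ^+ 2 by rewrite exprn_gt0.
have nu0 : 0 < nu by rewrite !lt_min ltr01 !(divr_gt0, invr_gt0, mulr_gt0, exprn_gt0).
have [nu1 nu2 nu3 nu4] : [/\ nu <= 1, K * nu <= D / 4,
    kap * C ^+ 2 * nu <= D ^+ 2 / 4 & C * (T * nu) <= 4^-1].
  split.
  - by rewrite !ge_min lexx.
  - have : nu <= D / (4 * K) by rewrite !ge_min lexx !orbT.
    by rewrite ler_pdivlMr ?mulr_gt0//; lra.
  - have : nu <= D ^+ 2 / (4 * (kap * C ^+ 2)) by rewrite !ge_min lexx !orbT.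
    by rewrite ler_pdivlMr ?mulr_gt0//; lra.
  - have : nu <= (4 * C * T)^-1 by rewrite !ge_min lexx !orbT.
    by rewrite -[X in _ <= X]mul1r ler_pdivlMr ?mulr_gt0//; lra.
(* The choice of [e0] ensures [4 C e X <= 1/4], as [(e X)^2 <= e T]. The constant [C'] collects what
   is proportional to [e], and the added 1 makes it positive with room to spare. *)
exists nu, kap, (K * D * 6 * (T / (4 * th)) + kap * C ^+ 2 * 16 * T + 1), ((4 * (4 * C)) ^+ 2 * T)^-1.
split; [by rewrite nu0|exact: ltW|..].
- have A0 : 0 < T / (4 * th) by apply: divr_gt0 => //; exact: mulr_gt0.
  have h1 : 0 < K * D * 6 * (T / (4 * th)).
    by apply: mulr_gt0 => //; apply: mulr_gt0 => //; exact: mulr_gt0.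
  have h2 : 0 < kap * C ^+ 2 * 16 * T.
    by apply: mulr_gt0 => //; apply: mulr_gt0 => //; exact: mulr_gt0.
  lra.
- by rewrite invr_gt0 mulr_gt0 ?exprn_gt0 ?mulr_gt0.
have kapE : kap = 3 * K * D * Ct by [].
have CtE : Ct = T * C + C ^+ 2 / (4 * th) by [].
clearbody nu kap Ct th.
move=> e t g N M X /andP[e0 ee] /andP[t0 tT] g0 NC /andP[M0 MC] X0 eX.
have eT : e * T * (4 * (4 * C)) ^+ 2 <= 1.
  rewrite -mulrA [T * _]mulrC -ler_pdivlMr ?div1r//.
  by rewrite mulr_gt0 ?exprn_gt0 ?mulr_gt0.
have r2 := sqr_sqrtr g0; have r0 := sqrtr_ge0 g.
move: (Num.sqrt g) r2 r0 NC MC => r r2 r0 NC MC.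
have i1 : t * N <= th * t ^+ 2 + Ct * g.
  have h1 : t * N <= t * (C * (g + r)) by rewrite ler_wpM2l.
  have h2 : t * (C * g) <= T * (C * g) by rewrite ler_wpM2r// mulr_ge0// ltW.
  have h3 := young_le t (C * r) th0.
  have h4 : (C * r) ^+ 2 / (4 * th) = C ^+ 2 / (4 * th) * g by rewrite -r2; ring.
  by rewrite CtE mulrDl; move: (C ^+ 2 / (4 * th)) h4 => P h4; rewrite h4 in h3; lra.
have i2 : t * (e * X) <= th * t ^+ 2 + e * (T / (4 * th)).
  apply: le_trans (young_le _ _ th0) _; rewrite lerD2l [leRHS]mulrA ler_wpM2r//.
    by rewrite invr_ge0 mulr_ge0// ltW.
  by rewrite exprMn expr2 -mulrA ler_wpM2l// ltW.
pose S := 4 * e * X + t * nu.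
have S0 : 0 <= S by rewrite addr_ge0 ?mulr_ge0// ltW.
have eX2 : (e * X) ^+ 2 <= e * T by rewrite exprMn expr2 -mulrA ler_wpM2l// ltW.
have S2 : S ^+ 2 <= 32 * (e * T) + 2 * (t ^+ 2 * nu).
  have h1 : t ^+ 2 * nu ^+ 2 <= t ^+ 2 * nu.
    by rewrite ler_wpM2l ?sqr_ge0// expr2 ler_piMr// ltW.
  have := sqr_ge0 (4 * (e * X) - t * nu); rewrite /S; nra.
have CS : C * S <= 2^-1.
  have h1 : C * (4 * (e * X)) <= 4^-1.
    rewrite -(@ler_pXn2r _ 2)// ?nnegrE ?mulr_ge0 ?invr_ge0// ?(ltW C0) ?(ltW e0)//.
    rewrite !exprMn.
    have : C ^+ 2 * (e * X) ^+ 2 <= C ^+ 2 * (e * T) by rewrite ler_wpM2l// ltW.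
    by rewrite -exprMn; lra.
  have h2 : C * (t * nu) <= C * (T * nu) by rewrite ler_wpM2l ?(ltW C0)// ler_wpM2r// ltW.
  by rewrite /S; lra.
have i3 : M * S <= g + C ^+ 2 * (16 * (e * T) + t ^+ 2 * nu).
  have h1 : M * S <= C * (g + r) * S by rewrite ler_wpM2r.
  have h2 : g * (C * S) <= g * 2^-1 by rewrite ler_wpM2l.
  have h3 := sqr_ge0 (r - C * S).
  have h4 : C ^+ 2 * S ^+ 2 <= C ^+ 2 * (32 * (e * T) + 2 * (t ^+ 2 * nu)) by rewrite ler_wpM2l// ltW.
  rewrite -exprMn in h4; rewrite -r2 in h1 h2 *; lra.
have KD : 0 < K * D by rewrite mulr_gt0.
have j1 := ler_wpM2l (ltW KD) i1.
have j2 := ler_wpM2l (ltW KD) i2.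
have j3 := ler_wpM2l (ltW kap0) i3.
have tt : 0 <= t ^+ 2 by exact: sqr_ge0.
have j4 : K * D * (9 * th) * t ^+ 2 = D ^+ 2 / 4 * t ^+ 2
  by rewrite (_ : _ * t ^+ 2 = K * th * (9 * D * t ^+ 2)); [rewrite Kth; lra|ring].
have j5 : K * D * (t ^+ 2 * nu) <= D ^+ 2 / 4 * t ^+ 2.
  have := ler_wpM2r (mulr_ge0 (ltW D0) tt) nu2; lra.
have j6 : kap * C ^+ 2 * (t ^+ 2 * nu) <= D ^+ 2 / 4 * t ^+ 2.
  have := ler_wpM2r tt nu3; lra.
have j7 : kap * g = K * D * (3 * Ct * g) by rewrite kapE; ring.
rewrite -/S; move: (T / (4 * th)) j2 => Q j2.
have e1 := ltW e0.
clear i1 i2 i3 CS S2 eX2 S0 MC NC r2 r0 eT eX nu1 nu2 nu3 nu4 ee tT.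
lra.
Qed.

End scalar_estimate.

Section vector_estimate.
Context (R : realType) (n : nat).
Implicit Types (d x h v : 'rV[R]_n).

Lemma normr_dot_le v h : `|dot v h| <= enorm v * enorm h.
Proof.
rewrite ler_norml dot_le_enorm andbT lerNl -dotNl -[enorm v]enormN.
exact: dot_le_enorm.
Qed.

(** [F] is the gradient of the function whose positive part is [t], and [- c x chi] is that of
    [chi]. Both sums have the common factor [t chi]; Cauchy-Schwarz then reduces the claim to the
    scalar inequality multiplied by [t chi]. *)
Lemma vector_estimate d x h v (F : 'I_n -> R) (e t c chi nu K kap E : R) :
  (forall i, F i = - h ord0 i - e * (2 * x ord0 i)) ->
  0 <= t -> 0 <= chi -> 0 <= c -> 0 <= e -> 0 <= kap ->
  c * enorm x <= nu -> `|dot d x| <= K ->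
  enorm d ^+ 2 / 4 * t ^+ 2 <= enorm d ^+ 2 * t ^+ 2
    - K * enorm d * (3 * t * enorm h + 6 * t * e * enorm x + t ^+ 2 * nu)
    + kap * (2 * dot v h - enorm v * (4 * e * enorm x + t * nu)) + E ->
  enorm d ^+ 2 / 4 * (t ^+ 3 * chi) <=
    \sum_i d ord0 i * (dot d x * (3 * t ^+ 2 * F i * chi + t ^+ 3 * - (c * x ord0 i * chi))
                       + d ord0 i * (t ^+ 3 * chi))
    - kap * (\sum_i v ord0 i * (2 * t * F i * chi + t ^+ 2 * - (c * x ord0 i * chi)))
    + E * (t * chi).
Proof.
move=> FE t0 chi0 c0 e0 kap0 cx dx H.
have E2 : \sum_i d ord0 i * (dot d x * (3 * t ^+ 2 * F i * chi + t ^+ 3 * - (c * x ord0 i * chi))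
    + d ord0 i * (t ^+ 3 * chi)) =
    t * chi * (enorm d ^+ 2 * t ^+ 2 - dot d x * (3 * t * dot d h + (6 * t * e + t ^+ 2 * c) * dot d x)).
  rewrite enorm_sqr.
  transitivity (t * chi * (t ^+ 2 * dot d d + - (dot d x * (3 * t)) * dot d h
      + - (dot d x * (6 * t * e + t ^+ 2 * c)) * dot d x)); last by ring.
  have gen al be : t * chi * (t ^+ 2 * dot d d + al * dot d h + be * dot d x) =
      \sum_i t * chi * (t ^+ 2 * (d ord0 i * d ord0 i) + al * (d ord0 i * h ord0 i)
        + be * (d ord0 i * x ord0 i)).
    by rewrite /dot !mulr_sumr -!big_split mulr_sumr.
  rewrite gen; apply: eq_bigr => i _ /=.
  by rewrite FE; ring.
have E1 : \sum_i v ord0 i * (2 * t * F i * chi + t ^+ 2 * - (c * x ord0 i * chi)) =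
    - (t * chi * (2 * dot v h + (4 * e + t * c) * dot v x)).
  rewrite /dot !mulr_sumr -big_split mulr_sumr -sumrN; apply: eq_bigr => i _ /=.
  by rewrite FE; ring.
rewrite E2 E1.
have D0 := enorm_ge0 d; have X0 := enorm_ge0 x; have N0 := enorm_ge0 h; have M0 := enorm_ge0 v.
have dh := normr_dot_le d h; have dx2 := normr_dot_le d x; have vx := normr_dot_le v x.
have K0 : 0 <= K by exact: le_trans (normr_ge0 _) dx.
have b1 : dot d x * (3 * t * dot d h + (6 * t * e + t ^+ 2 * c) * dot d x) <=
    K * enorm d * (3 * t * enorm h + 6 * t * e * enorm x + t ^+ 2 * nu).
  apply: le_trans (ler_norm _) _; rewrite normrM -[leRHS]mulrA ler_pM//.
  apply: le_trans (ler_normD _ _) _; rewrite !normrM.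
  rewrite [`|6 * t * e + _|]ger0_norm ?addr_ge0 ?mulr_ge0//.
  rewrite [`|3|]ger0_norm// [`|t|]ger0_norm//.
  have t2 : 0 <= t ^+ 2 by exact: sqr_ge0.
  have h1 : 3 * t * `|dot d h| <= 3 * t * (enorm d * enorm h) by rewrite ler_wpM2l ?mulr_ge0.
  have h2 : (6 * t * e + t ^+ 2 * c) * `|dot d x| <= (6 * t * e + t ^+ 2 * c) * (enorm d * enorm x).
    by rewrite ler_wpM2l ?addr_ge0 ?mulr_ge0.
  have h3 : t ^+ 2 * enorm d * (c * enorm x) <= t ^+ 2 * enorm d * nu by rewrite ler_wpM2l ?mulr_ge0.
  lra.
have b2 : - (enorm v * (4 * e * enorm x + t * nu)) <= (4 * e + t * c) * dot v x.
  have h1 : (4 * e + t * c) * - dot v x <= (4 * e + t * c) * (enorm v * enorm x).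
    rewrite ler_wpM2l ?addr_ge0 ?mulr_ge0//; apply: le_trans vx.
    by rewrite -normrN; exact: ler_norm.
  have h2 : t * enorm v * (c * enorm x) <= t * enorm v * nu by rewrite ler_wpM2l ?mulr_ge0.
  lra.
have b3 := ler_wpM2l kap0 b2.
have tc : 0 <= t * chi by exact: mulr_ge0.
have := ler_wpM2l tc H; have := ler_wpM2l tc b1; have := ler_wpM2l tc b3.
lra.
Qed.

End vector_estimate.

Section null_integral.
Context (R : realType) (n : nat).
Local Notation mu := (lebesgue_rV R n).
Implicit Types (f g : 'rV[R]_n -> R).

Definition null_integral f := mu.-integrable setT (EFin \o f) /\ \int[mu]_x f x = 0.

Lemma null_integralD f g : null_integral f -> null_integral g ->
  null_integral (fun x => f x + g x).
Proof.
move=> [If f0] [Ig g0]; split; last by rewrite RintegralD// f0 g0 addr0.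
exact: (@eq_integrable _ _ _ _ _ measurableT (fun x => ((f x)%:E + (g x)%:E)%E)
  _ _ (integrableD measurableT If Ig)).
Qed.

Lemma null_integralZ c f : null_integral f -> null_integral (fun x => c * f x).
Proof.
move=> [If f0]; split; last by rewrite RintegralZl// f0 mulr0.
exact: (@eq_integrable _ _ _ _ _ measurableT (fun x => (c%:E * (f x)%:E)%E)
  _ _ (integrableZl measurableT c If)).
Qed.

Lemma null_integral_sum (I : Type) (s : seq I) (F : I -> 'rV[R]_n -> R) :
  (forall i, null_integral (F i)) -> null_integral (fun x => \sum_(i <- s) F i x).
Proof.
move=> F0; elim: s => [|i s IHs].
  rewrite (_ : (fun x => _) = fun=> 0); last by apply/funext => x; rewrite big_nil.
  by split; [exact: integrable0|rewrite /Rintegral integral0].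
rewrite (_ : (fun x => _) = (fun x => F i x + \sum_(j <- s) F j x)); last first.
  by apply/funext => x; rewrite big_cons.
exact: null_integralD.
Qed.

Lemma null_integral_le f g (c c' : R) h : null_integral h ->
  mu.-integrable setT (EFin \o f) -> mu.-integrable setT (EFin \o g) ->
  {ae mu, forall x, c * f x <= h x + c' * g x} ->
  c * \int[mu]_x f x <= c' * \int[mu]_x g x.
Proof.
move=> [Ih h0] If Ig le.
pose k x := h x + (c' * g x - c * f x).
have Ic a q : mu.-integrable setT (EFin \o q) -> mu.-integrable setT (EFin \o (fun x => a * q x)).
  by move=> Iq; exact: (@eq_integrable _ _ _ _ _ measurableT (fun x => (a%:E * (q x)%:E)%E)
    _ _ (integrableZl measurableT a Iq)).
have Id : mu.-integrable setT (EFin \o (fun x => c' * g x - c * f x)).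
  exact: (@eq_integrable _ _ _ _ _ measurableT (fun x => ((c' * g x)%:E - (c * f x)%:E)%E)
    _ _ (integrableB measurableT (Ic _ _ Ig) (Ic _ _ If))).
have kE : \int[mu]_x k x = c' * \int[mu]_x g x - c * \int[mu]_x f x.
  by rewrite RintegralD// h0 add0r RintegralB ?Ic// !RintegralZl.
have mk : measurable_fun setT k.
  apply: measurable_funD; first by have /measurable_int/measurable_EFinP := Ih.
  by have /measurable_int/measurable_EFinP := Id.
have : 0 <= \int[mu]_x k x.
  rewrite (@eq_Rintegral_ae _ _ _ mu setT k (fun x => `|k x|))//.
  - exact: Rintegral_ge0.
  - exact: measurableT_comp.
  - by apply: filterS le => x kx _; rewrite ger0_norm// /k; lra.
by rewrite kE; lra.
Qed.

End null_integral.

Section energy_estimate.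
Context (R : realType) (n : nat).
Local Notation mu := (lebesgue_rV R n).
Local Notation e_ := (@basis_rV R n).
Variables (b p : R) (u : 'rV[R]_n -> R).
Hypotheses (n0 : (0 < n)%N) (b0 : 0 < b) (p1 : 1 < p).
Hypothesis cu : forall (x y : 'rV[R]_n) (t : R), 0 <= t <= 1 ->
  u (t *: x + (1 - t) *: y) <= t * u x + (1 - t) * u y.
Hypothesis u_sol : weak_solution b p u.

Lemma lbounded_sum (I : Type) (r : seq I) (f : I -> 'rV[R]_n -> R) :
  (forall i, lbounded (f i)) -> lbounded (fun x => \sum_(i <- r) f i x).
Proof.
move=> fb; elim: r => [|i r IHr].
  by move=> s; exists 0 => x _; rewrite big_nil normr0.
rewrite (_ : (fun x => _) = (fun x => f i x + \sum_(j <- r) f j x)); last first.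
  by apply/funext => x; rewrite big_cons.
exact: lboundedD.
Qed.

Definition truncation (a : 'rV[R]_n) (T e : R) (x : 'rV[R]_n) : R :=
  Num.max 0 (T - (u x - dot a x) - e * dot x x).

Lemma truncation_ge0 a T e x : 0 <= truncation a T e x.
Proof. by rewrite /truncation le_max lexx. Qed.

Lemma truncation_arg_rdiff a T e v :
  rdiff v (fun x => T - (u x - dot a x) - e * dot x x)
    (fun x => dot a v - dd u v x - e * (2 * dot x v)).
Proof.
have d1 := rdiffD (rdiffD (rdiffD (rdiff_cst v T) (rdiffZ (-1) (convex_rdiff n0 cu v)))
  (rdiff_dot v a)) (rdiffZ (- e) (rdiff_sqr v)).
by congr (rdiff _ _ _) : d1; apply/funext => x; ring.
Qed.

Lemma truncation_continuous a T e : continuous (truncation a T e).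
Proof.
have [c _ _] := truncation_arg_rdiff a T e (0 : 'rV[R]_n).
have H : continuous (fun s : R => Num.max 0 s).
  by move=> s; apply: continuous_max; [exact: cvg_cst|exact: cvg_id].
by move=> x; apply: (@continuous_cvg _ _ _ (nbhs x) (nbhs_filter x) _ _ _ (H _) (c x)).
Qed.

Lemma truncation_support a T T1 e x : 0 < e -> 0 < T1 ->
  (forall x, T - (u x - dot a x) <= T1) -> 1 + T1 / e <= `|x| -> truncation a T e x = 0.
Proof.
move=> e0 T10 uT xs; rewrite /truncation max_l//.
have := uT x; have : T1 < e * dot x x; last by lra.
rewrite -enorm_sqr -ltr_pdivrMl// mulrC.
(* With [q = T1 / e] it remains to see that [(1 + q)^2 > q]. *)
have q0 : 0 < T1 / e by exact: divr_gt0.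
have : 1 + T1 / e <= enorm x by exact: le_trans xs (ler_norm_enorm x).
move: (T1 / e) (enorm x) q0 => q r q0 qr; nra.
Qed.

(** Two identities are combined pointwise: the integral of the divergence of [<d|x> t^3 chi d]
    vanishes, which is the Poincare inequality across the slab in differential form, and so does the
    difference of the two equations tested with [t^2 chi]. [Hest] bounds the combination from below
    by [|d|^2 t^3 chi / 4] up to an error [e C' t chi]. *)
Lemma energy_estimate (a d : 'rV[R]_n) (T T1 e nu kap C' gam : R) :
  let K := 3 * T1 in let Va := flux b (p - 1) a ((enorm a)^-1 *: a) in
  0 < e -> 0 < T1 -> 0 <= kap -> 0 <= C' -> 0 < gam <= 1 -> n%:R * gam <= nu ->
  (forall x, T - (u x - dot a x) <= T1) ->
  (forall x, `|dot d x| <= 3 * (T1 - (T - (u x - dot a x)))) ->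
  (forall x t z, differentiable_pt u x -> 0 <= t <= T1 -> e * enorm x ^+ 2 <= T1 ->
    enorm z <= 1 -> dot z (right_grad u x) = enorm (right_grad u x) ->
    let h := right_grad u x - a in let v := flux b (p - 1) (right_grad u x) z - Va in
    enorm d ^+ 2 / 4 * t ^+ 2 <= enorm d ^+ 2 * t ^+ 2
      - K * enorm d * (3 * t * enorm h + 6 * t * e * enorm x + t ^+ 2 * nu)
      + kap * (2 * dot v h - enorm v * (4 * e * enorm x + t * nu)) + e * C') ->
  enorm d ^+ 2 / 4 * \int[mu]_x (truncation a T e x ^+ 3 * weight gam x) <=
    e * C' * T1 * \int[mu]_x weight gam x.
Proof.
move=> K Va e0 T10 kap0 C'0 /andP[gam0 gam1] gnu uT duT Hest.
have [uae wE] := weak_equation n0 p1 cu u_sol.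
(* [t] vanishes from [|x| = s] on, and the last 1 in [rho] makes the strict inequality required by
   [weak_equation]. *)
pose s := 1 + T1 / e; pose rho := n%:R * (s + 1) + 1.
have s0 : 0 < s by rewrite addr_gt0// divr_gt0.
have rho0 : 0 < rho by rewrite ltr_wpDl// mulr_ge0// addr_ge0// ltW.
have [V [M [mV VM V0 Vae Veq]]] := wE rho rho0.
set t := truncation a T e; set chi := weight gam.
pose F v x := dot a v - dd u v x - e * (2 * dot x v).
pose c (x : 'rV[R]_n) := weight_coef gam x.
have dF v := truncation_arg_rdiff a T e v.
have tsupp x : s <= `|x| -> t x = 0 by exact: truncation_support.
have dchi v : rdiff v chi (fun x => - (c x * dot x v * chi x)) := weight_rdiff gam v n0.
pose w x := t x ^+ 2 * chi x.
pose w' i x := 2 * t x * F (e_ i) x * chi x + t x ^+ 2 * - (c x * dot x (e_ i) * chi x).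
have dw i : rdiff (e_ i) w (w' i).
  have := rdiffM (rdiff_posX 0 (dF (e_ i))) (dchi (e_ i)).
  by congr (rdiff _ _ _); apply/funext => x; rewrite /w' expr1.
pose y x := t x ^+ 3 * chi x.
pose y' i x := 3 * t x ^+ 2 * F (e_ i) x * chi x + t x ^+ 3 * - (c x * dot x (e_ i) * chi x).
have dy i : rdiff (e_ i) y (y' i) := rdiffM (rdiff_posX 1 (dF (e_ i))) (dchi (e_ i)).
have w0 x : s <= `|x| -> w x = 0 by move=> /tsupp; rewrite /w => ->; rewrite expr0n mul0r.
have y0 x : s <= `|x| -> y x = 0 by move=> /tsupp; rewrite /y => ->; rewrite expr0n mul0r.
have ct : continuous t := @truncation_continuous a T e.
have cchi : continuous chi := @weight_continuous R n gam.
have cX (f : 'rV[R]_n -> R) k : continuous f -> continuous (fun x => f x ^+ k).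
  move=> cf x.
  by apply: (@continuous_cvg _ _ _ (nbhs x) (nbhs_filter x) _ _ _ (@exprn_continuous R k (f x)) (cf x)).
have cw : continuous w by move=> x; exact: cvgM (cX t 2 ct x) (cchi x).
have cy : continuous y by move=> x; exact: cvgM (cX t 3 ct x) (cchi x).
have w's i x : s + 1 <= `|x| -> w' i x = 0.
  move=> xs; apply: (rdiff_support (dw i) w0); apply: le_trans xs.
  by rewrite lerD2l norm_basis.
have y's i x : s + 1 <= `|x| -> y' i x = 0.
  move=> xs; apply: (rdiff_support (dy i) y0); apply: le_trans xs.
  by rewrite lerD2l norm_basis.
have N1 : null_integral (fun x => \sum_i V x ord0 i * w' i x).
  split.
    apply: (lbounded_integrable (r := s + 1)).
    - by apply: measurable_sum => i; apply: measurable_funM => //; exact: rdiff_measurable (dw i).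
    - apply: lbounded_sum => i.
      by apply: lboundedM (rdiff_lbounded (dw i)) => r; exists M => x _.
    - by move=> x xs; rewrite big1// => i _; rewrite w's// mulr0.
  apply: (Veq w w' s) => //; last by rewrite /rho ltrDl.
  move=> x i dx.
  (* The only ingredient of [w'] that may be discontinuous; everything else is continuous on the
     whole space. *)
  have cdd : dd u (e_ i) z @[z --> x] --> dd u (e_ i) x := dd_continuous n0 cu dx (i:=i).
  have cdot : dot z (e_ i) @[z --> x] --> dot x (e_ i).
    rewrite dotC (_ : (fun z => dot z (e_ i)) = dot (e_ i)); first exact: continuous_dot.
    by apply/funext => z; rewrite dotC.
  have cF : F (e_ i) z @[z --> x] --> F (e_ i) x.
    exact: cvgB (cvgB (cvg_cst _) cdd) (cvgM (cvg_cst _) (cvgM (cvg_cst _) cdot)).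
  have cc : c z @[z --> x] --> c x := @weight_coef_continuous R n gam x.
  exact: cvgD (cvgM (cvgM (cvgM (cvg_cst _) (ct x)) cF) (cchi x))
    (cvgM (cX t 2 ct x) (cvgN (cvgM (cvgM cc cdot) (cchi x)))).
(* This is the equation for the linear function [<a|.>]: its flux [Va] is constant. *)
have N2 i : null_integral (w' i).
  split; last exact: rdiff_Rintegral (dw i) w0.
  exact: (lbounded_integrable (rdiff_measurable (dw i)) (rdiff_lbounded (dw i)) (@w's i)).
have N3 i : null_integral (fun x => dot d x * y' i x + d ord0 i * y x).
  have I1 : mu.-integrable setT (EFin \o (fun x => dot d x * y' i x)).
    apply: (lbounded_integrable (r := s + 1)).
    - apply: measurable_funM; last exact: rdiff_measurable (dy i).
      by apply: continuous_measurable_rV; exact: continuous_dot.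
    - apply: lboundedM (rdiff_lbounded (dy i)); apply: continuous_lbounded.
      exact: continuous_dot.
    - by move=> x xs; rewrite y's// mulr0.
  have I2 : mu.-integrable setT (EFin \o (fun x => d ord0 i * y x)).
    apply: (lbounded_integrable (r := s)).
    - by apply: measurable_funM => //; exact: continuous_measurable_rV.
    - by apply: lboundedM; apply: continuous_lbounded => //; exact: cst_continuous.
    - by move=> x xs; rewrite y0// mulr0.
  split.
    exact: (@eq_integrable _ _ _ _ _ measurableT (fun x => ((dot d x * y' i x)%:E + (d ord0 i * y x)%:E)%E)
      _ _ (integrableD measurableT I1 I2)).
  rewrite RintegralD// (rdiff_by_parts (rdiff_dot (e_ i) d) (dy i) y0).
  by rewrite dot_basis addNr.
(* Divergence of [<d|x> y d], minus [kap] times the difference of the two equations; the sign turns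
   the gap into a positive contribution, as the gradient of [t] contains [- (grad u - a)]. *)
pose h x := \sum_i d ord0 i * (dot d x * y' i x + d ord0 i * y x) +
  - kap * (\sum_i V x ord0 i * w' i x + \sum_i - Va ord0 i * w' i x).
have Nh : null_integral h.
  apply: null_integralD.
    by apply: null_integral_sum => i; apply: null_integralZ; exact: N3.
  apply: null_integralZ; apply: null_integralD => //.
  by apply: null_integral_sum => i; apply: null_integralZ; exact: N2.
have Ichi : mu.-integrable setT (EFin \o chi) by apply: weight_integrable; rewrite gam0.
have Iy : mu.-integrable setT (EFin \o y).
  apply: (lbounded_integrable (r := s)) => //; first exact: continuous_measurable_rV.
  exact: continuous_lbounded.
apply: (null_integral_le Nh Iy Ichi).
apply: filterS2 uae Vae => x dx Vx.
have chi0 : 0 <= chi x := ltW (weight_gt0 gam x).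
have t0 : 0 <= t x := truncation_ge0 a T e x.
have tT : t x <= T1.
  rewrite /t /truncation ge_max (ltW T10)/=; have := uT x.
  have : 0 <= e * dot x x by rewrite mulr_ge0 ?dot_ge0// ltW.
  lra.
have hE : h x = \sum_i d ord0 i * (dot d x * y' i x + d ord0 i * y x) -
    kap * (\sum_i (V x - Va) ord0 i * w' i x).
  rewrite /h mulNr; congr (_ - _ * _); rewrite -big_split; apply: eq_bigr => i _ /=.
  by rewrite !mxE mulrBl mulNr.
rewrite hE.
(* Where [t] vanishes both sums vanish too. Elsewhere [t x > 0] bounds [e |x|^2] by [T1] and
   [|<d|x>|] by [K], as required by [Hest]. *)
have [tx0|tx0] := eqVneq (t x) 0.
  rewrite big1 => [|i _]; last by rewrite /y' /y tx0 !(expr0n, mul0r, mulr0, addr0).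
  rewrite big1 => [|i _]; last by rewrite /w' tx0 !(expr0n, mul0r, mulr0, addr0).
  rewrite /y tx0 expr0n/= mul0r !mulr0 subr0 add0r.
  by rewrite !mulr_ge0// ltW.
have tpos : 0 < T - (u x - dot a x) - e * dot x x.
  by move: tx0; rewrite /t /truncation; case: ltP => //; rewrite eqxx.
have xs : `|x| < s by rewrite ltNge; apply/negP => /tsupp /eqP; rewrite (negbTE tx0).
have xD : eball rho x.
  apply: le_lt_trans (enorm_le_norm x) _; rewrite /rho.
  have : n%:R * `|x| <= n%:R * (s + 1) by rewrite ler_wpM2l//; lra.
  lra.
have eX : e * enorm x ^+ 2 <= T1 by rewrite enorm_sqr; have := uT x; lra.
have [z [z1 zH VE]] := Vx xD.
have dxK : `|dot d x| <= K.
  apply: le_trans (duT x) _; rewrite /K.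
  have : 0 <= e * dot x x by rewrite mulr_ge0 ?dot_ge0// ltW.
  lra.
have := Hest x (t x) z dx _ eX z1 zH; rewrite t0 tT => /(_ isT).
set H := right_grad u x; rewrite VE -/H => est.
have FE i : F (e_ i) x = - (H - a) ord0 i - e * (2 * x ord0 i).
  by rewrite /F !dot_basis !mxE; ring.
have cx : c x * enorm x <= nu by apply: le_trans gnu; exact: weight_coef_le (ltW gam0).
apply: le_trans (vector_estimate FE t0 chi0 (weight_coef_ge0 gam x) (ltW e0) kap0 cx dxK est) _.
apply: lerD; last first.
  by rewrite -[leRHS]mulrA ler_wpM2l ?mulr_ge0 ?(ltW e0)// ler_wpM2r.
apply: lerB.
  rewrite le_eqVlt; apply/orP; left; apply/eqP/eq_bigr => i _.
  by rewrite /y' /y dot_basis.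
rewrite le_eqVlt; apply/orP; left; apply/eqP; congr (_ * _); apply: eq_bigr => i _.
by rewrite /w' dot_basis.
Qed.

End energy_estimate.

(** * Gradients of solutions are constant *)

Section two_slopes.
Context (R : realType) (n : nat).
Local Notation mu := (lebesgue_rV R n).
Local Notation e_ := (@basis_rV R n).
Variables (b p : R) (u : 'rV[R]_n -> R).
Hypotheses (n0 : (0 < n)%N) (b0 : 0 < b) (p1 : 1 < p).
Hypothesis cu : forall (x y : 'rV[R]_n) (t : R), 0 <= t <= 1 ->
  u (t *: x + (1 - t) *: y) <= t * u x + (1 - t) * u y.
Hypothesis u_sol : weak_solution b p u.

(** The hypothesis says that the sublevel sets of [u - <a|.>] lie in slabs. The integral of
    [t^3 chi] is then at most a constant times [e], yet it does not decrease when [e] is lowered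
    from 1. *)
Lemma two_slopes_absurd (a d : 'rV[R]_n) (C0 : R) : a != 0 -> d != 0 ->
  (forall x, `|dot d x| <= 3 * (u x - dot a x + C0)) -> False.
Proof.
move=> a0 d0 slab.
(* The truncation equals 1 at the origin for every [e]; [T1] bounds it from above everywhere. *)
pose T := u 0 - dot a 0 + 1; pose T1 := T + C0.
have T10 : 0 < T1.
  have := slab 0; have := normr_ge0 (dot d 0); rewrite /T1 /T; lra.
have uT x : T - (u x - dot a x) <= T1.
  have := slab x; have := normr_ge0 (dot d x); rewrite /T1; lra.
have duT x : `|dot d x| <= 3 * (T1 - (T - (u x - dot a x))).
  by apply: le_trans (slab x) _; rewrite /T1; lra.
have D0 : 0 < enorm d by rewrite lt_neqAle eq_sym enorm_eq0 d0 enorm_ge0.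
have p10 : 0 < p - 1 by rewrite subr_gt0.
have [C Cpos gapP] := flux_gap b0 p10 a0.
have K0 : 0 < 3 * T1 by rewrite mulr_gt0.
have [nu [kap [C' [e0 [/andP[nu0 nu1] kap0 C'0 e00 est]]]]] := scalar_estimate Cpos T10 K0 D0.
pose gam := nu / n%:R.
have nR0 : (0 : R) < n%:R by rewrite ltr0n.
have ngam : n%:R * gam <= nu by rewrite /gam mulrCA divff ?mulr1// gt_eqF.
have gam01 : 0 < gam <= 1.
  rewrite /gam divr_gt0//= ler_pdivrMr// mul1r (le_trans nu1)//.
  by rewrite -[1]/(1%:R) ler_nat.
pose J := \int[mu]_x weight gam x.
have main e : 0 < e <= e0 ->
  enorm d ^+ 2 / 4 * \int[mu]_x (truncation u a T e x ^+ 3 * weight gam x) <= e * C' * T1 * J.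
  move=> ee0; have [epos _] := andP ee0.
  apply: (energy_estimate n0 p1 cu u_sol (d := d) epos T10 kap0 (ltW C'0) gam01 ngam uT duT).
  move=> x t z _ tT eX z1 zH; cbv zeta.
  have [g0 hC vC] := gapP _ _ z1 zH.
  apply: est ee0 tT g0 hC _ _ eX => //; [|exact: enorm_ge0].
  by rewrite enorm_ge0.
have tint e : 0 < e -> mu.-integrable setT (EFin \o (fun x => truncation u a T e x ^+ 3 * weight gam x)) /\
    continuous (fun x => truncation u a T e x ^+ 3 * weight gam x).
  move=> epos.
  have cy : continuous (fun x => truncation u a T e x ^+ 3 * weight gam x).
    move=> x; have ct := @truncation_continuous R n u n0 cu a T e.
    have cX : truncation u a T e z ^+ 3 @[z --> x] --> truncation u a T e x ^+ 3.
      exact: (@continuous_cvg _ _ _ (nbhs x) (nbhs_filter x) _ _ _ (@exprn_continuous R 3 _) (ct x)).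
    exact: (cvgM cX (@weight_continuous R n gam x)).
  split=> //; apply: (lbounded_integrable (r := 1 + T1 / e)).
  - exact: continuous_measurable_rV.
  - exact: continuous_lbounded.
  - by move=> x xs; rewrite (truncation_support epos T10 uT xs) expr0n mul0r.
pose Y := \int[mu]_x (truncation u a T 1 x ^+ 3 * weight gam x).
have Y0 : 0 < Y.
  have [It ct] := tint 1 ltr01.
  apply: (Rintegral_gt0 (x0 := 0)) => // [x|].
    by rewrite mulr_ge0 ?exprn_ge0 ?truncation_ge0 ?(ltW (weight_gt0 _ _)).
  rewrite mulr_gt0 ?weight_gt0// exprn_gt0// /truncation lt_max; apply/orP; right.
  by rewrite /T (_ : dot (0 : 'rV[R]_n) 0 = 0); [lra|apply/eqP; rewrite dot_eq0].
have J0 : 0 <= J by apply: Rintegral_ge0 => x _; exact: ltW (weight_gt0 _ _).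
pose Q := C' * T1 * J.
have Q0 : 0 <= Q by rewrite !mulr_ge0// ltW.
have S0 : 0 < enorm d ^+ 2 / 4 * Y by rewrite mulr_gt0// divr_gt0// exprn_gt0.
move: (enorm d ^+ 2 / 4) S0 main => D S0 main.
(* The estimate would give [D Y <= e Q], while this [e] has [e Q < D Y]. *)
pose e := Num.min (Num.min e0 1) (D * Y / (2 * (Q + 1))).
have Q1 : 0 < 2 * (Q + 1) by lra.
have epos : 0 < e by rewrite !lt_min e00 ltr01 divr_gt0.
have ee0 : e <= e0 by rewrite !ge_min lexx.
have e1 : e <= 1 by rewrite !ge_min lexx !orbT.
have eQ : e * (2 * (Q + 1)) <= D * Y by rewrite -ler_pdivlMr// !ge_min lexx !orbT.
have := main e; rewrite epos ee0 => /(_ isT).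
have : Y <= \int[mu]_x (truncation u a T e x ^+ 3 * weight gam x).
  apply: le_Rintegral => //; [by have [] := tint 1 ltr01|by have [] := tint e epos|].
  move=> x _; rewrite ler_wpM2r ?(ltW (weight_gt0 _ _))//.
  rewrite ler_pXn2r ?nnegrE ?truncation_ge0// /truncation.
  have := ler_wpM2r (dot_ge0 x) e1; rewrite mul1r => h.
  by rewrite ge_max le_max lexx/= le_max; apply/orP; right; lra.
have Dpos : 0 < D by rewrite -(pmulr_lgt0 _ Y0).
move=> /(ler_wpM2l (ltW Dpos)) h1 h2.
have eQ' : e * C' * T1 * J = e * Q by rewrite /Q; ring.
rewrite eQ' in h2; move: (\int[mu]_x _) h1 h2 => I h1 h2.
nra.
Qed.

End two_slopes.

Section affine.
Context (R : realType) (n : nat).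
Local Notation mu := (lebesgue_rV R n).
Implicit Types (x y a d : 'rV[R]_n).

Lemma ae_dense (P : 'rV[R]_n -> Prop) x (e : R) : 0 < e -> {ae mu, forall y, P y} ->
  exists2 y, P y & `|x - y| < e.
Proof.
move=> e0 [A [mA A0 PA]]; apply: contrapT => noP.
pose B := obox (fun i => x ord0 i - e) (fun i => x ord0 i + e).
have BA : B `<=` A.
  move=> y By; apply: PA => Py; apply: noP; exists y => //.
  apply/rV_norm_ltP => // i; have := By i; rewrite in_itv/= !mxE ltr_norml => /andP[? ?].
  by apply/andP; split; lra.
have : (0 < mu B)%E by apply: obox_gt0 => i; lra.
rewrite ltNge => /negP; apply; rewrite -A0; apply: le_measure => //; rewrite inE//.
exact: measurable_obox.
Qed.

Variable u : 'rV[R]_n -> R.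
Hypothesis n0 : (0 < n)%N.
Hypothesis cu : forall x y (t : R), 0 <= t <= 1 ->
  u (t *: x + (1 - t) *: y) <= t * u x + (1 - t) * u y.
Hypothesis uae : {ae mu, forall x, differentiable_pt u x}.

(** The subgradient inequality with slope [a] holds at a dense set of points and, by continuity of
    [u], at all points; taken between 0 and [x] in both directions it is an equality. *)
Lemma constant_gradient_affine a :
  (forall x, differentiable_pt u x -> right_grad u x = a) ->
  forall x, u x = dot a x + u 0.
Proof.
move=> Ha.
have sub x y : u x + dot a (y - x) <= u y.
  rewrite leNgt; apply/negP => lt.
  have cphi : continuous (fun z => u z + dot a y - dot a z).
    move=> z; have c1 := @convex_continuous R n u cu n0 z.
    have c2 := @continuous_dot R n a z.
    exact: (cvgB (cvgD c1 (cvg_cst (dot a y))) c2).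
  have : \forall z \near x, u y < u z + dot a y - dot a z.
    apply: (@cvgr_gt _ _ _ (nbhs_filter x) _ _ (cphi x)).
    by move: lt; rewrite dotDr dotNr; lra.
  move=> /nbhs_ballP[e /= e0 He].
  have [z dz xz] := ae_dense x e0 uae.
  have := He z; rewrite -ball_normE /= => /(_ xz).
  have := differentiable_subgradient n0 cu y dz; rewrite Ha// dotDr dotNr; lra.
move=> x; apply/eqP; rewrite eq_le; have := sub x 0; have := sub 0 x.
by rewrite subr0 sub0r dotNr => h1 h2; apply/andP; split; lra.
Qed.

(** With [a = l a1 + (1 - l) a2], the two supporting functions exceed [<a|.>] by [(1 - l) <d|.>] and
    by [- l <d|.>], up to constants. Both weights are at least 1/3, so [u - <a|.>] is at least
    [|<d|.>| / 3] minus a constant. *)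
Lemma distinct_gradients_slab x1 x2 : differentiable_pt u x1 -> differentiable_pt u x2 ->
  right_grad u x1 != right_grad u x2 ->
  exists a d (C : R), [/\ a != 0, d != 0 & forall x, `|dot d x| <= 3 * (u x - dot a x + C)].
Proof.
move=> d1 d2; set a1 := right_grad u x1; set a2 := right_grad u x2 => a12.
(* If the combinations for 1/2 and 2/3 both vanished, [a1] and [a2] would coincide. *)
have [l [l1 a0]] : exists l : R, 3^-1 <= l <= 2 / 3 /\ l *: a1 + (1 - l) *: a2 != 0.
  have [h|h] := eqVneq (2^-1 *: a1 + (1 - 2^-1) *: a2) 0; last first.
    by exists 2^-1; split => //; apply/andP; split; lra.
  exists (2 / 3); split; first by apply/andP; split; lra.
  apply: contra_neq a12 => h'; apply/rowP => i.
  move/rowP/(_ i) : h; move/rowP/(_ i) : h'; rewrite !mxE; lra.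
exists (l *: a1 + (1 - l) *: a2), (a1 - a2).
exists (`|dot a1 x1 - u x1| + `|dot a2 x2 - u x2|); split => //.
  by rewrite subr_eq0.
move=> x.
have := differentiable_subgradient n0 cu x d1; have := differentiable_subgradient n0 cu x d2.
rewrite -/a1 -/a2 !(dotDl, dotDr, dotNl, dotNr, dotZl).
have := ler_norm (dot a1 x1 - u x1); have := ler_norm (dot a2 x2 - u x2).
have := normr_ge0 (dot a1 x1 - u x1); have := normr_ge0 (dot a2 x2 - u x2).
move: (`|dot a1 x1 - u x1|) (`|dot a2 x2 - u x2|) => P Q.
move: (dot a1 x1) (dot a2 x2) (dot a1 x) (dot a2 x) => r1 r2 s1 s2 P0 Q0 h1 h2 h3 h4.
have /andP[l2 l3] := l1.
by rewrite ler_norml; apply/andP; split; nra.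
Qed.

End affine.

Unset Implicit Arguments.

Theorem theorem3 (R : realType) (n : nat) (b p : R) (u : 'rV[R]_n -> R)
    (n_gt0 : (0 < n)%N) (b_gt0 : 0 < b) (p_gt1 : 1 < p)
    (u_convex : convex_function [set: convex_lmodType 'rV[R]_n] u)
    (u_sol : weak_solution b p u) :
  [/\ facet u = set0 \/ facet u = setT,
      (exists x, forall y, u x <= u y) -> exists c, forall x, u x = c &
      ~ (exists x, forall y, u x <= u y) ->
        (exists (a : 'rV[R]_n) (c : R), forall x, u x = dot a x + c) /\
        ~ (exists c, forall x, u x = c)].
Proof.
have cu (x y : 'rV[R]_n) (t : R) : 0 <= t <= 1 ->
    u (t *: x + (1 - t) *: y) <= t * u x + (1 - t) * u y.
  move=> /andP[t0 t1].
  exact: (u_convex (Itv01 t0 t1) x y (in_setT _) (in_setT _)).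
have [uae _] := weak_equation n_gt0 p_gt1 cu u_sol.
have [a uE] : exists a, forall x, u x = dot a x + u 0.
  have [x1 d1 _] := ae_dense (0 : 'rV[R]_n) ltr01 uae.
  exists (right_grad u x1); apply: constant_gradient_affine => // x2 d2.
  apply/eqP; apply: contrapT => /negP d12.
  have [a [d [C [a0 d0 slab]]]] := distinct_gradients_slab n_gt0 cu d2 d1 d12.
  exact: (two_slopes_absurd n_gt0 b_gt0 p_gt1 cu u_sol a0 d0 slab).
(* Moving from a minimum point by [- a] lowers an affine function by [|a|^2], so the slope is 0. *)
have minE x : (forall y, u x <= u y) -> forall y, u y = u 0.
  move=> xmin; have := xmin (x - a); rewrite (uE x) (uE (x - a)) dotDr dotNr => le.
  have a0 : a = 0 by apply/eqP; rewrite -dot_eq0 eq_le dot_ge0 andbT; lra.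
  by move=> y; rewrite uE a0 -[X in dot X _](scale0r y) dotZl mul0r add0r.
split.
- have [[x xmin]|nomin] := pselect (exists x, forall y, u x <= u y).
    by right; apply/seteqP; split => // y _ z; rewrite !(minE x xmin).
  by left; apply/seteqP; split => // x xmin; apply: nomin; exists x.
- by move=> [x xmin]; exists (u 0); exact: minE xmin.
- move=> nomin; split; first by exists a, (u 0).
  by move=> [c uc]; apply: nomin; exists 0 => y; rewrite !uc.
Qed.
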